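(* Let $n\ge 2$, let $x_1<x_2<\dots<x_n$ be real numbers, let $f\in\mathbb R^n$, and let $q\ge 0$ be an integer. Algorithm 5 (written out in the context), applied to $f$ and $q$, produces a real number $h\ge 0$, an index set $I$ (with $\{1,n\}\subseteq I\subseteq\{1,\dots,n\}$), a piece set $S$ of $I$, and a well-defined vector $y^{q}=y(S)\in\mathbb R^n$ such that $$h=F(y^{q})=\inf F(Y_q)\qquad\text{and}\qquad y^{q}\in Y_q .$$
   Context: **Problem.** For $v\in\mathbb R^n$ let $F(v)=\|v-f\|_\infty$, and $$c_{ijk}(v)=\frac1{x_k-x_i}\left(\frac{v_k-v_j}{x_k-x_j}-\frac{v_j-v_i}{x_j-x_i}\right)\ (i<j<k),\qquad c_i(v)=c_{i,i+1,i+2}(v).$$ $Y_q$ is the set of $v\in\mathbb R^n$ for which the signs of the successive elements of the sequence $1,c_1(v),\dots,c_{n-2}(v)$ change at most $q$ times (zeros are ignored when counting sign changes). **Notation.** $[r,s]=\{j: r\le j\le s\}$. $g_{ik}(w)=(w_k-w_i)/(x_k-x_i)$; $g_{ik}$ alone means $g_{ik}(f)$. For a set $I$ of indices, $j^+(I)=\min\{i\in I:i>j\}$ and $j^-(I)=\max\{i\in I:i<j\}$; by convention, if $j\ge m=\max I$ then $j^+(I)=m^-(I)$. For $p\ne p'$, $f_j(p,p')=f_p+g_{pp'}(f)(x_j-x_p)$. If values $v_i$, $i\in I$, are given with $I$ containing the endpoints of a range, $v_j(I)$ equals $v_j$ for $j\in I$ and is otherwise the linear interpolant between the neighbours $j^-(I),j^+(I)$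 of $j$ in $I$. **Optimal vertex sets and prices.** For $r\le s$ and $\sigma\in\{+,-\}$ (identified with $\pm1$), $I^\sigma(r,s)$ is the set consisting of $r$, $s$ and all $j$ with $r<j<s$ such that $\sigma c_{ijk}(f)>0$ for all $i,k$ with $r\le i<j<k\le s$ (indices of the vertices of the lower ($\sigma=+$) or upper ($\sigma=-$) boundary of the convex hull of the points $(x_j,f_j)$, $r\le j\le s$). Put $h^\sigma(r,s)=\frac12\max_{j\in[r,s]}\sigma\,(f_j-f_j(I^\sigma(r,s)))$ when $r\le s$, and $h^\sigma(r,s)=0$ when $r\ge s-1$. **Algorithm 2, Steps 2–8** (acting on $s,t,h,I$). - Step 2. If $s\ge t-1$: stop. Otherwise set $u:=t-s$ and $I':=I^+(s,t)$. - Step 3. Let $s^+=s^+(I')$; set $h':=\max(h,h^+(s,s^+))$. If $f_t(s,s^+)>f_t-2h'$: go to Step 5. - Step 4. Add $s^+$ to $I$, delete $s$ from $I'$, set $h:=h'$, $s:=s^+$. If $s<t-1$: go to Step 3. - Step 5. If $s=t$: stop. Otherwise set $I':=I^-(s,t)$. - Step 6. Let $t^-=t^-(I')$; set $h':=\max(h,h^-(t^-,t))$. If $f_s(t^-,t)<f_s+2h'$: go to Step 8. - Step 7. Add $t^-$ to $I$, delete $t$ from $I'$, set $h:=h'$, $t:=t^-$. If $s<t$: go to Step 6. - Step 8. If $t-s=u$: stop. Otherwise go to Step 2. **Piece sets.** A piece set $S$ of $I$ is an ordered list $s_1\le s_2\le\dots$ of elements of $I$ whose last element is $n$; $s_\alpha$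 is its $\alpha$th element, $|S|$ its length, and $q'=|S|-1$ (repetitions can occur only when $h=0$). **closejoin($\alpha$)** (modifies $h,I,S$). (1) If $\alpha$ is even replace $f$ by $-f$; set $s=s_\alpha$, $t=s_\alpha^+(I)$. (2) Carry out Steps 2–8 of Algorithm 2, starting with the current $h$ and $I$. (3) Set $s_\alpha=s$; if $\alpha$ is even replace $f$ by $-f$. **Price of a piece set.** With $t_0=1$ and $t_\alpha=s_\alpha^+(I)$ for $1\le\alpha\le q'$, $$h(S)=\max\{h^{(-)^{\alpha-1}}(t_{\alpha-1},s_\alpha):1\le\alpha\le q'+1\},$$ where $(-)^{\alpha-1}$ is $+$ for $\alpha$ odd and $-$ for $\alpha$ even. When $h(S)>0$, $j^\star(S)$ is the lowest index $j$ such that $h(S)=\frac12\sigma(f_j-f_j(k,k^+))$, where $\sigma=(-1)^{\beta-1}$ for some $1\le\beta\le q'+1$ and $k,k^+$ are consecutive elements of $I$ with $t_{\beta-1}\le k<j<k^+\le s_\beta$. **Join gradients.** With $s=s_\alpha$, $t=s_\alpha^+(I)$: $g^{(\alpha)}(S,h)=\dfrac{f_t-f_s-2(-1)^{\alpha-1}h}{x_t-x_s}$. **The vector $y(S)$.** Let $q'=|S|-1$, $t_0=1$ and, for $1\le\alpha\le q'$, $t_\alpha=s_\alpha^+(I)$ if $h>0$ and $t_\alpha=s_\alpha$ if $h=0$. Let $P_\alpha=[t_{\alpha-1},s_\alpha]$ for $1\le\alpha\le q'+1$. Then $y_i=f_i+(-1)^{\alpha-1}h$ for $i\in I\cap P_\alpha$,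 $1\le\alpha\le q'+1$, and $y_j=y_j(I)$ for $1\le j\le n$. **Algorithm 5.** - Step 1. Set $\bar q=q$ modulo $2$. If $\bar q=0$: set $S:=\{n\}$, $I:=I^+(1,n)$, $h:=h^+(1,n)$. Otherwise set $S:=\{1,n\}$, $I:=\{1,n\}$, $h:=0$ and call closejoin(1). - Step 2. If $\bar q=q$ or $h=0$: stop. Otherwise set $j:=j^\star(S)$, $k:=j^-(I)$, insert $j$ into $I$, insert $j$ and $k$ into $S$, increase $\bar q$ by $2$, and set $h:=h(S)$. Set $h':=h$, $I':=I$, $S':=S$ (with elements $s'_\alpha$), $\gamma:=1$. - Step 3. For $\alpha=1$ to $\bar q$: apply closejoin($\alpha$); if $h$ has increased set $\bar\alpha:=\alpha$; if $h=0$ set $\gamma:=\alpha+1$. After the loop: if $h=h'$ return to Step 2; otherwise set $\alpha:=1$ and go to Step 4. - Step 4. If $\alpha<\gamma$: go to Step 5. If $\alpha=\bar\alpha$: return to Step 2. Calculate $g=g^{(\alpha)}(S,h)$. If $s_\alpha>s'_\alpha$ and $(-1)^{\alpha-1}g_{s_\alpha^-(I)\,s_\alpha}>(-1)^{\alpha-1}g$: go to Step 5. Set $t:=s_\alpha^+(I)$ and $t^+:=t^+(I)$. If $t<{s'_\alpha}^{+}(I')$ and $(-1)^{\alpha-1}g_{t\,t^+}>(-1)^{\alpha-1}g$: go to Step 5. Increase $\alpha$ by $1$ and repeat this step. - Step 5. Set $s_\alpha:=s'_\alpha$, delete all elements of $I$ lying strictly between $s_\alpha$ and $s_\alpha^+(I')$,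 and call closejoin($\alpha$). Increase $\alpha$ by $1$ and return to Step 4. $y^q$ is the value of $y(S)$ when the algorithm stops. *)

(* Defs.v *)
From mathcomp Require Import all_boot all_order all_algebra.
From mathcomp Require Import all_classical all_reals all_analysis.
From mathcomp Require qe_rcf_th.
Set Implicit Arguments.
Unset Strict Implicit.
Unset Printing Implicit Defensive.
Import Order.TTheory GRing.Theory Num.Theory.
Import numFieldNormedType.Exports.
Local Open Scope ring_scope.

(* A problem with n+1 data points is indexed by 'I_n.+1: the indices           *)
(* 1, ..., n of the usual presentation are 0, ..., n here, the first one being *)
(* ord0 and the last one ord_max.  The elements s_1, s_2, ... of a piece set   *)
(* are still numbered from 1: s_a is the item at position a.-1.  The sets I    *)
(* and S are called II and SS, I and S being constructors.                     *)

(* A transition function [next] returns None when it needs the value of an     *)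
(* undefined expression; [run next N st] is None if such an expression is met, *)
(* or if the machine has not stopped after N transitions.                      *)
Notation goto st := (Some (inl st)).
Notation stop out := (Some (inr out)).
Definition bind (A B : Type) (o : option A) (g : A -> option B) : option B :=
  obind g o.
Notation "'let?' p := o 'in' e" := (bind o (fun p => e))
  (at level 200, p strict pattern, o at level 200, e at level 200).

Fixpoint run (T A : Type) (next : T -> option (T + A)) (N : nat) (st : T) :
    option A :=
  if N is N'.+1 then
    let? r := next st in
    match r with inl st' => run next N' st' | inr out => Some out end
  else None.

Section IndexSets.
Variable n : nat.
Implicit Types (I : {set 'I_n.+1}) (j : 'I_n.+1).

Definition omin I : option 'I_n.+1 :=
  [pick i in I | [forall k in I, (i <= k)%N]].
Definition omax I : option 'I_n.+1 :=
  [pick i in I | [forall k in I, (k <= i)%N]].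

Definition pred_in I j := omax [set i in I | (i < j)%N].

(* If j lies at or after m = max I, the successor of j is by convention the   *)
(* predecessor of m.  It is defined for all j as soon as I has two elements.  *)
Definition succ_in I j :=
  let? m := omax I in
  if (m <= j)%N then pred_in I m else omin [set i in I | (j < i)%N].

End IndexSets.

Section Minimax.
Variables (R : realType) (n : nat).
Variable x : 'rV[R]_n.+1.
Implicit Types (v w f y : 'rV[R]_n.+1) (II : {set 'I_n.+1}).
Implicit Types (i j k r s t p : 'I_n.+1) (sigma h : R) (SS : seq 'I_n.+1).

(* The norm of 'rV[R]_n.+1 is the maximum norm. *)
Definition F f v : R := `|v - f|.

Definition cdiff v i j k : R :=
  (x 0 k - x 0 i)^-1 *
  ((v 0 k - v 0 j) / (x 0 k - x 0 j) - (v 0 j - v 0 i) / (x 0 j - x 0 i)).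

Definition cseq v : seq R :=
  [seq cdiff v (inord i) (inord i.+1) (inord i.+2) |
    i : nat <- iota 0 n.-1].

(* [changes] counts the pairs of successive items of opposite signs. *)
Definition sign_changes v : nat :=
  qe_rcf_th.changes [seq c : R <- 1 :: cseq v | c != 0].

Definition Y (q : nat) : set 'rV[R]_n.+1 := [set v | (sign_changes v <= q)%N].

Definition grad w i k : R := (w 0 k - w 0 i) / (x 0 k - x 0 i).

Definition line w j p p' : R := w 0 p + grad w p p' * (x 0 j - x 0 p).

(* Only used for sets I containing indices on both sides of j; the value 0 in *)
(* the other cases is irrelevant.                                             *)
Definition interp v II j : R :=
  if j \in II then v 0 j else
  if (pred_in II j, succ_in II j) is (Some p, Some p') then line v j p p' else 0.

(* Here and in [price] the sign sigma is the real number 1 or -1. *)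
Definition hull sigma w r s : {set 'I_n.+1} :=
  [set j : 'I_n.+1 | [&& (r <= j)%N, (j <= s)%N &
    [|| j == r, j == s |
      [forall i : 'I_n.+1, forall k : 'I_n.+1,
         [&& (r <= i)%N, (i < j)%N, (j < k)%N & (k <= s)%N] ==>
         (0 < sigma * cdiff w i j k)]]]].

(* The term of index r is 0, so that starting the maximum from 0 is harmless  *)
(* if r <= s; it gives the value 0 if r > s.                                  *)
Definition price sigma w r s : R :=
  2^-1 * \big[Num.max/0]_(j : 'I_n.+1 | (r <= j)%N && (j <= s)%N)
           (sigma * (w 0 j - interp w (hull sigma w r s) j)).

(* [AtK s t h II ...] is the state in which step K of the joining procedure is *)
(* about to be executed, steps 4 and 7 being the "otherwise" branches of steps *)
(* 3 and 6.  J is the set called I' there; it is local to the procedure, and   *)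
(* distinct from the saved set II0 below.                                      *)
Inductive state2 :=
| At2 of 'I_n.+1 & 'I_n.+1 & R & {set 'I_n.+1}
| At3 of 'I_n.+1 & 'I_n.+1 & R & {set 'I_n.+1} & nat & {set 'I_n.+1}
| At5 of 'I_n.+1 & 'I_n.+1 & R & {set 'I_n.+1} & nat
| At6 of 'I_n.+1 & 'I_n.+1 & R & {set 'I_n.+1} & nat & {set 'I_n.+1}
| At8 of 'I_n.+1 & 'I_n.+1 & R & {set 'I_n.+1} & nat.

Definition next2 w (st : state2) :
    option (state2 + 'I_n.+1 * 'I_n.+1 * R * {set 'I_n.+1}) :=
  match st with
  | At2 s t h II =>
      if (t <= s.+1)%N then stop (s, t, h, II)
      else goto (At3 s t h II (t - s)%N (hull 1 w s t))
  | At3 s t h II u J =>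
      let? s1 := succ_in J s in
      let h1 := Num.max h (price 1 w s s1) in
      if w 0 t - 2 * h1 < line w t s s1 then goto (At5 s t h II u)
      else if (s1.+1 < t)%N then goto (At3 s1 t h1 (s1 |: II) u (J :\ s))
      else goto (At5 s1 t h1 (s1 |: II) u)
  | At5 s t h II u =>
      if s == t then stop (s, t, h, II)
      else goto (At6 s t h II u (hull (-1) w s t))
  | At6 s t h II u J =>
      let? t1 := pred_in J t in
      let h1 := Num.max h (price (-1) w t1 t) in
      if line w s t1 t < w 0 s + 2 * h1 then goto (At8 s t h II u)
      else if (s < t1)%N then goto (At6 s t1 h1 (t1 |: II) u (J :\ t))
      else goto (At8 s t1 h1 (t1 |: II) u)
  | At8 s t h II u =>
      if (t - s)%N == u then stop (s, t, h, II) else goto (At2 s t h II)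
  end.

Variable f : 'rV[R]_n.+1.

Definition closejoin (N a : nat) h II SS : option (R * {set 'I_n.+1} * seq 'I_n.+1) :=
  let? s := onth SS a.-1 in
  let? t := succ_in II s in
  let? (s1, t1, h1, II1) :=
    run (next2 (if odd a then f else - f)) N (At2 s t h II) in
  Some (h1, II1, set_nth ord0 SS a.-1 s1).

Definition piece_set II SS : Prop :=
  [/\ sorted (fun i j : 'I_n.+1 => (i <= j)%N) SS, {subset SS <= II},
      SS != [::] & last ord0 SS = ord_max].

(* The pairs (t_(a-1), s_a).  The default of odflt is irrelevant: [closejoin]  *)
(* fails if II has fewer than two elements.                                    *)
Definition pieces II SS : seq ('I_n.+1 * 'I_n.+1) :=
  zip (ord0 :: [seq odflt s (succ_in II s) | s <- SS]) SS.

(* In [piece_price] and [jstar], b = a - 1 is the position of the piece a. *)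
Definition piece_price II SS : R :=
  \big[Num.max/0]_(b < size SS)
    let P := nth (ord0, ord0) (pieces II SS) b in price ((-1) ^+ b) f P.1 P.2.

Definition jstar II SS : option 'I_n.+1 :=
  if 0 < piece_price II SS then
    omin [set j : 'I_n.+1 |
      [exists b : 'I_(size SS), exists k : 'I_n.+1, exists k1 : 'I_n.+1,
        let P := nth (ord0, ord0) (pieces II SS) b in
        [&& k \in II, succ_in II k == Some k1,
            (P.1 <= k)%N, (k < j)%N, (j < k1)%N, (k1 <= P.2)%N &
            piece_price II SS ==
              2^-1 * ((-1) ^+ b * (f 0 j - line f j k k1))]]]
  else None.

Definition join_grad (a : nat) h s t : R :=
  (f 0 t - f 0 s - 2 * (-1) ^+ a.-1 * h) / (x 0 t - x 0 s).

(* The steps of the main algorithm.  qb, ab and c stand for \bar q,            *)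
(* \bar\alpha and \gamma (ab is None until it is set); h0, II0, SS0 are the    *)
(* values saved as h', I', S'.                                                 *)
Inductive state5 :=
| Main2 of nat & R & {set 'I_n.+1} & seq 'I_n.+1
| Main3 (qb a : nat) (ab : option nat) (c : nat)
    (h : R) (II : {set 'I_n.+1}) (SS : seq 'I_n.+1)
    (h0 : R) (II0 : {set 'I_n.+1}) (SS0 : seq 'I_n.+1)
| Main4 (qb a : nat) (ab : option nat) (c : nat)
    (h : R) (II : {set 'I_n.+1}) (SS : seq 'I_n.+1)
    (II0 : {set 'I_n.+1}) (SS0 : seq 'I_n.+1)
| Main5 (qb a : nat) (ab : option nat) (c : nat)
    (h : R) (II : {set 'I_n.+1}) (SS : seq 'I_n.+1)
    (II0 : {set 'I_n.+1}) (SS0 : seq 'I_n.+1).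

Definition next5 (q N : nat) (st : state5) :
    option (state5 + R * {set 'I_n.+1} * seq 'I_n.+1) :=
  match st with
  | Main2 qb h II SS =>
      if (qb == q) || (h == 0) then stop (h, II, SS) else
      let? j := jstar II SS in
      let? k := pred_in II j in
      let II1 := j |: II in
      let SS1 := sort (fun i j : 'I_n.+1 => (i <= j)%N) [:: j, k & SS] in
      let h1 := piece_price II1 SS1 in
      goto (Main3 qb.+2 1 None 1 h1 II1 SS1 h1 II1 SS1)
  | Main3 qb a ab c h II SS h0 II0 SS0 =>
      if (a <= qb)%N then
        let? (h1, II1, SS1) := closejoin N a h II SS in
        goto (Main3 qb a.+1 (if h < h1 then Some a else ab)
                (if h1 == 0 then a.+1 else c) h1 II1 SS1 h0 II0 SS0)
      else if h == h0 then goto (Main2 qb h II SS)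
      else goto (Main4 qb 1 ab c h II SS II0 SS0)
  | Main4 qb a ab c h II SS II0 SS0 =>
      if (a < c)%N then goto (Main5 qb a ab c h II SS II0 SS0)
      else if ab == Some a then goto (Main2 qb h II SS) else
      let sgn := (-1) ^+ a.-1 in
      let? s := onth SS a.-1 in
      let? s0 := onth SS0 a.-1 in
      let? t := succ_in II s in
      let? t0 := succ_in II0 s0 in
      let g := join_grad a h s t in
      let? left_bad :=
        if (s0 < s)%N then
          let? sm := pred_in II s in Some (sgn * g < sgn * grad f sm s)
        else Some false in
      if left_bad then goto (Main5 qb a ab c h II SS II0 SS0) else
      let? t1 := succ_in II t in
      if (t < t0)%N && (sgn * g < sgn * grad f t t1)
      then goto (Main5 qb a ab c h II SS II0 SS0)
      else goto (Main4 qb a.+1 ab c h II SS II0 SS0)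
  | Main5 qb a ab c h II SS II0 SS0 =>
      let? s0 := onth SS0 a.-1 in
      let? t0 := succ_in II0 s0 in
      let? (h1, II1, SS1) :=
        closejoin N a h (II :\: [set i : 'I_n.+1 | (s0 < i < t0)%N])
          (set_nth ord0 SS a.-1 s0) in
      goto (Main4 qb a.+1 ab c h1 II1 SS1 II0 SS0)
  end.

(* N bounds the number of transitions of each machine; see [algorithm5_mono]. *)
Definition algorithm5 (q N : nat) : option (R * {set 'I_n.+1} * seq 'I_n.+1) :=
  if odd q then
    let? (h, II, SS) :=
      closejoin N 1 0 [set ord0; ord_max] [:: ord0; ord_max] in
    run (next5 q N) N (Main2 1 h II SS)
  else
    run (next5 q N) N
      (Main2 0 (price 1 f ord0 ord_max) (hull 1 f ord0 ord_max) [:: ord_max]).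

(* The end points of the ranges P_1, P_2, ... *)
Definition ypieces h II SS : seq ('I_n.+1 * 'I_n.+1) :=
  if 0 < h then pieces II SS else zip (ord0 :: SS) SS.

(* y satisfies the equations that define y(S). *)
Definition is_y h II SS y : Prop :=
  (forall (b : 'I_(size SS)) (i : 'I_n.+1),
     let P := nth (ord0, ord0) (ypieces h II SS) b in
     i \in II -> (P.1 <= i <= P.2)%N -> y 0 i = f 0 i + (-1) ^+ b * h) /\
  (forall j, y 0 j = interp y II j).

End Minimax.

Lemma run_mono (T A : Type) (g1 g2 : T -> option (T + A)) (N M : nat) st out :
  (forall u r, g1 u = Some r -> g2 u = Some r) -> (N <= M)%N ->
  run g1 N st = Some out -> run g2 M st = Some out.
Proof.
move=> g12; elim: N M st => [|N IHN] [|M] //= st le_NM.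
by case E: (g1 st) => [[st'|a]|//] /=; rewrite (g12 _ _ E) //=; apply: IHN.
Qed.

Lemma bind_mono (T A : Type) (f1 f2 : T -> option A) (o1 o2 : option T) out :
  (forall u, o1 = Some u -> o2 = Some u) ->
  (forall u, f1 u = Some out -> f2 u = Some out) ->
  bind o1 f1 = Some out -> bind o2 f2 = Some out.
Proof. by move=> o12 f12; case: o1 o12 => //= u /(_ u erefl) -> /=; apply: f12. Qed.

Section Mono.
Variables (R : realType) (n : nat) (x f : 'rV[R]_n.+1) (q N M : nat).
Hypothesis le_NM : (N <= M)%N.

Lemma closejoin_mono a h II SS out :
  closejoin x f N a h II SS = Some out -> closejoin x f M a h II SS = Some out.
Proof.
do 2![apply: bind_mono => // ?]; apply: bind_mono => // ?.
exact: run_mono.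
Qed.

Lemma next5_mono st r :
  next5 x f q N st = Some r -> next5 x f q M st = Some r.
Proof.
case: st => [//|qb a ab c h II SS h0 II0 SS0|//|qb a ab c h II SS II0 SS0] /=.
- by case: ifP => // _; apply: bind_mono => // ?; apply: closejoin_mono.
- do 2![apply: bind_mono => // ?]; apply: bind_mono => // ?.
  exact: closejoin_mono.
Qed.

Lemma algorithm5_mono out :
  algorithm5 x f q N = Some out -> algorithm5 x f q M = Some out.
Proof.
rewrite /algorithm5; case: ifP => _; last exact: run_mono next5_mono le_NM.
apply: bind_mono => [u|[[h II] SS]]; first exact: closejoin_mono.
exact: run_mono next5_mono le_NM.
Qed.

End Mono.

(* Main.v *)
Require Import Defs.
From mathcomp Require Import all_boot all_order all_algebra.
From mathcomp Require Import all_classical all_reals all_analysis.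
From mathcomp Require Import ring lra zify.
Set Implicit Arguments.
Unset Strict Implicit.
Unset Printing Implicit Defensive.
Import Order.TTheory GRing.Theory Num.Theory.
Import numFieldNormedType.Exports.
Local Open Scope ring_scope.

(* Call a state (h, I, S) good if the polygon y(S) stays within h of f and is  *)
(* alternately convex and concave on the successive pieces, each taken with    *)
(* the joins next to it; y(S) has then at most |S| - 1 sign changes.           *)
(*                                                                             *)
(* Inserting an index j at which h is attained, and its predecessor k, leaves  *)
(* the polygon unchanged at the old value H of h: the point (j, f_j - h) of    *)
(* the new piece lies on the old edge.  The joins are then closed from the     *)
(* lower price h(S) upwards, each within its own gap of I.  Both ends of a     *)
(* closed join are stuck, which means that the data between them lie strictly  *)
(* inside the strip of width 2h spanned by the join; and no price can exceed   *)
(* H, because the old edges confine the data to a strip of width 2H.  A join   *)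
(* closed at a value below the final h violates only the slope conditions      *)
(* tested in step 4; closing it again at the final h does not raise h, since   *)
(* its end points cannot leave the chains that it had built before.  Hence     *)
(* all joins end up closed at one value of h, and the state is good again.     *)
(*                                                                             *)
(* For optimality, insert j and k once more.  If F(v) < h, the slopes of v     *)
(* over the q + 2 joins are forced to rise and fall alternately, so v has more *)
(* than q sign changes.                                                        *)

(** Let [U b] be the data multiplied by (-1)^b, pieces and joins being counted from 0. In this
    orientation piece b is convex, and turning abscissas and values around together ([negf X],
    [negf W]) exchanges the two ends of a join. One argument thus serves lower and upper hulls, left
    and right moves, odd and even joins.

    Feasibility. In a [good] state the second differences of the polygon y(S) at the points of piece
    b have the sign (-1)^b or vanish, except possibly at elements of S when h = 0. Hence 1, c_1, ...
    changes sign at most |S| - 1 times ([yfull_changes]). Every datum is within h of the polygon,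
    and the points of I are at distance exactly h, so F(y(S)) = h ([yfull_dist]).

    Optimality. If h > 0, some edge inside a piece lies h above the data at its ends and h below
    them at an inner index j, in the orientation of the piece. The point at j, h away from the datum
    on the other side, is then on the polygon. Splitting the piece there gives a good state with the
    same h and two more joins ([jstar_spec], [good_insert]). In orientation b, a vector v with F(v)
    < h is below the polygon on piece b and above it on piece b+1, so its slope over join b exceeds
    that of the polygon. The polygon's slopes are monotone from one join to the next
    ([join_slope_le]), so between successive joins v has a second difference of prescribed,
    alternating sign. This is one sign change too many ([good_lower], [main_lower]).

    Progress. Each round of the algorithm must end in a good state whose h is attained. After the
    insertion the state is good at the old value H, and the joins are closed in disjoint gaps of I.
    The invariant [join_inv] of one closing is kept by moves of the left end ([join_inv_lmove]) and,
    by the half-turn, of the right end; when both ends are stuck, the data between them lie strictly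
    inside the strip of the join ([stuck_tube]). No value of h exceeds H ([closed_join_le]). Once
    all joins are closed at a common h, [assemble] gives goodness: within a gap from [join_inv], at
    the ends of a gap by comparing the slopes of the new edges with the old join, elsewhere by
    inheritance. A join closed below the final h either passes the slope tests and is then also
    closed at h ([closed_join_raise]), or is closed again; the second closing retraces the chains of
    the first, so h does not rise ([rerun_lmove]). *)

Section Affine.
Variables (R : realFieldType) (T : finType).
Implicit Types (X W D : T -> R) (i j k p s t z : T) (I : {set T}) (h : R).

(** * Affine functions, secants and strict convexity *)

Definition negf X := fun i => - X i.

Definition seg X W p q z := W p + (W q - W p) / (X q - X p) * (X z - X p).

Definition aff X D := exists a b, forall z, D z = a + b * X z.

Lemma aff_seg X W p q : aff X (seg X W p q).
Proof.
exists (W p - (W q - W p) / (X q - X p) * X p), ((W q - W p) / (X q - X p)).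
by move=> z; rewrite /seg; ring.
Qed.

Lemma aff_cst X c : aff X (fun=> c).
Proof. by exists c, 0 => z; rewrite mul0r addr0. Qed.

Lemma affB X D D' : aff X D -> aff X D' -> aff X (fun z => D z - D' z).
Proof.
move=> [a [b Dab]] [a' [b' D'ab]]; exists (a - a'), (b - b') => z.
by rewrite Dab D'ab; ring.
Qed.

Lemma affD X D D' : aff X D -> aff X D' -> aff X (fun z => D z + D' z).
Proof.
move=> [a [b Dab]] [a' [b' D'ab]]; exists (a + a'), (b + b') => z.
by rewrite Dab D'ab; ring.
Qed.

Lemma aff_ge0 X D i j k : aff X D -> X i <= X j -> X j <= X k ->
  0 <= D i -> 0 <= D k -> 0 <= D j.
Proof.
move=> [a [b Dab]]; rewrite !Dab => ij jk Di Dk.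
by have [b0|b0] := lerP 0 b; nra.
Qed.

Lemma aff_gt0 X D i j k : aff X D -> X i <= X j -> X j <= X k ->
  0 < D i -> 0 < D k -> 0 < D j.
Proof.
move=> [a [b Dab]]; rewrite !Dab => ij jk Di Dk.
by have [b0|b0] := lerP 0 b; nra.
Qed.

Lemma affr_ge0 X D i j k : aff X D -> X i < X j -> X j <= X k ->
  D i <= 0 -> 0 <= D j -> 0 <= D k.
Proof.
move=> [a [b Dab]]; rewrite !Dab => ij jk Di Dj.
have b0 : 0 <= b by rewrite leNgt; apply/negP => b0; nra.
nra.
Qed.

Lemma segl X W p q : seg X W p q p = W p.
Proof. by rewrite /seg subrr mulr0 addr0. Qed.

Lemma segr X W p q : X p < X q -> seg X W p q q = W q.
Proof. by move=> pq; rewrite /seg; field; rewrite subr_eq0 gt_eqF. Qed.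

Lemma segC X W p q z : X p < X q -> seg X W q p z = seg X W p q z.
Proof.
move=> pq; rewrite /seg; field.
by rewrite !subr_eq0 gt_eqF // lt_eqF.
Qed.

Lemma seg_opp X W p q z : seg (negf X) (negf W) p q z = - seg X W p q z.
Proof.
rewrite /seg /negf -!opprD.
have -> : W q + - W p = W q - W p by [].
by rewrite invrN !opprD opprK; ring.
Qed.

(** Strict convexity at j, cross-multiplied so that no division occurs. The three lemmas that follow
    rephrase it as one of the points lying strictly off the line through the other two. *)
Definition cvx X W i j k := (W j - W i) * (X k - X j) < (W k - W j) * (X j - X i).

Lemma cvx_mid X W i j k : X i < X j -> X j < X k ->
  cvx X W i j k <-> W j < seg X W i k j.
Proof.
move=> ij jk; rewrite /cvx /seg.
have ik : 0 < X k - X i by lra.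
set m := _ / _; have mE : m * (X k - X i) = W k - W i.
  by rewrite /m divfK // gt_eqF.
by split=> ?; nra.
Qed.

Lemma cvx_right X W i j k : X i < X j -> X j < X k ->
  cvx X W i j k <-> seg X W i j k < W k.
Proof.
move=> ij jk; rewrite /cvx /seg.
have ik : 0 < X j - X i by lra.
set m := _ / _; have mE : m * (X j - X i) = W j - W i.
  by rewrite /m divfK // gt_eqF.
by split=> ?; nra.
Qed.

Lemma cvx_left X W i j k : X i < X j -> X j < X k ->
  cvx X W i j k <-> seg X W j k i < W i.
Proof.
move=> ij jk; rewrite /cvx /seg.
have ik : 0 < X k - X j by lra.
set m := _ / _; have mE : m * (X k - X j) = W k - W j.
  by rewrite /m divfK // gt_eqF.
by split=> ?; nra.
Qed.

(** Convexity at j makes the slope from i to p smaller than that from j to p, so the left neighbour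
    of p may be moved out from j to i. *)
Lemma cvx_transl X W i j p k : X i < X j -> X j < X p -> X p < X k ->
  cvx X W i j p -> cvx X W j p k -> cvx X W i p k.
Proof.
rewrite /cvx => ij jp pk c1 c2; rewrite -(ltr_pM2l (_ : 0 < X p - X j)) ?subr_gt0 //.
have: 0 < X k - X p by lra.
have: 0 < X j - X i by lra.
nra.
Qed.

Lemma cvx_transr X W i p j k : X i < X p -> X p < X j -> X j < X k ->
  cvx X W i p j -> cvx X W p j k -> cvx X W i p k.
Proof.
rewrite /cvx => ip pj jk c1 c2; rewrite -(ltr_pM2l (_ : 0 < X j - X p)) ?subr_gt0 //.
have: 0 < X k - X j by lra.
have: 0 < X p - X i by lra.
nra.
Qed.

End Affine.

(** * The geometry of closing one join *)

Section JoinGeometry.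
Variables (R : realFieldType) (T : finType).
Implicit Types (X W D : T -> R) (a c i j k p r s t z : T) (I J : {set T}) (h : R).

Lemma opp_opp X : negf (negf X) = X.
Proof. by apply: funext => i; rewrite /negf opprK. Qed.

Lemma opp_inj X : injective X -> injective (negf X).
Proof. by move=> Xinj i j /oppr_inj /Xinj. Qed.

Definition consec X I a c :=
  [/\ a \in I, c \in I, X a < X c & forall i, i \in I -> X a < X i -> X i < X c -> False].

(** The vertex that follows s on the lower hull of the data from s to t. Strictness beyond p selects
    the last contact point and makes p unique. *)
Definition tangent X W s t p :=
  [/\ X s < X p, X p <= X t & forall k, X s < X k -> X k <= X t ->
     seg X W s p k <= W k /\ (X p < X k -> seg X W s p k < W k)].

(** [h'] is the maximum of h and the price of the edge from s to p, described by a bound and by the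
    point that attains it when it exceeds h. *)
Definition raise X W s p h h' :=
  [/\ h <= h',
      forall i, X s < X i -> X i < X p -> W i <= seg X W s p i + 2 * h' &
      h' = h \/ exists j, [/\ X s < X j, X j < X p & W j = seg X W s p j + 2 * h']].

(* Step 4 of the joining procedure; [lstuck] is the exit from step 3. *)
Definition lmove X W s t h p h' :=
  [/\ tangent X W s t p, raise X W s p h h' & seg X W s p t <= W t - 2 * h'].

Definition lstuck X W s t h := exists p h',
  [/\ tangent X W s t p, raise X W s p h h' & W t - 2 * h' < seg X W s p t].

(* The chain of edges from [s'] to [s], the end points of the old and of the  *)
(* current join.  The chain from [t] to [t'] is a [left_part] of the mirrored *)
(* data [negf X], [negf W].                                                   *)
Definition left_part X W s' s t h I :=
  [/\ forall a c, consec X I a c -> X s' <= X a -> X c <= X s ->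
        forall i, X a < X i -> X i < X c ->
          seg X W a c i <= W i /\ W i <= seg X W a c i + 2 * h,
      forall p, p \in I -> X s' < X p -> X p <= X s ->
        forall i k, X s' <= X i -> X i < X p -> X p < X k -> X k <= X t ->
          cvx X W i p k &
      forall a, consec X I a s -> X s' <= X a -> seg X W a s t <= W t - 2 * h].

Definition attains X W lo hi I h := exists a c j,
  [/\ consec X I a c, X lo <= X a, X c <= X hi, X a < X j < X c &
      W j = seg X W a c j + 2 * h].

(** [s'], [t'] are the ends of the gap and [h0] is the value of h at the start; the other arguments
    are current. [ji_eq] lets the ends meet only at h = 0, and [ji_att] remembers on which chain a
    raised h is attained. *)
Record join_inv X W s' t' h0 s t h I : Prop := JoinInv {
  ji_le1 : X s' <= X s;
  ji_le2 : X s <= X t;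
  ji_le3 : X t <= X t';
  ji_mem1 : s' \in I;
  ji_mem2 : s \in I;
  ji_mem3 : t \in I;
  ji_mem4 : t' \in I;
  ji_gap : forall i, i \in I -> X s < X i -> X i < X t -> False;
  ji_h : h0 <= h;
  ji_eq : X s = X t -> h = 0;
  ji_left : left_part X W s' s t h I;
  ji_right : left_part (negf X) (negf W) t' t s h I;
  ji_att : [\/ h = h0, attains X W s' s I h | attains (negf X) (negf W) t' t I h] }.

Lemma consec_opp X I a c : consec (negf X) I a c <-> consec X I c a.
Proof.
rewrite /consec /negf; split=> -[aI cI]; rewrite ?ltrN2 => ac gap; split=> // i iI.
- by move=> ci ia; apply: (gap i iI); rewrite ltrN2.
- by rewrite !ltrN2 => ci ia; apply: (gap i iI).
Qed.

(** The half-turn swaps the two chains, so right moves need no separate treatment. *)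
Lemma join_inv_opp X W s' t' h0 s t h I :
  join_inv X W s' t' h0 s t h I -> join_inv (negf X) (negf W) t' s' h0 t s h I.
Proof.
move=> J; split; rewrite ?opp_opp; try by case: J.
- by rewrite /negf lerN2 (ji_le3 J).
- by rewrite /negf lerN2 (ji_le2 J).
- by rewrite /negf lerN2 (ji_le1 J).
- by move=> i iI; rewrite !ltrN2 => it si; apply: (ji_gap J iI si it).
- by move=> /oppr_inj /esym; exact: ji_eq J.
- by case: (ji_att J) => ?; [apply: Or31|apply: Or33|apply: Or32].
Qed.

Section Moves.
Variables (X W : T -> R).
Hypothesis Xinj : injective X.

(** If p came before q, the line to p would pass strictly below q, hence the line to q strictly
    above p, against the tangency at q. *)
Lemma eq_tangent s t p : tangent X W s t p -> forall q, tangent X W s t q -> p = q.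
Proof.
move=> [sp pt P] q [sq qt Q]; apply: Xinj; apply/eqP.
case: ltgtP => // lt_pq.
- have [_ /(_ lt_pq) c1] := P q sq qt; have [c2 _] := Q p sp pt.
  have/(cvx_right _ sp lt_pq)/(cvx_mid _ sp lt_pq) : seg X W s p q < W q by [].
  by rewrite ltNge c2.
- have [_ /(_ lt_pq) c1] := Q p sp pt; have [c2 _] := P q sq qt.
  have/(cvx_right _ sq lt_pq)/(cvx_mid _ sq lt_pq) : seg X W s q p < W p by [].
  by rewrite ltNge c2.
Qed.

(** The data are above the tangent line before p and strictly above it after p, so the slope into p
    is at most, and the slope out of p larger than, that of the line. *)
Lemma tangent_cvx s t p i k : tangent X W s t p ->
  X s <= X i -> X i < X p -> X p < X k -> X k <= X t -> cvx X W i p k.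
Proof.
move=> [sp pt P] si ip pk kt; apply/(cvx_right _ ip pk).
have [_ /(_ pk) c1] := P k (lt_trans sp pk) kt.
have c2 : seg X W s p i <= W i.
  move: si; rewrite le_eqVlt => /orP[/eqP /Xinj <-|si]; first by rewrite segl.
  by have [] := P i si (le_trans (ltW ip) pt).
have := @affr_ge0 R T X (fun z => seg X W s p z - seg X W i p z) i p k.
rewrite segl !segr // subrr => /(_ (affB (aff_seg _ _ _ _) (aff_seg _ _ _ _)) ip (ltW pk)).
by move=> H; have := H ltac:(lra) (lexx _); lra.
Qed.

Lemma tangent_chord s t p i : tangent X W s t p -> X s < X i -> X i < X p ->
  seg X W s p i <= W i.
Proof. by move=> [sp pt P] si ip; have [] := P i si (le_trans (ltW ip) pt). Qed.

Lemma consec_setU_left I p s a c : X c <= X s -> X s < X p ->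
  consec X (p |: I) a c -> consec X I a c.
Proof.
move=> cs sp [aI cI ac gap]; split=> //.
- move: aI; rewrite in_setU1 => /predU1P[pa|//].
  by move: (lt_le_trans ac cs); rewrite pa ltNge (ltW sp).
- move: cI; rewrite in_setU1 => /predU1P[pc|//].
  by move: cs; rewrite pc leNgt sp.
- by move=> i iI; apply: gap; rewrite in_setU1 iI orbT.
Qed.

Lemma consec_setU_right I p t a c : t \in I -> X p <= X t -> X t <= X a ->
  consec X (p |: I) a c -> consec X I a c.
Proof.
move=> tI pt ta [aI cI ac gap]; split=> //.
- move: aI; rewrite in_setU1 => /predU1P[pa|//].
  by have -> : a = t by apply: Xinj; apply/eqP; rewrite eq_le ta pa pt.
- move: cI; rewrite in_setU1 => /predU1P[pc|//].
  by move: (le_lt_trans ta ac); rewrite pc ltNge pt.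
- by move=> i iI; apply: gap; rewrite in_setU1 iI orbT.
Qed.

Lemma setU_consec_left I p s a c : X c <= X s -> X s < X p ->
  consec X I a c -> consec X (p |: I) a c.
Proof.
move=> cs sp [aI cI ac gap]; split; rewrite ?in_setU1 ?aI ?cI ?orbT //.
move=> i; rewrite in_setU1 => /predU1P[-> _|]; last exact: gap.
by move=> /(lt_le_trans)/(_ cs); rewrite ltNge (ltW sp).
Qed.

Lemma setU_consec_right I p t a c : X p <= X t -> X t <= X a ->
  consec X I a c -> consec X (p |: I) a c.
Proof.
move=> pt ta [aI cI ac gap]; split; rewrite ?in_setU1 ?aI ?cI ?orbT //.
move=> i; rewrite in_setU1 => /predU1P[->|]; last exact: gap.
by move=> /(le_lt_trans ta); rewrite ltNge pt.
Qed.

Lemma setU_consec_new I p s : s \in I -> X s < X p ->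
  (forall i, i \in I -> X s < X i -> X i < X p -> False) -> consec X (p |: I) s p.
Proof.
move=> sI sp gap; split; rewrite ?in_setU1 ?sI ?eqxx ?orbT //.
by move=> i; rewrite in_setU1 => /predU1P[->|]; [rewrite ltxx|apply: gap].
Qed.

Lemma setU_consec_last I p s a : s \in I -> X s < X p ->
  (forall i, i \in I -> X s < X i -> X i < X p -> False) ->
  consec X (p |: I) a p -> a = s.
Proof.
move=> sI sp gap [aI _ ap gap'].
have {}aI : a \in I.
  by move: aI; rewrite in_setU1 => /predU1P[pa|//]; rewrite pa ltxx in ap.
apply: Xinj; apply/eqP; case: ltgtP => // lt_as.
- by case: (gap' s); rewrite ?in_setU1 ?sI ?orbT.
- by case: (gap a).
Qed.

(* This is why a left move preserves the slope condition of the right chain. *)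
Lemma lmove_slope I s' t' h0 s t h p h' c : join_inv X W s' t' h0 s t h I ->
  0 <= h0 -> lmove X W s t h p h' -> consec X I t c -> X c <= X t' ->
  W p + 2 * h' <= seg X W t c p.
Proof.
move=> J h00 [tan [hh' rs att] mv] tc ct'; have [sp pt P] := tan.
have tltc : X t < X c by case: tc.
have [_ vert slope] := ji_right J.
rewrite leNgt; apply/negP => bad.
(* [D] is the prolonged first edge of the right chain minus the upper side of the strip over the new
   edge. The accepted move makes it nonnegative at t; if it were negative at p, it would be so at
   every earlier point. One earlier point with [D] nonnegative is therefore enough: s if h was not
   raised, otherwise the point that raised it. *)
pose D z := seg X W t c z - (seg X W s p z + 2 * h').
have affDD : aff X D.
  by apply: affB; [exact: aff_seg|apply: affD; [exact: aff_seg|exact: aff_cst]].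
have Dp : D p < 0 by rewrite /D segr //; lra.
suff [z [zp Dz]] : exists z, X z < X p /\ 0 <= D z.
  have : D t < 0.
    rewrite ltNge; apply/negP => Dt.
    have := @aff_ge0 R T X D z p t affDD (ltW zp) pt Dz Dt.
    by rewrite leNgt Dp.
  by rewrite /D segl; lra.
case: att => [h'h|[j [sj jp Wj]]].
- exists s; split=> //; rewrite /D segl h'h.
  have /slope : consec (negf X) I c t by apply/consec_opp.
  rewrite /negf lerN2 => /(_ ct'); rewrite -/(negf X) -/(negf W) seg_opp segC //; lra.
- exists j; split=> //; rewrite /D -Wj.
  have jt : X j < X t := lt_le_trans jp pt.
  have : cvx (negf X) (negf W) c t j.
    have tt' := lt_le_trans tltc ct'.
    by apply: vert; rewrite /negf ?lerN2 ?ltrN2 ?(ji_mem3 J) // ltW.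
  rewrite cvx_right /negf ?ltrN2 // -/(negf X) -/(negf W) seg_opp segC // /negf; lra.
Qed.

(** Tangency yields the new edge and the convexity at p; the older vertices were already convex
    against everything up to t. The slope condition of the left chain is the test just passed, that
    of the right chain is [lmove_slope]. *)
Lemma join_inv_lmove I s' t' h0 s t h p h' : join_inv X W s' t' h0 s t h I ->
  0 <= h0 -> lmove X W s t h p h' -> join_inv X W s' t' h0 p t h' (p |: I).
Proof.
move=> J h00 M; have [tan [hh' rs att] mv] := M; have [sp pt P] := tan.
have gap : forall i, i \in I -> X s < X i -> X i < X p -> False.
  by move=> i iI si ip; apply: (ji_gap J iI si); apply: lt_le_trans ip pt.
have [/= edge vert slope] := ji_left J.
have [/= edge' vert' slope'] := ji_right J.
have s's := ji_le1 J; have tt' := ji_le3 J.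
split=> //.
- exact: le_trans s's (ltW sp).
- by rewrite in_setU1 (ji_mem1 J) orbT.
- by rewrite in_setU1 eqxx.
- by rewrite in_setU1 (ji_mem3 J) orbT.
- by rewrite in_setU1 (ji_mem4 J) orbT.
- move=> i; rewrite in_setU1 => /predU1P[->|iI]; first by rewrite ltxx.
  by move=> pi; apply: (ji_gap J iI); apply: lt_trans pi.
- exact: le_trans (ji_h J) hh'.
(* Arriving at t means W t <= W t - 2h', which forces h' = 0. *)
- move=> /Xinj pE; move: mv; rewrite -pE segr //.
  by have := ji_h J; lra.
- split.
  + move=> a c ac s'a cp i ai ic.
    have [cs|sc] := lerP (X c) (X s).
      have := edge _ _ (consec_setU_left cs sp ac) s'a cs i ai ic.
      by move=> [? ?]; split=> //; lra.
    have cE : c = p.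
      case: ac => _; rewrite in_setU1 => /predU1P[//|cI] _ _.
      apply: Xinj; apply/eqP; rewrite eq_le cp /= leNgt; apply/negP => ltcp.
      exact: gap ltcp.
    subst c; have aE := setU_consec_last (ji_mem2 J) sp gap ac; subst a.
    by split; [apply: (tangent_chord tan)|apply: rs].
  + move=> q; rewrite in_setU1 => /predU1P[-> _ _|qI s'q qp] i k s'i ip pk kt.
      have [si|si] := lerP (X s) (X i); first exact: (tangent_cvx tan).
      have s's0 : X s' < X s by apply: le_lt_trans s'i si.
      apply: (cvx_transl si sp pk); last exact: (tangent_cvx tan).
      by apply: vert => //; exact: ji_mem2 J.
    have qs : X q <= X s.
      rewrite leNgt; apply/negP => sq; move: qp; rewrite le_eqVlt => /orP[/eqP|].
        move=> /Xinj qE; subst q.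
        by have := ji_gap J qI sp; move: pt; rewrite le_eqVlt => /orP[/eqP/Xinj pE|pt /(_ pt)//];
          subst p; move: (pk); rewrite ltNge kt.
      exact: gap.
    exact: vert.
  + move=> a ac _; by have -> := setU_consec_last (ji_mem2 J) sp gap ac.
- split.
  + move=> a c /consec_opp ac; rewrite /negf !lerN2 => at' tc i; rewrite !ltrN2 => ia ic.
    have /consec_opp ac' := consec_setU_right (ji_mem3 J) pt tc ac.
    have := edge' _ _ ac'; rewrite /negf !lerN2 => /(_ at' tc i).
    rewrite !ltrN2 => /(_ ia ic) [? ?]; split=> //; lra.
  + move=> q qI; rewrite /negf ltrN2 lerN2 => qt' tq i k; rewrite !ltrN2 !lerN2 => it' qi kq pk.
    have {}qI : q \in I.
      move: qI; rewrite in_setU1 => /predU1P[pa|//].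
      by have -> : q = t; [apply: Xinj; apply/eqP; rewrite eq_le tq pa pt|exact: ji_mem3 J].
    apply: vert' => //; rewrite /negf ?ltrN2 ?lerN2 //.
    exact: le_trans (ltW sp) pk.
  + move=> a /consec_opp ac; rewrite /negf lerN2 => at'.
    have ta : X t < X a by case: ac.
    have ac' := consec_setU_right (ji_mem3 J) pt (lexx _) ac.
    have := lmove_slope J h00 M ac' at'.
    by rewrite -/(negf X) -/(negf W) seg_opp (segC _ _ ta) /negf; lra.
- case: att => [h'h|[j [sj jp Wj]]]; last first.
    apply: Or32; exists s, p, j; split=> //; last by rewrite sj.
    exact: setU_consec_new (ji_mem2 J) sp gap.
  rewrite h'h; case: (ji_att J) => [->|[a [c [j [ac s'a cs aj Wj]]]]|[a [c [j [ac ta ct aj Wj]]]]].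
  + exact: Or31.
  + apply: Or32; exists a, c, j; split=> //; last exact: le_trans cs (ltW sp).
    exact: setU_consec_left cs sp ac.
  + apply: Or33; exists a, c, j; split=> //.
    apply/consec_opp/(setU_consec_right pt); last exact/consec_opp.
    by move: ct; rewrite /negf lerN2.
Qed.

(* The line from [s] which passes [h] above the data at [s] and [h] below them *)
(* at [t], lowered by [h].                                                     *)
Definition low X W s t h z :=
  W s + (W t - 2 * h - W s) / (X t - X s) * (X z - X s).

(** The lower half of the strip of the join; the upper half is the [tube] of the mirrored data. *)
Definition tube X W s t h := forall i, X s < X i -> X i < X t -> low X W s t h i < W i.

Lemma aff_low s t h : aff X (low X W s t h).
Proof.
exists (W s - (W t - 2 * h - W s) / (X t - X s) * X s),
  ((W t - 2 * h - W s) / (X t - X s)).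
by move=> z; rewrite /low; ring.
Qed.

Lemma lowl s t h : low X W s t h s = W s.
Proof. by rewrite /low subrr mulr0 addr0. Qed.

Lemma lowr s t h : X s < X t -> low X W s t h t = W t - 2 * h.
Proof. by move=> st; rewrite /low; field; rewrite subr_eq0 gt_eqF. Qed.

Lemma low_opp s t h z : X s < X t ->
  low (negf X) (negf W) t s h z = - (low X W s t h z + 2 * h).
Proof.
by move=> st; rewrite /low /negf; field; rewrite !subr_eq0 gt_eqF // opprK addrC subr_eq0 lt_eqF.
Qed.

(** If the left test failed without a raise, a datum on or under the lower side would put this side
    above the tangent line there and then also at t, against the failed test. A failed left test
    with a raise is impossible: take the larger of the two trial values. The corresponding tangent,
    shifted by twice that value, is on the far side of the other tangent at both s and t, hence also
    at the point that attains the value, although the other tangent bounds the data. *)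
Lemma stuck_tube s t h : lstuck X W s t h -> lstuck (negf X) (negf W) t s h ->
  tube X W s t h.
Proof.
move=> [p [h1 [tan1 [hh1 _ att1] st1]]] [r [h2 [tan2 [hh2 _ att2] st2]]] i si it.
have low1 k : X s < X k -> X k <= X t -> seg X W s p k <= W k.
  by case: tan1 => _ _ P sk kt; case: (P k sk kt).
have upp2 k : X s <= X k -> X k < X t -> W k <= seg X W t r k.
  case: tan2 => _ _ P sk kt; have := P k.
  by rewrite seg_opp /negf ltrN2 !lerN2 => /(_ kt sk) [].
have {}st2 : seg X W t r s < W s + 2 * h2 by move: st2; rewrite seg_opp /negf; lra.
rewrite ltNge; apply/negP => bad.
pose E d z := seg X W s p z + 2 * d - seg X W t r z.
have affE d : aff X (E d).
  by apply: affB; [apply: affD; [exact: aff_seg|exact: aff_cst]|exact: aff_seg].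
case: att1 => [h1h|[j [sj jp Wj]]].
  pose D z := low X W s t h z - seg X W s p z.
  have affD' : aff X D by apply: affB; [exact: aff_low|exact: aff_seg].
  have := affr_ge0 affD' si (ltW it); rewrite /D lowl segl subrr lowr ?(lt_trans si) //.
  by have := low1 i si (ltW it) => ? /(_ (lexx _)); rewrite h1h in st1; lra.
have jt : X j < X t by case: tan1 => _ pt _; apply: lt_le_trans pt.
have [h21|h12] := lerP h2 h1.
  have := aff_gt0 (affE h1) (ltW sj) (ltW jt); rewrite /E !segl -Wj.
  have := upp2 j (ltW sj) jt => ? H.
  have : 0 < W j - seg X W t r j by apply: H; lra.
  lra.
case: att2 => [?|[j' [tj' j'r Wj']]]; first lra.
have {}tj' : X j' < X t by move: tj'; rewrite /negf ltrN2.
have {}j'r : X s < X j'.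
  case: tan2 => _; rewrite /negf lerN2 => sr _.
  by move: j'r; rewrite /negf ltrN2; apply: le_lt_trans.
move: Wj'; rewrite seg_opp /negf => Wj'.
have := aff_gt0 (affE h2) (ltW j'r) (ltW tj'); rewrite /E !segl.
have := low1 j' j'r (ltW tj') => ? H.
have : 0 < seg X W s p j' + 2 * h2 - seg X W t r j' by apply: H; lra.
lra.
Qed.

Lemma next_exists I a q : a \in I -> q \in I -> X a < X q ->
  exists c, consec X I a c /\ X c <= X q.
Proof.
move=> aI qI aq.
case: (@arg_minP _ R T q (fun c => (c \in I) && (X a < X c)) X); first by rewrite qI aq.
move=> c /andP[cI ac] cmin; exists c; split; last by apply: cmin; rewrite qI aq.
split=> // i iI ai ic; have := cmin i; rewrite iI ai => /(_ isT).
by rewrite leNgt ic.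
Qed.

Lemma bracket I u0 v0 p : u0 \in I -> v0 \in I -> X u0 < X p -> X p < X v0 ->
  p \notin I ->
  exists u v, [/\ consec X I u v, X u0 <= X u, X v <= X v0 & X u < X p < X v].
Proof.
move=> uI vI up pv pI.
case: (@arg_minP _ R T v0 (fun c => (c \in I) && (X p < X c)) X); first by rewrite vI pv.
move=> v /andP[{}vI' {}pv'] vmin.
case: (@arg_maxP _ R T u0 (fun c => (c \in I) && (X c < X p)) X); first by rewrite uI up.
move=> u /andP[{}uI' {}up'] umax.
exists u, v; split=> //; last 1 first.
- by rewrite up' pv'.
- split=> //; first exact: lt_trans pv'.
  move=> i iI ui iv; case: (ltgtP (X i) (X p)) => [ip|pi|/Xinj ip].
  + have : X i <= X u by apply: umax; rewrite iI ip.
    by rewrite leNgt ui.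
  + by have := vmin i; rewrite iI pi => /(_ isT); rewrite leNgt iv.
  + by rewrite -ip iI in pI.
- by apply: umax; rewrite uI up.
- by apply: vmin; rewrite vI pv.
Qed.

(** * Closing a gap a second time, from a larger value of h *)

Section Rerun.
Variables (s' t' s1 t1 : T) (h0 hb : R) (I1 : {set T}).
Hypothesis J : join_inv X W s' t' h0 s1 t1 hb I1.
Hypothesis tub : tube X W s1 t1 hb.
Hypothesis h00 : 0 <= h0.

(** By the slope condition the first edge of the right chain rises no faster than the join, and
    concavity only bends the chain further down. *)
Lemma right_chain_slope t : t \in I1 -> X t1 <= X t -> X t <= X t' ->
  X s1 < X t1 -> W t - 2 * hb <= low X W s1 t1 hb t.
Proof.
move=> tI; rewrite le_eqVlt => /orP[/eqP/Xinj <- _ st|t1t tt' st].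
  by rewrite lowr.
have [/= edge vert slope] := ji_right J.
have [c [t1c ct]] := next_exists (ji_mem3 J) tI t1t.
have lt1c : X t1 < X c by case: t1c.
have /slope : consec (negf X) I1 c t1 by apply/consec_opp.
rewrite /negf lerN2 => /(_ (le_trans ct tt')); rewrite -/(negf X) -/(negf W) seg_opp.
rewrite (segC _ _ lt1c) /negf => cs.
have ct' : W t <= seg X W t1 c t.
  move: ct; rewrite le_eqVlt => /orP[/eqP/Xinj <-|ct]; first by rewrite segr.
  have cI : c \in I1 by case: t1c.
  have := vert c cI; rewrite /negf ltrN2 lerN2 => /(_ (lt_le_trans ct tt') (ltW lt1c) t t1).
  rewrite !ltrN2 !lerN2 => /(_ tt' ct lt1c (ltW st)).
  rewrite -/(negf X) -/(negf W) cvx_left /negf ?ltrN2 //.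
  by rewrite -/(negf X) -/(negf W) seg_opp (segC _ _ lt1c) ltrN2 => /ltW.
have := @affr_ge0 R T X (fun z => low X W s1 t1 hb z - (seg X W t1 c z - 2 * hb)) s1 t1 t.
rewrite lowl lowr // segl subrr => H; have {H} := H _ st (ltW t1t) _ (lexx _).
move=> H; have : 0 <= low X W s1 t1 hb t - (seg X W t1 c t - 2 * hb); last by lra.
apply: H; last by lra.
by apply: affB; [exact: aff_low|apply: affB; [exact: aff_seg|exact: aff_cst]].
Qed.

(** A concave chain lies above its chords, and the data are at most 2 [hb] below its edges. *)
Lemma right_chain_chord t p : t \in I1 -> X t <= X t' -> X t1 < X p -> X p < X t ->
  seg X W t1 t p - 2 * hb <= W p.
Proof.
move=> tI tt' t1p pt.
have [/= edge vert slope] := ji_right J.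
have s1t1 := ji_le2 J; have hb0 := ji_h J.
have above q : q \in I1 -> X t1 <= X q -> X q <= X t -> seg X W t1 t q <= W q.
  move=> qI; rewrite le_eqVlt => /orP[/eqP/Xinj <-|t1q]; first by rewrite segl.
  rewrite le_eqVlt => /orP[/eqP/Xinj ->|qt].
    by rewrite segr //; apply: lt_trans pt.
  have := vert q qI; rewrite /negf ltrN2 lerN2 => /(_ (lt_le_trans qt tt') (ltW t1q) t t1).
  rewrite !ltrN2 !lerN2 => /(_ tt' qt t1q s1t1).
  rewrite -/(negf X) -/(negf W) cvx_mid /negf ?ltrN2 //.
  by rewrite -/(negf X) -/(negf W) seg_opp (segC _ _ (lt_trans t1q qt)) ltrN2 => /ltW.
have [pI|pI] := boolP (p \in I1).
  by have := above p pI (ltW t1p) (ltW pt); move: h00 hb0; lra.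
have [u [v [uv t1u vt /andP[up pv]]]] := bracket (ji_mem3 J) tI t1p pt pI.
have luv := lt_trans up pv.
have /consec_opp vu := uv.
have := edge v u vu; rewrite /negf !lerN2 => /(_ (le_trans vt tt') t1u p).
rewrite !ltrN2 => /(_ pv up) [_]; rewrite -/(negf X) -/(negf W) seg_opp (segC _ _ luv) => e.
have uI : u \in I1 by case: uv. have vI : v \in I1 by case: uv.
have := @aff_ge0 R T X (fun z => seg X W u v z - seg X W t1 t z) u p v
  (affB (aff_seg _ _ _ _) (aff_seg _ _ _ _)) (ltW up) (ltW pv).
rewrite segl segr // !subr_ge0 => /(_ (above u uI t1u _) (above v vI _ vt)).
by move=> H; have := H (le_trans (ltW luv) vt) (le_trans t1u (ltW luv)); move: e; rewrite /negf; lra.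
Qed.

(** Up to [s1] the tangents from points of the old chain are its own edges, whose prices are at most
    [hb] < h, so nothing is raised. A tangent reaching beyond [s1] would overtake the lower side of
    the old strip and stay above it up to t, where the move test requires the opposite. *)
Lemma rerun_lmove s t h p h' : hb < h ->
  s \in I1 -> X s' <= X s -> X s <= X s1 ->
  t \in I1 -> X t1 <= X t -> X t <= X t' ->
  lmove X W s t h p h' -> [/\ p \in I1, X p <= X s1 & h' = h].
Proof.
move=> hbh sI s's ss1 tI t1t tt' [tan [hh' rs att] mv]; have [sp pt P] := tan.
have hb0 := ji_h J; have s1t1 := ji_le2 J.
have [/= edge vert slope] := ji_left J.
have [ps1|s1p] := lerP (X p) (X s1).
  have [c [sc cp]] := next_exists sI (ji_mem2 J) (lt_le_trans sp ps1).
  have [_ cI ltsc _] := sc.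
  have tanp : tangent X W s s1 p.
    by split=> // k sk ks1; apply: P => //; apply: le_trans ks1 (le_trans s1t1 t1t).
  have tanc : tangent X W s s1 c.
    split=> // k sk ks1; case: (ltgtP (X c) (X k)) => [ck|kc|/Xinj <-].
    - suff lt : seg X W s c k < W k by split; [exact: ltW|].
      apply/(cvx_right _ ltsc ck); apply: vert => //.
      + exact: le_lt_trans s's ltsc.
      + exact: le_trans ks1 s1t1.
    - by split=> //; case: (edge _ _ sc s's cp k sk kc).
    - by rewrite segr.
  have pc := eq_tangent tanp tanc; subst c; split=> //.
  case: att => // -[j [sj jp Wj]].
  have [_] := edge _ _ sc s's cp j sj jp; lra.
exfalso.
have Ns1 : seg X W s p s1 <= W s1.
  move: ss1; rewrite le_eqVlt => /orP[/eqP/Xinj <-|ss1]; first by rewrite segl.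
  by case: (P s1 ss1 (le_trans s1t1 t1t)).
have ltpt : X p < X t.
  rewrite lt_neqAle pt andbT; apply/negP => /eqP/Xinj pE; subst p.
  by move: mv h00; rewrite segr //; lra.
have Np : seg X W s p p = W p by rewrite segr.
(* Past [t1], the line is on or above the lowered chord of the right chain at p and below it at t;
   hence it is above it at [t1]. *)
have Nt1 : X t1 < X p -> X s1 < X t1 /\ W t1 - 2 * hb <= seg X W s p t1.
  move=> t1p; have chord := right_chain_chord tI tt' t1p ltpt.
  have t1t' := lt_trans t1p ltpt.
  pose D z := (seg X W t1 t z - 2 * hb) - seg X W s p z.
  have affDD : aff X D.
    by apply: affB; [apply: affB; [exact: aff_seg|exact: aff_cst]|exact: aff_seg].
  have Dt : 0 < D t by rewrite /D segr //; lra.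
  have Dp : D p <= 0 by rewrite /D Np; lra.
  have Dt1 : D t1 < 0.
    rewrite ltNge; apply/negP => Dt1.
    have opp_aff : aff X (fun z => D z) by [].
    case: affDD => a [b Dab]; move: Dt Dp Dt1; rewrite !Dab; nra.
  move: Dt1; rewrite /D segl => Dt1; split; last by lra.
  rewrite lt_neqAle s1t1 andbT; apply/negP => /eqP/Xinj s1E.
  by move: Dt1 (ji_eq J); rewrite -s1E => ? /(_ erefl); lra.
have lts1t1 : X s1 < X t1.
  by have [/Nt1[]//|pt1] := ltrP (X t1) (X p); apply: lt_le_trans pt1.
(* The overtaking point z is p or [t1], whichever comes first. *)
suff [z [s1z zt Nz]] : exists z, [/\ X s1 < X z, X z <= X t &
    low X W s1 t1 hb z <= seg X W s p z].
  have := @affr_ge0 R T X (fun y => seg X W s p y - low X W s1 t1 hb y) s1 z t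
    (affB (aff_seg _ _ _ _) (aff_low _ _ _)) s1z zt.
  rewrite lowl subr_le0 subr_ge0 => /(_ Ns1 Nz).
  by have := right_chain_slope tI t1t tt' lts1t1; lra.
case: (ltgtP (X p) (X t1)) => [pt1|t1p|/Xinj pE].
- by exists p; split; rewrite // Np; apply: ltW; apply: tub.
- by exists t1; split; rewrite // lowr //; case: (Nt1 t1p).
- by exists p; split; rewrite // Np pE lowr //; move: h00; lra.
Qed.

End Rerun.

Definition vertex s t p := forall i k,
  X s <= X i -> X i < X p -> X p < X k -> X k <= X t -> cvx X W i p k.

(** Describes the set I' of the joining procedure, but only beyond s, so that passed end points do
    not matter. *)
Definition chain_after (J : {set T}) s t := forall i, X s < X i ->
  (i \in J) <-> (X i <= X t /\ (i = t \/ vertex s t i)).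

(** Take the least slope seen from s and, among the points realising it, the last one. *)
Lemma tangent_exists s t : X s < X t -> exists p, tangent X W s t p.
Proof.
move=> st; pose m k := (W k - W s) / (X k - X s).
case: (@arg_minP _ R T t (fun k => X s < X k <= X t) m); first by rewrite st lexx.
move=> q0 /andP[sq0 q0t] q0min.
case: (@arg_maxP _ R T q0 (fun k => (X s < X k <= X t) && (m k <= m q0)) X).
  by rewrite sq0 q0t lexx.
move=> p /andP[/andP[sp pt] mp] pmax; exists p; split=> // k sk kt.
have mk : m q0 <= m k by apply: q0min; rewrite sk kt.
have Wk : W k = W s + m k * (X k - X s).
  by rewrite /m divfK ?subr_eq0 ?gt_eqF // addrC subrK.
have segE : seg X W s p k = W s + m p * (X k - X s) by [].
split; first by rewrite segE Wk lerD2l ler_pM2r ?subr_gt0 // (le_trans mp).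
move=> pk; rewrite segE Wk ltrD2l ltr_pM2r ?subr_gt0 // (le_lt_trans mp) //.
rewrite ltNge; apply/negP => mk'.
have : X k <= X p by apply: pmax; rewrite sk kt mk'.
by rewrite leNgt pk.
Qed.

Lemma next_tangent J s t p : X s < X t -> chain_after J s t ->
  p \in J -> X s < X p -> (forall i, i \in J -> X s < X i -> X i < X p -> False) ->
  tangent X W s t p.
Proof.
move=> st Js pJ sp gap; have [q tan] := tangent_exists st.
have [sq qt Q] := tan.
have qJ : q \in J.
  apply/(Js q sq); split=> //; right => i k si iq qk kt; exact: (tangent_cvx tan).
suff -> : p = q by [].
apply: Xinj; apply/eqP; case: ltgtP => // [pq|qp]; last by case: (gap q).
have [pt [pE|vp]] := (Js p sp).1 pJ.
  by move: pq; rewrite pE ltNge qt.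
have := vp s q (lexx _) sp pq qt.
by move=> /(cvx_mid _ sp pq); rewrite ltNge (tangent_chord tan).
Qed.

(** Since p is a hull vertex, the hulls from s and from p have the same vertices after p;
    [cvx_transl] carries convexity back across p. Hence I' need not be recomputed after a move. *)
Lemma chain_after_shift J s t p : chain_after J s t -> tangent X W s t p ->
  chain_after (J :\ s) p t.
Proof.
move=> Js tan i pi; have [sp pt P] := tan.
have is' : i != s.
  by apply/eqP => iE; subst i; move: (lt_trans sp pi); rewrite ltxx.
rewrite in_setD1 is' /=; split=> [/(Js i (lt_trans sp pi))|] [it vi].
- split=> //; case: vi => [|vi]; [by left|right => k k' pk ki ik' k't].
  by apply: vi => //; apply: le_trans pk; apply: ltW.
- apply/(Js i (lt_trans sp pi)); split=> //; case: vi => [|vi]; [by left|right].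
  move=> k k' sk ki ik' k't.
  have [pk|kp] := lerP (X p) (X k); first by apply: vi.
  by apply: (cvx_transl kp pi ik'); [apply: (tangent_cvx tan)|apply: vi].
Qed.

End Moves.
End JoinGeometry.

(** A transition of the main machine itself runs the joining machine, so [next] takes fuel too; by
    monotonicity the maximum of all amounts met along the run serves everywhere. *)
Lemma run_total (T A : Type) (next : nat -> T -> option (T + A))
    (Inv : T -> Prop) (m : T -> nat) (Post : A -> Prop) :
  (forall N M st r, (N <= M)%N -> next N st = Some r -> next M st = Some r) ->
  (forall st, Inv st -> exists N,
     (exists2 out, next N st = stop out & Post out) \/
     (exists st', [/\ next N st = goto st', Inv st' & (m st' < m st)%N])) ->
  forall st, Inv st -> exists N, exists2 out, run (next N) N st = Some out & Post out.
Proof.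
move=> mono step st; have [k] := ubnP (m st).
elim: k st => // k IHk st mk /step[N [[out E Pout]|[st' [E I' m']]]].
  exists N.+1, out => //; rewrite /= (mono N _ _ _ _ E) //.
have [N' [out Eout Pout]] := IHk st' ltac:(lia) I'.
exists (maxn N N').+1, out => //=; rewrite (mono N _ _ _ _ E) /=; last lia.
apply: (run_mono _ _ Eout); last lia.
by move=> u r; apply: mono; lia.
Qed.

Lemma bigmax_cases (R : realDomainType) (T : finType) (P : pred T) (F : T -> R) :
  \big[Num.max/0]_(i | P i) F i = 0 \/
  exists2 i, P i & \big[Num.max/0]_(i | P i) F i = F i.
Proof.
elim/big_ind: _ => [|a b Ha Hb|i Pi]; [by left| |by right; exists i].
by have [ab|ab] := leP a b.
Qed.

(** * Successors and predecessors in an index set *)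

Section IndexSetFacts.
Variable n : nat.
Implicit Types (I : {set 'I_n.+1}) (i j k : 'I_n.+1).

Lemma omin_some I p : p \in I -> (forall k, k \in I -> (p <= k)%N) -> omin I = Some p.
Proof.
move=> pI pmin; rewrite /omin; case: pickP => [q /andP[qI /forall_inP qmin]|/(_ p)].
  by congr Some; apply/val_inj/eqP; rewrite eqn_leq qmin //= pmin.
by rewrite pI /=; move=> /negbT/forall_inPn[k kI]; rewrite pmin.
Qed.

Lemma omax_some I p : p \in I -> (forall k, k \in I -> (k <= p)%N) -> omax I = Some p.
Proof.
move=> pI pmax; rewrite /omax; case: pickP => [q /andP[qI /forall_inP qmax]|/(_ p)].
  by congr Some; apply/val_inj/eqP; rewrite eqn_leq qmax ?pmax.
by rewrite pI /=; move=> /negbT/forall_inPn[k kI]; rewrite pmax.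
Qed.

Lemma ominP I p : omin I = Some p -> p \in I /\ forall k, k \in I -> (p <= k)%N.
Proof.
by rewrite /omin; case: pickP => // q /andP[qI /forall_inP qmin] [<-].
Qed.

Lemma succ_some I a c : a \in I -> c \in I -> (a < c)%N ->
  (forall i, i \in I -> (a < i)%N -> (i < c)%N -> False) -> succ_in I a = Some c.
Proof.
move=> aI cI ac gap; rewrite /succ_in.
case: (@arg_maxnP _ c (fun i => i \in I) val cI) => m mI mmax.
rewrite (omax_some mI) //=.
have -> : (m <= a)%N = false by apply/negbTE; rewrite -ltnNge; apply: leq_trans ac (mmax _ cI).
apply: omin_some; first by rewrite inE cI.
by move=> k; rewrite inE => /andP[kI ak]; rewrite leqNgt; apply/negP; apply: gap.
Qed.

Lemma pred_some I a c : a \in I -> c \in I -> (a < c)%N ->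
  (forall i, i \in I -> (a < i)%N -> (i < c)%N -> False) -> pred_in I c = Some a.
Proof.
move=> aI cI ac gap; apply: omax_some; first by rewrite inE aI.
by move=> k; rewrite inE => /andP[kI kc]; rewrite leqNgt; apply/negP => ak; apply: (gap k).
Qed.

End IndexSetFacts.

(** * Hulls and prices in terms of tangents and edges *)

Section Data.
Variables (R : realType) (n : nat) (x : 'rV[R]_n.+1).
Hypothesis x_incr : forall i j : 'I_n.+1, (i < j)%N -> x 0 i < x 0 j.
Implicit Types (w : 'rV[R]_n.+1) (I J : {set 'I_n.+1}) (i j k p r s t : 'I_n.+1).
Implicit Types (h : R).

Definition X i := x 0 i.

Lemma Xlt i j : (X i < X j) = (i < j)%N.
Proof.
case: (ltngtP i j) => [/x_incr->//|/x_incr ji|/val_inj ->]; last by rewrite ltxx.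
by apply/negbTE; rewrite -leNgt ltW.
Qed.

Lemma Xle i j : (X i <= X j) = (i <= j)%N.
Proof. by rewrite leNgt Xlt -leqNgt. Qed.

Lemma Xinj : injective X.
Proof.
move=> i j ij; apply/val_inj/eqP; rewrite eqn_leq -!Xle ij lexx //.
Qed.

Lemma oXinj : injective (negf X).
Proof. exact: opp_inj Xinj. Qed.

Definition vec w : 'I_n.+1 -> R := fun i => w 0 i.

Lemma lineE w j p q : line x w j p q = seg X (vec w) p q j.
Proof. by []. Qed.

Lemma seg_oppW (U : 'I_n.+1 -> R) p q z : seg X (negf U) p q z = - seg X U p q z.
Proof. by rewrite /seg /negf -opprD !mulNr opprD. Qed.

Lemma seg_scale (c : R) (U : 'I_n.+1 -> R) p q z :
  seg X (fun i => c * U i) p q z = c * seg X U p q z.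
Proof. by rewrite /seg; ring. Qed.

Lemma consecP I a c : consec X I a c <->
  [/\ a \in I, c \in I, (a < c)%N &
     forall i, i \in I -> (a < i)%N -> (i < c)%N -> False].
Proof.
split=> -[aI cI ac gap]; split; rewrite ?Xlt // -?Xlt // => i iI ai ic.
- by apply: (gap i iI); rewrite Xlt.
- by apply: (gap i iI); rewrite -Xlt.
Qed.

Lemma consec_succ I a c : consec X I a c -> succ_in I a = Some c.
Proof. by move=> /consecP[]; exact: succ_some. Qed.

Lemma consec_pred I a c : consec X I a c -> pred_in I c = Some a.
Proof. by move=> /consecP[]; exact: pred_some. Qed.

Lemma cdiff_cvx w i j k : (i < j)%N -> (j < k)%N ->
  0 < cdiff x w i j k <-> cvx X (vec w) i j k.
Proof.
rewrite -!Xlt /cdiff /cvx /vec /X => ij jk.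
have ik := lt_trans ij jk.
rewrite pmulr_rgt0 ?invr_gt0 ?subr_gt0 //.
by rewrite ltr_pdivlMr ?subr_gt0 // mulrAC ltr_pdivrMr ?subr_gt0.
Qed.

Lemma cdiff_scale c w i j k : cdiff x (c *: w) i j k = c * cdiff x w i j k.
Proof. by rewrite /cdiff !mxE; ring. Qed.

Lemma hullP sigma w r s j : reflect
  [/\ (r <= j)%N, (j <= s)%N & [\/ j = r, j = s |
    vertex X (vec (sigma *: w)) r s j]] (j \in hull x sigma w r s).
Proof.
rewrite inE; apply: (iffP and3P) => -[rj js H]; split=> //.
- case/or3P: H => [/eqP ->|/eqP ->|]; [exact: Or31|exact: Or32|].
  move=> /forallP H; apply: Or33 => i k; rewrite !Xlt !Xle => ri ij jk ks.
  apply/cdiff_cvx => //; rewrite cdiff_scale.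
  by move/forallP/(_ k)/implyP: (H i); apply; rewrite ri ij jk ks.
- case: H => [->|->|H]; rewrite ?eqxx ?orbT //.
  apply/or3P/Or33/forallP => i; apply/forallP => k; apply/implyP => /and4P[ri ij jk ks].
  rewrite -cdiff_scale; apply/cdiff_cvx => //.
  by apply: H; rewrite ?Xlt ?Xle.
Qed.

Lemma vertex_opp (U : 'I_n.+1 -> R) s t p :
  vertex X U s t p <-> vertex (negf X) U t s p.
Proof.
split=> H i k; rewrite /negf ?lerN2 ?ltrN2 => ti ip pk ks.
- by have := H k i ks pk ip ti; rewrite /cvx /negf; nra.
- by have := H k i; rewrite /negf !lerN2 !ltrN2 => /(_ ks pk ip ti); rewrite /cvx; nra.
Qed.

Lemma hull_chain w s t : (s < t)%N -> chain_after X (vec w) (hull x 1 w s t) s t.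
Proof.
move=> st i; rewrite Xlt => si; split=> [/hullP[_ it H]|[it H]].
- rewrite Xle; split=> //; case: H => [iE|->|]; last by rewrite scale1r; right.
  + by subst i; rewrite ltnn in si.
  + by left.
- rewrite Xle in it; apply/hullP; split=> //; first exact: ltnW.
  by case: H => [->|]; [exact: Or32|rewrite scale1r; exact: Or33].
Qed.

Lemma vecN w : vec (- w) = negf (vec w).
Proof. by apply: funext => i; rewrite /vec mxE. Qed.

Lemma hull_chain_opp w s t : (s < t)%N ->
  chain_after (negf X) (negf (vec w)) (hull x (-1) w s t) t s.
Proof.
move=> st i; rewrite /negf ltrN2 lerN2 -/(negf _) Xlt => it; split=> [/hullP[si _ H]|[si H]].
- rewrite Xle; split=> //; case: H => [->|iE|].
  + by left.
  + by subst i; rewrite ltnn in it.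
  + by rewrite scaleN1r vecN => /vertex_opp; right.
- rewrite Xle in si; apply/hullP; split=> //; first exact: ltnW.
  case: H => [->|]; [exact: Or31|rewrite scaleN1r vecN => /vertex_opp; exact: Or33].
Qed.

(** [I] has to agree with the hull only between r and s, so that the price of a piece can be read
    off the global index set. *)
Lemma price_spec sigma w r s I : (r <= s)%N -> r \in I -> s \in I ->
  (forall j, (r <= j)%N -> (j <= s)%N -> (j \in hull x sigma w r s) = (j \in I)) ->
  let U := vec (sigma *: w) in
  [/\ 0 <= price x sigma w r s,
      forall a c, consec X I a c -> (r <= a)%N -> (c <= s)%N ->
        forall j, (a < j)%N -> (j < c)%N -> U j <= seg X U a c j + 2 * price x sigma w r s &
      price x sigma w r s = 0 \/ exists a c j,
        [/\ consec X I a c, (r <= a)%N, (c <= s)%N, (a < j < c)%N &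
          U j = seg X U a c j + 2 * price x sigma w r s]].
Proof.
move=> rs rI sI hullE U; pose A := hull x sigma w r s.
have val j : j \in I -> (r <= j)%N -> (j <= s)%N -> sigma * (w 0 j - interp x w A j) = 0.
  by move=> jI rj js; rewrite /interp hullE // jI subrr mulr0.
have val2 a c j : consec X I a c -> (r <= a)%N -> (c <= s)%N -> (a < j)%N -> (j < c)%N ->
    sigma * (w 0 j - interp x w A j) = U j - seg X U a c j.
  move=> ac ra cs aj jc; have /consecP[aI cI _ gap] := ac.
  have jI : j \notin I by apply/negP => /gap /(_ aj jc).
  have aA : a \in A by rewrite hullE //; lia.
  have cA : c \in A by rewrite hullE //; lia.
  rewrite /interp hullE ?(negbTE jI); [|lia..].
  have -> : pred_in A j = Some a.
    apply: omax_some; first by rewrite inE aA.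
    move=> k; rewrite inE => /andP[kA kj]; rewrite leqNgt; apply/negP => ak.
    have /hullP[rk ks _] := kA.
    by rewrite hullE // in kA; apply: (gap k) => //; lia.
  have -> : succ_in A j = Some c.
    rewrite /succ_in (@omax_some _ A s) /=; last 2 first.
    - by rewrite hullE.
    - by move=> k /hullP[].
    have -> : (s <= j)%N = false by lia.
    apply: omin_some; first by rewrite inE cA.
    move=> k; rewrite inE => /andP[kA kj]; rewrite leqNgt; apply/negP => kc.
    have /hullP[rk ks _] := kA.
    by rewrite hullE // in kA; apply: (gap k) => //; lia.
  rewrite lineE mulrBr -seg_scale /U /vec mxE; congr (_ - _).
  by rewrite /seg !mxE.
have cases j : (r <= j)%N -> (j <= s)%N -> j \in I \/ exists a c,
    [/\ consec X I a c, (r <= a)%N, (c <= s)%N, (a < j)%N & (j < c)%N].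
  move=> rj js; have [|jI] := boolP (j \in I); [by left|right].
  have rj' : X r < X j.
    by rewrite Xlt ltn_neqAle rj andbT; apply: contraNneq jI => /val_inj <-.
  have js' : X j < X s.
    by rewrite Xlt ltn_neqAle js andbT; apply: contraNneq jI => /val_inj ->.
  have [u [v [uv ru vs /andP[uj jv]]]] := bracket Xinj rI sI rj' js' jI.
  by exists u, v; rewrite -!Xle -!Xlt.
pose m := \big[Num.max/0]_(j : 'I_n.+1 | (r <= j)%N && (j <= s)%N)
           (sigma * (w 0 j - interp x w A j)).
have pE : 2 * price x sigma w r s = m by rewrite /price mulVKf.
have m0 : 0 <= m by apply: bigmax_ge_id.
split.
- by rewrite -(pmulr_rge0 _ (ltr0Sn R 1)) pE.
- move=> a c ac ra cs j aj jc; rewrite pE addrC -lerBlDr -(val2 a c j) //.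
  by apply: le_bigmax_cond; lia.
- case: (bigmax_cases (fun j : 'I_n.+1 => (r <= j)%N && (j <= s)%N)
    (fun j => sigma * (w 0 j - interp x w A j))) => [m_eq0|[j /andP[rj js] mj]].
    by left; move: pE; rewrite /m m_eq0; lra.
  have [jI|[a [c [ac ra cs aj jc]]]] := cases j rj js.
    by left; move: pE; rewrite /m mj val //; lra.
  right; exists a, c, j; split; rewrite ?aj //.
  by rewrite pE /m mj (val2 a c) //; ring.
Qed.

(** Between a point and its tangent point the hull has no further vertex, so the price is the
    largest deviation above a single chord. *)
Lemma raise_max w s t p h : 0 <= h -> tangent X (vec w) s t p ->
  raise X (vec w) s p h (Num.max h (price x 1 w s p)).
Proof.
move=> h0 tan; have [sp pt P] := tan.
have hullE j : (s <= j)%N -> (j <= p)%N -> (j \in hull x 1 w s p) = (j \in [set s; p]).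
  move=> sj jp; rewrite in_set2; apply/hullP/idP => [[_ _]|].
    case=> [->|->|]; rewrite ?eqxx ?orbT // scale1r => v; apply: contraT.
    rewrite negb_or => /andP[js jp'].
    have sj' : X s < X j by rewrite Xlt ltn_neqAle sj eq_sym andbT.
    have {}jp' : X j < X p by rewrite Xlt ltn_neqAle jp andbT.
    have := v s p (lexx _) sj' jp' (lexx _).
    by move=> /(cvx_mid _ sj' jp'); rewrite ltNge (tangent_chord tan).
  by move=> /orP[]/eqP E; split=> //; [exact: Or31|exact: Or32].
have [|||p0 bnd att] := @price_spec 1 w s p [set s; p] _ _ _ hullE.
- by rewrite -Xle ltW.
- by rewrite in_set2 eqxx.
- by rewrite in_set2 eqxx orbT.
rewrite scale1r in bnd att.
have spI : consec X [set s; p] s p.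
  split; rewrite ?in_set2 ?eqxx ?orbT // => i; rewrite in_set2.
  by case/orP => /eqP ->; rewrite ltxx.
split.
- by rewrite le_max lexx.
- move=> i; rewrite !Xlt => si ip; have := bnd _ _ spI (leqnn _) (leqnn _) i si ip.
  by move/le_trans; apply; rewrite lerD2l ler_pM2l // le_max lexx orbT.
- have [_|lt] := leP (price x 1 w s p) h; [by left|right].
  case: att => [pE|[a [c [j [[]]]]]]; first by move: lt; rewrite pE ltNge h0.
  rewrite !in_set2 => aI cI ac _ _ _ /andP[aj jc] Wj; exists j.
  case/orP: aI => /eqP ?; case/orP: cI => /eqP ?; subst a c; rewrite ?Xlt //.
  + by rewrite ltxx in ac.
  + by move: ac; rewrite ltNge (ltW sp).
  + by rewrite ltxx in ac.
Qed.

Lemma raise_max_opp w s t r h : 0 <= h ->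
  tangent (negf X) (negf (vec w)) t s r ->
  raise (negf X) (negf (vec w)) t r h (Num.max h (price x (-1) w r t)).
Proof.
move=> h0 tan; have [] := tan; rewrite /negf ltrN2 lerN2 -!/(negf _) => rt sr P.
have hullE j : (r <= j)%N -> (j <= t)%N -> (j \in hull x (-1) w r t) = (j \in [set r; t]).
  move=> rj jt; rewrite in_set2; apply/hullP/idP => [[_ _]|].
    case=> [->|->|]; rewrite ?eqxx ?orbT // scaleN1r vecN => v; apply: contraT.
    rewrite negb_or => /andP[jr jt'].
    have rj' : X r < X j by rewrite Xlt ltn_neqAle rj eq_sym andbT.
    have {}jt' : X j < X t by rewrite Xlt ltn_neqAle jt andbT.
    have := v r t (lexx _) rj' jt' (lexx _).
    move=> /(cvx_mid _ rj' jt'); rewrite ltNge seg_oppW -(segC _ _ rt) -seg_opp.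
    by rewrite (tangent_chord tan) // /negf ltrN2.
  by move=> /orP[]/eqP E; split=> //; [exact: Or31|exact: Or32].
have [|||p0 bnd att] := @price_spec (-1) w r t [set r; t] _ _ _ hullE.
- by rewrite -Xle ltW.
- by rewrite in_set2 eqxx.
- by rewrite in_set2 eqxx orbT.
rewrite scaleN1r vecN in bnd att.
have spI : consec X [set r; t] r t.
  split; rewrite ?in_set2 ?eqxx ?orbT // => i; rewrite in_set2.
  by case/orP => /eqP ->; rewrite ltxx.
have segE j : seg (negf X) (negf (vec w)) t r j = seg X (negf (vec w)) r t j.
  by rewrite seg_opp seg_oppW (segC _ _ rt).
split.
- by rewrite le_max lexx.
- move=> i; rewrite /negf !ltrN2 -!/(negf _) !Xlt => it ri.
  have := bnd _ _ spI (leqnn _) (leqnn _) i ri it; rewrite segE.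
  by move/le_trans; apply; rewrite lerD2l ler_pM2l // le_max lexx orbT.
- have [_|lt] := leP (price x (-1) w r t) h; [by left|right].
  case: att => [pE|[a [c [j [[]]]]]]; first by move: lt; rewrite pE ltNge h0.
  rewrite !in_set2 => aI cI ac _ _ _ /andP[aj jc] Wj; exists j.
  rewrite /negf !ltrN2 -!/(negf _) segE.
  case/orP: aI => /eqP ?; case/orP: cI => /eqP ?; subst a c; rewrite ?Xlt //.
  + by rewrite ltxx in ac.
  + by move: ac; rewrite ltNge (ltW rt).
  + by rewrite ltxx in ac.
Qed.

(** * Termination and result of the joining procedure *)

Section Machine.
Variables (w : 'rV[R]_n.+1) (P : 'I_n.+1 -> 'I_n.+1 -> R -> {set 'I_n.+1} -> Prop).
Let W := vec w.
Let X' := negf X.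
Let W' := negf W.
Hypothesis P_ge0 : forall s t h I, P s t h I -> 0 <= h.
Hypothesis P_left : forall s t h I p h', P s t h I -> (s < t)%N ->
  lmove X W s t h p h' -> P p t h' (p |: I).
Hypothesis P_right : forall s t h I p h', P s t h I -> (s < t)%N ->
  lmove X' W' t s h p h' -> P s p h' (p |: I).

Definition stuck s t h := lstuck X W s t h /\ lstuck X' W' t s h.

(** A stuck left end is recorded only under t - s = u: then neither end has moved since step 2, and
    the record is still valid when step 8 stops. *)
Let Inv (st : state2 R n) : Prop := match st with
  | At2 s t h II => P s t h II /\ (s <= t)%N
  | At3 s t h II u J => [/\ P s t h II, (s.+1 < t)%N, (t - s <= u)%N & chain_after X W J s t]
  | At5 s t h II u => [/\ P s t h II, (s <= t)%N, (t - s <= u)%N, (0 < u)%N &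
      (t - s)%N = u -> lstuck X W s t h]
  | At6 s t h II u J => [/\ P s t h II, (s < t)%N, (t - s <= u)%N,
      (t - s)%N = u -> lstuck X W s t h & chain_after X' W' J t s]
  | At8 s t h II u => [/\ P s t h II, (s <= t)%N, (t - s <= u)%N, (0 < u)%N &
      (t - s)%N = u -> stuck s t h]
  end.

(** A lexicographic measure: width of the gap at the start of the sweep, position within the sweep,
    distance between the ends. *)
Let m (st : state2 R n) : nat := match st with
  | At2 s t h II => (t - s) * (n.+2 * 6) + n.+2 * 4
  | At3 s t h II u J => u * (n.+2 * 6) + n.+2 * 3 + (t - s)
  | At5 s t h II u => u * (n.+2 * 6) + n.+2 * 2
  | At6 s t h II u J => u * (n.+2 * 6) + n.+2 + (t - s)
  | At8 s t h II u => u * (n.+2 * 6)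
  end.

Let bound (t s : 'I_n.+1) : (t - s < n.+1)%N.
Proof. by have := ltn_ord t; lia. Qed.

Lemma next_left J s t : (s < t)%N -> chain_after X W J s t ->
  exists p, succ_in J s = Some p /\ tangent X W s t p.
Proof.
move=> st Js; have st' : X s < X t by rewrite Xlt.
have tJ : t \in J by apply/(Js t st'); split=> //; left.
have Pt : (t \in J) && (s < t)%N by rewrite tJ.
case: (@arg_minnP _ t (fun p => (p \in J) && (s < p)%N) val Pt) => p /andP[pJ sp] pmin.
have pt : (p <= t)%N by apply: pmin; rewrite tJ.
have gap i : i \in J -> (s < i)%N -> (i < p)%N -> False.
  by move=> iJ si; rewrite ltnNge pmin // iJ.
exists p; split.
  rewrite /succ_in (@omax_some _ J t) //=.
    rewrite leqNgt st /=; apply: omin_some; first by rewrite inE pJ.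
    by move=> k; rewrite inE => /andP[kJ sk]; apply: pmin; rewrite kJ.
  move=> k kJ; rewrite leqNgt; apply/negP => tk.
  have [] := (Js k _).1 kJ; first by rewrite Xlt; lia.
  by rewrite Xle; lia.
apply: (next_tangent Xinj st' Js pJ); first by rewrite Xlt.
by move=> i iJ; rewrite !Xlt; apply: gap.
Qed.

Lemma next_right J s t : (s < t)%N -> chain_after X' W' J t s ->
  exists p, pred_in J t = Some p /\ tangent X' W' t s p.
Proof.
move=> st Js; have st' : X' t < X' s by rewrite /X' /negf ltrN2 Xlt.
have sJ : s \in J by apply/(Js s st'); split=> //; left.
have Ps : (s \in J) && (s < t)%N by rewrite sJ.
case: (@arg_maxnP _ s (fun p => (p \in J) && (p < t)%N) val Ps) => p /andP[pJ pt] pmax.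
exists p; split.
  apply: omax_some; first by rewrite inE pJ.
  by move=> k; rewrite inE => /andP[kJ kt]; apply: pmax; rewrite kJ.
apply: (next_tangent oXinj st' Js pJ); first by rewrite /negf ltrN2 Xlt.
move=> i iJ; rewrite /X' /negf !ltrN2 !Xlt => it pi.
by have : (i <= p)%N by [apply: pmax; rewrite iJ]; rewrite leqNgt pi.
Qed.

(** [P] is left abstract so that one induction carries both [join_inv] and the comparison with an
    earlier closing. *)
Lemma run_join s t h I : P s t h I -> (s <= t)%N ->
  exists N s1 t1 h1 I1, [/\ run (next2 x w) N (At2 s t h I) = Some (s1, t1, h1, I1),
    P s1 t1 h1 I1, (s1 <= t1)%N & (t1 <= s1.+1)%N \/ stuck s1 t1 h1].
Proof.
move=> Pst st.
pose Post (out : 'I_n.+1 * 'I_n.+1 * R * {set 'I_n.+1}) : Prop :=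
  let: (s1, t1, h1, I1) := out in
  [/\ P s1 t1 h1 I1, (s1 <= t1)%N & (t1 <= s1.+1)%N \/ stuck s1 t1 h1].
have [|||N [[[[s1 t1] h1] I1] E []]] := @run_total _ _ (fun=> next2 x w) Inv m Post _ _ (At2 s t h I).
- by [].
- move=> {s t h I Pst st} [s t h I|s t h I u J|s t h I u|s t h I u J|s t h I u] /=.
  + move=> [Pst st]; exists 0%N; have [ts|ts] := leqP t s.+1.
      by left; eexists; [reflexivity|split=> //; left].
    right; eexists; split; first reflexivity.
      by split=> //; apply: hull_chain; lia.
    by have := bound t s; rewrite /=; lia.
  + move=> [Pst st ts Js]; exists 0%N; have {}st' : (s < t)%N by lia.
    have [p [-> tan]] := next_left st' Js.
    have [] := tan; rewrite Xlt Xle => sp pt _ /=.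
    have rs := raise_max (P_ge0 Pst) tan.
    rewrite lineE; case: ltP => [stk|mv].
      right; eexists; split; first reflexivity; last by rewrite /=; have := bound t s; lia.
      split=> //; [lia|lia|move=> _; eexists; eexists; split; [exact: tan|exact: rs|exact: stk]].
    have M : lmove X W s t h p (Num.max h (price x 1 w s p)) by [].
    have Pp := P_left Pst st' M.
    have [pt'|pt'] := ltnP p.+1 t.
      right; eexists; split; first reflexivity; last by rewrite /=; lia.
      by split=> //; [lia|apply: chain_after_shift Js tan; exact: Xinj].
    right; eexists; split; first reflexivity; last by rewrite /=; have := bound t s; lia.
    by split=> //; lia.
  + move=> [Pst st ts u0 H]; exists 0%N; case: eqP => [E|sNt].
      left; eexists; first reflexivity.
      by split=> //; left; rewrite E.
    have st' : (s < t)%N by rewrite ltn_neqAle st andbT; apply/eqP => /val_inj.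
    right; eexists; split; first reflexivity; last by rewrite /=; have := bound t s; lia.
    by split=> //; apply: hull_chain_opp.
  + move=> [Pst st ts H Js]; exists 0%N.
    have [p [-> tan]] := next_right st Js.
    have [] := tan; rewrite /X' /negf ltrN2 lerN2 Xlt Xle => pt sp _ /=.
    have rs := raise_max_opp (P_ge0 Pst) tan.
    have segE : seg X' W' t p s = - line x w s p t.
      by rewrite /X' /W' seg_opp (segC _ _ (_ : X p < X t)) ?Xlt.
    have u0 : (0 < u)%N by lia.
    case: ltP => [stk|mv].
      right; eexists; split; first reflexivity; last by rewrite /=; have := bound t s; lia.
      split=> //; [lia|move=> tsu; split; [exact: H|]].
      eexists; eexists; split; [exact: tan|exact: rs|].
      by rewrite segE /W' /negf /W /vec; lra.
    have M : lmove X' W' t s h p (Num.max h (price x (-1) w p t)).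
      by split=> //; rewrite segE /W' /negf /W /vec; lra.
    have Pp := P_right Pst st M.
    case: ltnP => sp'.
      right; eexists; split; first reflexivity; last by rewrite /=; lia.
      split=> //; [lia|lia|apply: chain_after_shift Js tan; exact: oXinj].
    right; eexists; split; first reflexivity; last by rewrite /=; lia.
    by split=> //; lia.
  + move=> [Pst st ts u0 H]; exists 0%N; case: eqP => [tsu|tsu].
      by left; eexists; [reflexivity|split=> //; right; apply: H].
    right; eexists; split; [reflexivity|by []|rewrite /=; nia].
- by [].
- by move=> Ps1 le cl; exists N, s1, t1, h1, I1.
Qed.

End Machine.

End Data.

Lemma onth_some (T : Type) (x0 : T) s i : (i < size s)%N -> onth s i = Some (nth x0 s i).
Proof. by move=> is_; rewrite onthE (nth_map x0). Qed.

(** * Locality of the join invariant *)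

Section JoinInvFacts.
Variables (R : realFieldType) (T : finType).
Implicit Types (X W : T -> R) (a c i j k p r s t z : T) (I J : {set T}) (h : R).

Lemma consec_ext X (lo hi : T) I I' a c :
  (forall i, X lo <= X i -> X i <= X hi -> (i \in I) = (i \in I')) ->
  X lo <= X a -> X c <= X hi -> consec X I a c -> consec X I' a c.
Proof.
move=> ext loa chi [aI cI ac gap].
split=> //; rewrite -?ext // ?(le_trans loa (ltW ac)) ?(le_trans (ltW ac) chi) //.
move=> i iI ai ic; apply: (gap i) => //; rewrite ext //.
- by rewrite (le_trans loa) // ltW.
- by apply: le_trans chi; apply: ltW.
Qed.

Lemma left_part_ext X W s' s t hi h I I' :
  (forall i, X s' <= X i -> X i <= X hi -> (i \in I) = (i \in I')) ->
  X s <= X hi -> left_part X W s' s t h I -> left_part X W s' s t h I'.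
Proof.
move=> ext shi [edge vert slope].
have ext' i : X s' <= X i -> X i <= X hi -> (i \in I') = (i \in I).
  by move=> *; rewrite ext.
split.
- move=> a c ac s'a cs; apply: edge => //.
  exact: (consec_ext ext' s'a (le_trans cs shi) ac).
- move=> p pI s'p ps; apply: vert => //.
  by rewrite ext // ?(ltW s'p) ?(le_trans ps shi).
- move=> a ac s'a; apply: slope => //.
  exact: (consec_ext ext' s'a shi ac).
Qed.

Lemma attains_ext X W lo hi I I' h :
  (forall i, X lo <= X i -> X i <= X hi -> (i \in I) = (i \in I')) ->
  attains X W lo hi I h -> attains X W lo hi I' h.
Proof.
move=> ext [a [c [j [ac loa chi aj Wj]]]]; exists a, c, j; split=> //.
exact: (consec_ext ext loa chi ac).
Qed.

(** The invariant looks at I only between the ends of the gap, so closing the other joins does not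
    disturb it. *)
Lemma join_inv_ext X W s' t' h0 s t h I I' :
  (forall i, X s' <= X i -> X i <= X t' -> (i \in I) = (i \in I')) ->
  join_inv X W s' t' h0 s t h I -> join_inv X W s' t' h0 s t h I'.
Proof.
move=> ext J; have [[s's st] tt'] := (ji_le1 J, ji_le2 J, ji_le3 J).
have st' := le_trans st tt'; have s't := le_trans s's st.
have s't' := le_trans s't tt'.
have ext' i : negf X t' <= negf X i -> negf X i <= negf X s' -> (i \in I) = (i \in I').
  by rewrite /negf !lerN2 => *; apply: ext.
split=> //; try by case: J.
- by rewrite -ext // (ji_mem1 J).
- by rewrite -ext // (ji_mem2 J).
- by rewrite -ext // (ji_mem3 J).
- by rewrite -ext // (ji_mem4 J).
- move=> i iI si it; apply: (ji_gap J _ si it); rewrite ext //.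
  + by apply: le_trans s's _; apply: ltW.
  + by apply: le_trans (ltW it) _.
- exact: left_part_ext ext st' (ji_left J).
- by apply: left_part_ext ext' _ (ji_right J); rewrite /negf lerN2.
- case: (ji_att J) => [hE|att|att]; [exact: Or31|apply: Or32|apply: Or33].
  + by apply: attains_ext att => i s'i /le_trans/(_ st'); apply: ext.
  + by apply: attains_ext att => i t'i /le_trans; rewrite /negf => H; apply: ext' => //; apply: H; rewrite lerN2.
Qed.

Lemma join_inv_start X W s' t' h I : consec X I s' t' -> join_inv X W s' t' h s' t' h I.
Proof.
move=> [sI tI st gap]; split=> //.
- exact: ltW.
- by move=> sE; rewrite sE ltxx in st.
- split.
  + move=> a c [_ _ ac _] s'a cs' i ai ic.
    by have := lt_trans ai ic; rewrite ltNge (le_trans cs').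
  + by move=> p _ s'p ps'; have := lt_le_trans s'p ps'; rewrite ltxx.
  + move=> a [_ _ ac _] s'a; have := lt_le_trans ac s'a; rewrite ltxx //.
- split.
  + move=> a c [_ _ ac _] s'a cs' i ai ic.
    by have := lt_trans ai ic; rewrite ltNge (le_trans cs').
  + by move=> p _ s'p ps'; have := lt_le_trans s'p ps'; rewrite ltxx.
  + move=> a [_ _ ac _] s'a; have := lt_le_trans ac s'a; rewrite ltxx //.
- exact: Or31.
Qed.

End JoinInvFacts.

(** * Specification of closejoin *)

Section CloseJoin.
Variables (R : realType) (n : nat) (x f : 'rV[R]_n.+1).
Hypothesis x_incr : forall i j : 'I_n.+1, (i < j)%N -> x 0 i < x 0 j.
Implicit Types (I J : {set 'I_n.+1}) (i j k p r s t : 'I_n.+1) (b : nat).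
Implicit Types (h : R) (SS : seq 'I_n.+1).

Notation X := (X x).

(* The data seen by the join number [b], counted from 0. *)
Definition U b : 'I_n.+1 -> R := fun i => (-1) ^+ b * f 0 i.

Lemma vec_signed b : vec (if odd b.+1 then f else - f) = U b.
Proof.
apply: funext => i; rewrite /vec /U -signr_odd /=.
by case: (odd b) => /=; rewrite ?mxE ?expr1 ?expr0 ?mulN1r ?mul1r.
Qed.

Definition closed_join b s' t' h0 s t h I :=
  [/\ join_inv X (U b) s' t' h0 s t h I, tube X (U b) s t h &
      tube (negf X) (negf (U b)) t s h].

(** The last clause compares with an earlier closing of the same gap that ended below the present
    starting value: nothing is raised this time. For it, [extra] keeps the current ends on the
    earlier chains, as [rerun_lmove] requires. *)
Lemma closejoin_spec b SS I t' h0 : (b < size SS)%N ->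
  let s' := nth ord0 SS b in consec X I s' t' -> 0 <= h0 ->
  exists N s t h I1,
  [/\ closejoin x f N b.+1 h0 I SS = Some (h, I1, set_nth ord0 SS b s),
      closed_join b s' t' h0 s t h I1,
      forall i, (i <= s')%N || (t' <= i)%N -> (i \in I1) = (i \in I) &
      forall s1 t1 h1 hb I2, 0 <= h1 -> closed_join b s' t' h1 s1 t1 hb I2 ->
        hb < h0 -> h = h0].
Proof.
move=> bS s' s't' h00; have s'lt : (s' < t')%N by case/consecP: s't'.
pose extra s t h := forall s1 t1 h1 hb I2, 0 <= h1 ->
  closed_join b s' t' h1 s1 t1 hb I2 -> hb < h0 ->
  [/\ h = h0, s \in I2, X s <= X s1, t \in I2 & X t1 <= X t].
pose P s t h I1 := [/\ join_inv X (U b) s' t' h0 s t h I1,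
  forall i, (i <= s')%N || (t' <= i)%N -> (i \in I1) = (i \in I) & extra s t h].
pose w := if odd b.+1 then f else - f.
have wE : vec w = U b := vec_signed b.
have [|||||N [s [t [h [I1 [E [J frame ex] st cl]]]]]] := @run_join R n x x_incr w P _ _ _ s' t' h0 I.
- by move=> s t h I1 [J _ _]; apply: le_trans (ji_h J).
- move=> s t h I1 p h' [J frame ex] st; rewrite wE => M.
  have [[sp pt _] _ _] := M.
  have [s's tt'] := (ji_le1 J, ji_le3 J).
  have JM := join_inv_lmove (Xinj x_incr) J h00 M.
  split; first exact: JM.
    move=> i ip; rewrite in_setU1 frame //; case: eqP => // iE; subst i.
    move: sp pt s's tt' ip; rewrite !(Xlt x_incr) !(Xle x_incr) => sp pt s's tt' ip.
    have -> : p = t' by apply/val_inj => /=; lia.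
    by case: s't' => _ ->.
  move=> s1 t1 h1 hb I2 h10 C hb0; have [J2 tb _] := C.
  have [hE sI ss1 tI t1t] := ex _ _ _ _ _ h10 C hb0.
  rewrite -hE in hb0.
  have [pI ps1 h'h] := rerun_lmove (Xinj x_incr) J2 tb h10 hb0 sI s's ss1 tI t1t tt' M.
  by rewrite h'h.
- move=> s t h I1 p h' [J frame ex] st; rewrite wE => M.
  have Jo := join_inv_opp J.
  have [[sp pt _] _ _] := M.
  have [s's tt'] := (ji_le1 Jo, ji_le3 Jo).
  split.
  + have := join_inv_opp (join_inv_lmove (oXinj x_incr) Jo h00 M).
    by rewrite !opp_opp.
  + move=> i ip; rewrite in_setU1 frame //; case: eqP => // iE; subst i.
    move: sp pt s's tt' ip; rewrite /negf !ltrN2 !lerN2 !(Xlt x_incr) !(Xle x_incr) => sp pt s's tt' ip.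
    have -> : p = s' by apply/val_inj => /=; lia.
    by case: s't' => ->.
  move=> s1 t1 h1 hb I2 h10 C hb0; have [J2 _ tb] := C.
  have [hE sI ss1 tI t1t] := ex _ _ _ _ _ h10 C hb0.
  rewrite -hE in hb0.
  have t1t' : negf X t <= negf X t1 by rewrite /negf lerN2.
  have ss1' : negf X s1 <= negf X s by rewrite /negf lerN2.
  have [pI pt1 ->] := rerun_lmove (oXinj x_incr) (join_inv_opp J2) tb h10 hb0 tI s's t1t' sI ss1' tt' M.
  by split=> //; move: pt1; rewrite /negf lerN2.
- split=> //; first exact: join_inv_start.
  move=> s1 t1 h1 hb I2 h10 [J2 _ _] hb0.
  by split=> //; [exact: ji_mem1 J2|exact: ji_le1 J2|exact: ji_mem4 J2|exact: ji_le3 J2].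
- exact: ltnW.
move: cl; rewrite /stuck wE => cl.
exists N, s, t, h, I1; split.
- rewrite /closejoin (onth_some ord0) //= -/s' (consec_succ x_incr s't') /=.
  by rewrite E.
- split=> //; case: cl => [le|[L1 L2]] i.
  + by rewrite !(Xlt x_incr); lia.
  + exact: stuck_tube L1 L2 i.
  + by rewrite /negf !ltrN2 !(Xlt x_incr); lia.
  + by apply: (stuck_tube L2 _ (i := i)); rewrite !opp_opp.
- exact: frame.
- move=> s1 t1 h1 hb I2 h10 C hb0; by have [] := ex _ _ _ _ _ h10 C hb0.
Qed.

(* The slope conditions are the only part of [closed_join] that may be lost   *)
(* when [h] is increased.                                                     *)
Lemma closed_join_raise b s' t' h0 s t hb h I :
  closed_join b s' t' h0 s t hb I -> hb <= h -> 0 <= h0 -> 0 < hb ->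
  (forall a, consec X I a s -> X s' <= X a -> seg X (U b) a s t <= U b t - 2 * h) ->
  (forall c, consec X I t c -> X c <= X t' -> U b s + 2 * h <= seg X (U b) t c s) ->
  closed_join b s' t' h s t h I.
Proof.
move=> [J tl tr] hbh h00 hb0 sl sr.
have lst : X s < X t.
  by rewrite lt_neqAle (ji_le2 J) andbT; apply/eqP => /(ji_eq J) E; rewrite E ltxx in hb0.
have [edge vert _] := ji_left J; have [edge' vert' _] := ji_right J.
have mono i : X s < X i -> X i < X t -> low X (U b) s t h i <= low X (U b) s t hb i.
  move=> si it; have /= := @aff_ge0 _ _ X (fun z => low X (U b) s t hb z - low X (U b) s t h z)
     s i t (affB (aff_low _ _ _ _ _) (aff_low _ _ _ _ _)) (ltW si) (ltW it).
  rewrite !lowl subrr !lowr // !subr_ge0 => H; apply: H => //; lra.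
have lstn : negf X t < negf X s by rewrite /negf ltrN2.
have mono' i : X s < X i -> X i < X t ->
    low (negf X) (negf (U b)) t s h i <= low (negf X) (negf (U b)) t s hb i.
  move=> si it; have /= := @aff_ge0 _ _ (negf X) (fun z => low (negf X) (negf (U b)) t s hb z
      - low (negf X) (negf (U b)) t s h z)
     t i s (affB (aff_low _ _ _ _ _) (aff_low _ _ _ _ _)).
  rewrite /negf !lerN2 -!/(negf _) => /(_ (ltW it) (ltW si)).
  rewrite !lowl subrr !lowr // !subr_ge0 => H; apply: H => //; lra.
split.
- split; try by case: J.
  + by move=> E; rewrite E ltxx in lst.
  + split=> // a c ac s'a cs i ai ic; have [? ?] := edge a c ac s'a cs i ai ic.
    by split=> //; lra.
  + split=> //.
      move=> a c ac s'a cs i ai ic; have [? ?] := edge' a c ac s'a cs i ai ic.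
      by split=> //; lra.
    move=> c /consec_opp tc; rewrite /negf lerN2 => ct'; have := sr c tc ct'.
    have ltc : X t < X c by case: tc.
    by rewrite -!/(negf _) seg_opp (segC _ _ ltc) /negf; lra.
  + exact: Or31.
- by move=> i si it; apply: le_lt_trans (mono i si it) (tl i si it).
- move=> i si it; apply: le_lt_trans (tr i si it); apply: mono'.
  + by move: it; rewrite /negf ltrN2.
  + by move: si; rewrite /negf ltrN2.
Qed.

End CloseJoin.

(* Preprocessing the hypotheses over the reals dominates the cost of [lia]. *)
Ltac nlia := repeat match goal with
  | H : is_true (leq _ _) |- _ => revert H | H : @eq nat _ _ |- _ => revert H end;
  clear; lia.

(** * Convexity in terms of slopes *)

Section Slope.
Variables (R : realFieldType) (T : finType) (X : T -> R).
Implicit Types (W : T -> R) (i j k : T).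

Definition slope W i j := (W j - W i) / (X j - X i).

Lemma slopeE W i j : X i < X j -> W j = W i + slope W i j * (X j - X i).
Proof. by move=> ij; rewrite /slope divfK ?subr_eq0 ?gt_eqF // addrC subrK. Qed.

Lemma seg_slope W i j z : seg X W i j z = W i + slope W i j * (X z - X i).
Proof. by []. Qed.

Lemma le_slope W i j k : X i < X j -> X j < X k ->
  (seg X W i j k <= W k) = (slope W i j <= slope W j k).
Proof.
move=> ij jk; rewrite (slopeE W jk) (_ : seg X W i j k = W j + slope W i j * (X k - X j)).
  by rewrite lerD2l ler_pM2r // subr_gt0.
by rewrite seg_slope (slopeE W ij); ring.
Qed.

Lemma ge_slope W i j k : X i < X j -> X j < X k ->
  (W k <= seg X W i j k) = (slope W j k <= slope W i j).
Proof.
move=> ij jk; rewrite (slopeE W jk) (_ : seg X W i j k = W j + slope W i j * (X k - X j)).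
  by rewrite lerD2l ler_pM2r // subr_gt0.
by rewrite seg_slope (slopeE W ij); ring.
Qed.

Lemma cvx_slope W i j k : X i < X j -> X j < X k ->
  cvx X W i j k <-> slope W i j < slope W j k.
Proof.
move=> ij jk; rewrite (cvx_right _ ij jk) !ltNge.
by rewrite ge_slope.
Qed.

Lemma slope_scale c W i j : slope (fun z => c * W z) i j = c * slope W i j.
Proof. by rewrite /slope; ring. Qed.

End Slope.

(** * Numbering the pieces *)

Section Labels.
Variable n : nat.
Implicit Types (SS : seq 'I_n.+1) (i j : 'I_n.+1).

(* For an index in I, the number of the piece it belongs to, counted from 0. *)
Definition lab SS i : nat := count (fun s : 'I_n.+1 => (s < i)%N) SS.

Lemma lab_nth SS i k : sorted (fun i j : 'I_n.+1 => (i <= j)%N) SS ->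
  (k < size SS)%N -> (nth ord0 SS k < i)%N = (k < lab SS i)%N.
Proof.
rewrite /lab; elim: SS k => // a SS IH k /= pa.
have trans : transitive (fun i j : 'I_n.+1 => (i <= j)%N) by move=> ? ? ?; apply: leq_trans.
have all_a := order_path_min trans pa.
case: (ltnP a i) => [ai|ia]; last first.
  move=> kS; rewrite add0n.
  have -> : count (fun s : 'I_n.+1 => (s < i)%N) SS = 0%N.
    apply/eqP; rewrite -leqn0 leqNgt -has_count; apply/hasPn => s sS.
    by rewrite -leqNgt (leq_trans ia) //; apply: (allP all_a).
  apply/negbTE; rewrite -leqNgt; case: k kS => //= k kS.
  by rewrite (leq_trans ia) //; apply: (allP all_a); rewrite mem_nth.
case: k => [|k] //= kS; rewrite IH //.
exact: path_sorted pa.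
Qed.

Lemma lab_eq SS i b : sorted (fun i j : 'I_n.+1 => (i <= j)%N) SS ->
  (b < size SS)%N -> (forall k, (k < b)%N -> (nth ord0 SS k < i)%N) ->
  (i <= nth ord0 SS b)%N -> lab SS i = b.
Proof.
move=> so bS lo hi; apply/eqP; rewrite eqn_leq; apply/andP; split.
  by rewrite leqNgt -lab_nth // -leqNgt.
by case: b bS lo hi => // b bS lo hi; rewrite -lab_nth ?lo // ltnW.
Qed.

Lemma lab_le SS i j : (i <= j)%N -> (lab SS i <= lab SS j)%N.
Proof. by move=> ij; apply: sub_count => s /= /leq_trans; apply. Qed.

Lemma lab_lt_size SS i : SS != [::] -> last ord0 SS = ord_max ->
  sorted (fun i j : 'I_n.+1 => (i <= j)%N) SS -> (lab SS i < size SS)%N.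
Proof.
move=> S0 lS so; have sz : (0 < size SS)%N by case: (SS) S0.
rewrite -(prednK sz) ltnS leqNgt -lab_nth ?prednK // nth_last lS -leqNgt.
by rewrite -ltnS ltn_ord.
Qed.

End Labels.

(** * Good states *)

Section Good.
Variables (R : realType) (n : nat) (x f : 'rV[R]_n.+1).
Hypothesis x_incr : forall i j : 'I_n.+1, (i < j)%N -> x 0 i < x 0 j.
Implicit Types (I J : {set 'I_n.+1}) (i j p u v : 'I_n.+1) (b k : nat).
Implicit Types (h H : R) (SS : seq 'I_n.+1).

Notation X := (X x).
Notation U := (U f).
Let Xlt' := Xlt x_incr.
Let Xle' := Xle x_incr.

Definition yv h SS i := f 0 i + (-1) ^+ lab SS i * h.

(** The polygon in the orientation that makes piece b convex; across join b its vertices pass from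
    [U b + h] to [U b - h]. *)
Definition Z h SS b i := (-1) ^+ b * yv h SS i.

(* The state ([h], [I], [SS]) describes the polygon through the points         *)
(* [yv h SS i], [i] in [I].  At [h = 0] the ends of a join may coincide, and   *)
(* no convexity is required at the elements of [SS].                          *)
Record good h I SS : Prop := Good {
  g_pieces : piece_set I SS;
  g_ord0 : ord0 \in I;
  g_ge0 : 0 <= h;
  g_dist : forall a c, consec X I a c -> forall i, (a < i)%N -> (i < c)%N ->
    `|f 0 i - seg X (yv h SS) a c i| <= h;
  g_convex : forall a p c, consec X I a p -> consec X I p c -> (p \in SS -> 0 < h) ->
    slope X (Z h SS (lab SS p)) a p <= slope X (Z h SS (lab SS p)) p c;
  g_strict : 0 < h -> sorted (fun i j : 'I_n.+1 => (i < j)%N) SS;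
  g_vertex : 0 < h -> forall i p (k : 'I_n.+1), p \in I -> (i < p)%N -> (p < k)%N ->
    (forall c, c \in I -> (i < c)%N -> (c < k)%N -> lab SS c = lab SS p) ->
    cvx X (U (lab SS p)) i p k;
  g_edge : 0 < h -> forall a c, consec X I a c -> lab SS a = lab SS c ->
    forall i, (a < i)%N -> (i < c)%N -> seg X (U (lab SS a)) a c i <= U (lab SS a) i }.

Lemma sign_sq b : (-1) ^+ b * (-1) ^+ b = 1 :> R.
Proof. by rewrite -signr_odd; case: odd; rewrite ?mulrNN mulr1. Qed.

Lemma Z_lab h SS b i : lab SS i = b -> Z h SS b i = U b i + h.
Proof.
by move=> lb; rewrite /Z /yv /U lb mulrDr mulrA sign_sq mul1r.
Qed.

Lemma Z_labS h SS b i : lab SS i = b.+1 -> Z h SS b i = U b i - h.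
Proof.
by move=> lb; rewrite /Z /yv /U lb exprS mulrDr mulN1r mulNr mulrN mulrA sign_sq mul1r.
Qed.

Lemma Z_h0 SS b i : Z 0 SS b i = U b i.
Proof. by rewrite /Z /yv mulr0 addr0. Qed.

Lemma US b : U b.+1 = negf (U b).
Proof. by apply: funext => i; rewrite /U /negf exprS mulN1r mulNr. Qed.

Lemma ZS h SS b : Z h SS b.+1 = negf (Z h SS b).
Proof. by apply: funext => i; rewrite /Z /negf exprS mulN1r mulNr. Qed.

Lemma slopeN W i j : slope X (negf W) i j = - slope X W i j.
Proof. by rewrite /slope /negf; ring. Qed.

Lemma dist_Z h SS b a c i :
  `|f 0 i - seg X (yv h SS) a c i| = `|U b i - seg X (Z h SS b) a c i|.
Proof.
rewrite /Z (seg_scale x) /U -mulrBr normrM normrX normrN1 expr1n mul1r //.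
Qed.

Lemma good_max h I SS : good h I SS -> ord_max \in I.
Proof.
move=> G; have [so sub S0 <-] := g_pieces G; apply: sub.
by case: (SS) S0 => // a S1 _; rewrite /= mem_last.
Qed.

(** In the orientation of its piece, the edge of the polygon is h above the data at a and c and h
    below them at j; this alternation is the source of optimality. *)
Definition attained h I SS := exists a c j,
  [/\ consec X I a c, lab SS a = lab SS c, (a < j)%N, (j < c)%N &
      U (lab SS a) j = seg X (U (lab SS a)) a c j + 2 * h].

(** * Joins closed at a common h form a good state *)

Section Assemble.
Variables (H h : R) (I' I : {set 'I_n.+1}) (SS' SS : seq 'I_n.+1) (q : nat).
Variables (t' t : nat -> 'I_n.+1).
Let s' b := nth ord0 SS' b.
Let s b := nth ord0 SS b.
Hypothesis G' : good H I' SS'.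
Hypothesis H0 : 0 < H.
Hypothesis hH : h <= H.
Hypothesis h0 : 0 <= h.
Hypothesis sz' : size SS' = q.+1.
Hypothesis sz : size SS = q.+1.
Hypothesis sq : s q = ord_max.
Hypothesis s't' : forall b, (b < q)%N -> consec X I' (s' b) (t' b).
Hypothesis closed : forall b, (b < q)%N ->
  closed_join x f b (s' b) (t' b) h (s b) (t b) h I.
Hypothesis frame : forall i, (forall b, (b < q)%N -> (s' b < i)%N -> (i < t' b)%N -> False) ->
  (i \in I) = (i \in I').
Hypothesis edges : forall a c, consec X I' a c -> lab SS' a = lab SS' c ->
  forall i, (a < i)%N -> (i < c)%N ->
  U (lab SS' a) i <= seg X (U (lab SS' a)) a c i + 2 * h.

Let sorted' : sorted (fun i j : 'I_n.+1 => (i <= j)%N) SS'.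
Proof. by case: (g_pieces G'). Qed.

Let s'q : s' q = ord_max.
Proof. by case: (g_pieces G') => _ _ _; rewrite (last_nth ord0) sz' /=. Qed.

Let s'_lt b c : (b < c)%N -> (c <= q)%N -> (s' b < s' c)%N.
Proof.
move=> bc cq; have so := g_strict G' H0.
have tr : transitive (fun i j : 'I_n.+1 => (i < j)%N) by move=> ? ? ?; apply: ltn_trans.
by apply: (sorted_ltn_nth tr ord0 so) => //; rewrite inE sz'; lia.
Qed.

Let s'I b : (b <= q)%N -> s' b \in I'.
Proof.
by move=> bq; case: (g_pieces G') => _ sub _ _; apply: sub; rewrite mem_nth // sz'.
Qed.

Let t's' b c : (b < c)%N -> (c <= q)%N -> (t' b <= s' c)%N.
Proof.
move=> bc cq; have /(consecP x_incr)[_ _ _ gap] := s't' (leq_trans bc cq).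
rewrite leqNgt; apply/negP => lt; apply: (gap (s' c)) => //; [exact: s'I|exact: s'_lt].
Qed.

Let s't'lt b : (b < q)%N -> (s' b < t' b)%N.
Proof. by move=> bq; case/(consecP x_incr): (s't' bq). Qed.

Let inv b : (b < q)%N -> join_inv X (U b) (s' b) (t' b) h (s b) (t b) h I.
Proof. by move=> bq; case: (closed bq). Qed.

Let le_s's b : (b < q)%N -> (s' b <= s b)%N.
Proof. by move=> bq; rewrite -Xle'; exact: ji_le1 (inv bq). Qed.
Let le_st b : (b < q)%N -> (s b <= t b)%N.
Proof. by move=> bq; rewrite -Xle'; exact: ji_le2 (inv bq). Qed.
Let le_tt' b : (b < q)%N -> (t b <= t' b)%N.
Proof. by move=> bq; rewrite -Xle'; exact: ji_le3 (inv bq). Qed.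

Let lt_st b : 0 < h -> (b < q)%N -> (s b < t b)%N.
Proof.
move=> hp bq; rewrite -Xlt' lt_neqAle (ji_le2 (inv bq)) andbT.
by apply/eqP => /(ji_eq (inv bq)) E; rewrite E ltxx in hp.
Qed.

Let le_s's' b : (b <= q)%N -> (s' b <= s b)%N.
Proof.
rewrite leq_eqVlt => /orP[/eqP ->|]; last exact: le_s's.
by rewrite s'q sq.
Qed.

Let s_sorted : sorted (fun i j : 'I_n.+1 => (i <= j)%N) SS.
Proof.
apply/(sortedP ord0) => i; rewrite sz => iq; rewrite -!/(s _).
have bq : (i < q)%N by lia.
apply: leq_trans (le_st bq) _; apply: leq_trans (le_tt' bq) _.
by apply: leq_trans (t's' (ltnSn i) bq) _; apply: le_s's'.
Qed.

(* [i] lies in the old piece number [b], ends included. *)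
Definition in_piece b i := [/\ (b <= q)%N, forall k, (k < b)%N -> (t' k <= i)%N &
  forall k, (b <= k)%N -> (k <= q)%N -> (i <= s' k)%N].

Let in_piece_lab b i : in_piece b i -> lab SS' i = b.
Proof.
move=> [bq lo hi]; apply: lab_eq; rewrite // ?sz' //; last exact: hi.
by move=> k kb; apply: leq_trans (lo _ kb); apply: s't'lt; lia.
Qed.

Let position i : (exists b, [/\ (b < q)%N, (s' b < i)%N & (i < t' b)%N]) \/
  in_piece (lab SS' i) i.
Proof.
have [_ _ S0 lS] := g_pieces G'.
have lq : (lab SS' i <= q)%N by have := lab_lt_size i S0 lS sorted'; rewrite sz'.
have lo k : (k < lab SS' i)%N -> (s' k < i)%N.
  by move=> kl; rewrite lab_nth // sz'; lia.
have hi k : (lab SS' i <= k)%N -> (k <= q)%N -> (i <= s' k)%N.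
  by move=> lk kq; rewrite leqNgt lab_nth // ?sz' // -leqNgt.
case E : (lab SS' i) lq lo hi => [|b] lq lo hi; first by right.
have [it|ti] := ltnP i (t' b).
  by left; exists b; split=> //; apply: lo.
right; split=> // k; rewrite ltnS leq_eqVlt => /orP[/eqP -> //|kb].
by apply: leq_trans (t's' kb (ltnW lq)) _; apply: ltnW; apply: lo.
Qed.

Let in_piece_gap b i : in_piece b i -> forall k, (k < q)%N -> (s' k < i)%N ->
  (i < t' k)%N -> False.
Proof.
move=> [bq lo hi] k kq ki ik; have [kb|bk] := ltnP k b.
  by move: ik; rewrite ltnNge lo.
by move: ki; rewrite ltnNge hi // ltnW.
Qed.

Let in_piece_mem b i : in_piece b i -> (i \in I) = (i \in I').
Proof. by move=> Pi; apply: frame; exact: (in_piece_gap Pi). Qed.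

Let in_piece_left b k i : in_piece b i -> (k < q)%N -> (s' k <= i)%N -> (i < t' k)%N ->
  i = s' k /\ b = k.
Proof.
move=> Pi kq ki ik; have E : i = s' k.
  move: ki; rewrite leq_eqVlt => /orP[/eqP/val_inj -> //|ki].
  by case: (in_piece_gap Pi kq ki ik).
split=> //; have [bq lo hi] := Pi; apply/eqP; rewrite eqn_leq; apply/andP; split.
  by rewrite leqNgt; apply/negP => /lo; rewrite leqNgt ik.
rewrite leqNgt; apply/negP => bk; have := hi b (leqnn _) bq.
by rewrite E leqNgt s'_lt // ltnW.
Qed.

Let in_piece_right b k i : in_piece b i -> (k < q)%N -> (s' k < i)%N -> (i <= t' k)%N ->
  i = t' k /\ b = k.+1.
Proof.
move=> Pi kq ki ik; have E : i = t' k.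
  move: ik; rewrite leq_eqVlt => /orP[/eqP/val_inj -> //|ik].
  by case: (in_piece_gap Pi kq ki ik).
split=> //; have [bq lo hi] := Pi; apply/eqP; rewrite eqn_leq; apply/andP; split.
  rewrite leqNgt; apply/negP => kb; have := lo _ kb; rewrite E leqNgt.
  by rewrite (leq_ltn_trans (t's' (ltnSn k) kq)) // s't'lt //; lia.
rewrite ltnNge; apply/negP => bk; have := hi k bk (ltnW kq).
by rewrite E leqNgt s't'lt.
Qed.

Let lab_left b i : (b < q)%N -> (s' b < i)%N || (0 < h) -> (s' b <= i)%N -> (i <= s b)%N ->
  lab SS i = b.
Proof.
move=> bq st si is_; apply: lab_eq; rewrite ?sz //; first lia.
move=> k kb; rewrite -/(s k); have kq : (k < q)%N by lia.
have t's := t's' kb (ltnW bq); have := le_tt' kq; have := le_st kq.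
by case/orP: st => [?|/lt_st/(_ kq)]; lia.
Qed.

Let lab_right b i : (b < q)%N -> (s b < i)%N -> (i <= t' b)%N -> lab SS i = b.+1.
Proof.
move=> bq si it'; apply: lab_eq; rewrite ?sz //; last first.
  exact: leq_trans it' (leq_trans (t's' (ltnSn b) bq) (le_s's' bq)).
move=> k; rewrite ltnS leq_eqVlt => /orP[/eqP -> //|kb]; rewrite -/(s k).
have kq : (k < q)%N by lia.
have := t's' kb (ltnW bq); have := le_tt' kq; have := le_st kq; have := le_s's bq; lia.
Qed.

Let lab_piece b i : (i \in SS -> 0 < h) -> in_piece b i -> lab SS i = b.
Proof.
move=> iS [bq lo hi]; apply: lab_eq; rewrite // ?sz //; last first.
  exact: leq_trans (hi b _ _) (le_s's' _).
move=> k kb; have kq : (k < q)%N by lia.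
have le_si : (s k <= i)%N by apply: leq_trans (le_st kq) (leq_trans (le_tt' kq) (lo k kb)).
rewrite ltn_neqAle le_si andbT; apply/eqP => /val_inj E.
have hp : 0 < h by apply: iS; rewrite -E mem_nth // sz; lia.
by have := lo k kb; have := le_tt' kq; have := lt_st hp kq; rewrite -E -/(s k); lia.
Qed.

Let Z_left b i : (b < q)%N -> (s' b <= i)%N -> (i <= s b)%N -> Z h SS b i = U b i + h.
Proof.
move=> bq si is_; have [h_eq0|hp] := eqVneq h 0; first by rewrite h_eq0 Z_h0 addr0.
by apply: Z_lab; apply: lab_left; rewrite // lt_neqAle eq_sym hp h0 orbT.
Qed.

Let Z_right b i : (b < q)%N -> (t b <= i)%N -> (i <= t' b)%N -> Z h SS b i = U b i - h.
Proof.
move=> bq si is_; have [h_eq0|hp] := eqVneq h 0; first by rewrite h_eq0 Z_h0 subr0.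
apply: Z_labS; apply: lab_right => //; apply: leq_trans si; apply: lt_st => //.
by rewrite lt_neqAle eq_sym hp.
Qed.

Let Z_piece b i : in_piece b i -> Z h SS b i = U b i + h.
Proof.
move=> Pi; have [h_eq0|hp] := eqVneq h 0; first by rewrite h_eq0 Z_h0 addr0.
by apply: Z_lab; apply: lab_piece => // _; rewrite lt_neqAle eq_sym hp.
Qed.

Let edge_cases u v : consec X I u v ->
  [\/ exists b, [/\ (b < q)%N, (s' b <= u)%N & (v <= s b)%N],
      exists b, [/\ (b < q)%N, u = s b & v = t b],
      exists b, [/\ (b < q)%N, (t b <= u)%N & (v <= t' b)%N] |
      exists b, [/\ in_piece b u, in_piece b v & consec X I' u v]].
Proof.
move=> /(consecP x_incr)[uI vI uv gap].
have gap' w : w \in I -> (w < v)%N -> (w <= u)%N.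
  by move=> wI wv; rewrite leqNgt; apply/negP => uw; apply: (gap w).
have ingap b : (b < q)%N -> (s' b < v)%N -> (v <= t' b)%N ->
  [\/ exists b, [/\ (b < q)%N, (s' b <= u)%N & (v <= s b)%N],
      exists b, [/\ (b < q)%N, u = s b & v = t b] |
      exists b, [/\ (b < q)%N, (t b <= u)%N & (v <= t' b)%N]].
  move=> bq sv vt; have J := inv bq.
  have s'u : (s' b <= u)%N by apply: gap' sv; exact: ji_mem1 J.
  have [vs|sv'] := leqP v (s b); first by apply: Or31; exists b.
  have su : (s b <= u)%N by apply: gap' sv'; exact: ji_mem2 J.
  have [tu|ut] := leqP (t b) u; first by apply: Or33; exists b.
  apply: Or32; exists b; split=> //.
    apply/val_inj/eqP; rewrite eqn_leq su andbT leqNgt; apply/negP => su'.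
    by apply: (ji_gap J uI); rewrite Xlt'.
  apply/val_inj/eqP; rewrite eqn_leq; apply/andP; split; last first.
    by rewrite leqNgt; apply/negP => vt'; apply: (ji_gap J vI); rewrite Xlt'.
  by rewrite leqNgt; apply/negP => tv; apply: (gap (t b)) => //; exact: ji_mem3 J.
have ingap4 b : (b < q)%N -> (s' b < v)%N -> (v <= t' b)%N ->
  [\/ exists b, [/\ (b < q)%N, (s' b <= u)%N & (v <= s b)%N],
      exists b, [/\ (b < q)%N, u = s b & v = t b],
      exists b, [/\ (b < q)%N, (t b <= u)%N & (v <= t' b)%N] |
      exists b, [/\ in_piece b u, in_piece b v & consec X I' u v]].
  by move=> bq sv vt; case: (ingap b bq sv vt); [apply: Or41|apply: Or42|apply: Or43].
have [[b [bq sv vt]]|Pv] := position v; first exact: (ingap4 b bq sv (ltnW vt)).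
have [bq lo hi] := Pv; move: (lab SS' v) Pv bq lo hi => b Pv bq lo hi.
have P4 : (forall k, (k < b)%N -> (t' k <= u)%N) ->
    exists b, [/\ in_piece b u, in_piece b v & consec X I' u v].
  move=> lo'; exists b.
  have Pu : in_piece b u.
    by split=> // k bk kq; apply: leq_trans (ltnW uv) (hi k bk kq).
  split=> //; apply/(consecP x_incr); split; rewrite -?(in_piece_mem Pu) -?(in_piece_mem Pv) //.
  move=> i iI' ui iv; apply: (gap i) => //.
  rewrite (@in_piece_mem b) //; split=> // k.
    by move=> kb; apply: leq_trans (lo' k kb) (ltnW ui).
  by move=> bk kq; apply: leq_trans (ltnW iv) (hi k bk kq).
case: b Pv bq lo hi P4 => [|b] Pv bq lo hi P4; first by apply: Or44; apply: P4.
have := lo b (ltnSn b); rewrite leq_eqVlt => /orP[/eqP/val_inj tv|tv].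
  by apply: (ingap4 b) => //; rewrite -tv // s't'lt.
apply: Or44; apply: P4 => k; rewrite ltnS => kb.
apply: (@leq_trans (t' b)).
  move: kb; rewrite leq_eqVlt => /orP[/eqP -> //|kb].
  by apply: leq_trans (t's' kb (ltnW bq)) (ltnW (s't'lt bq)).
by apply: gap' tv; exact: ji_mem4 (inv bq).
Qed.

Let good_dist a c i : consec X I a c -> (a < i)%N -> (i < c)%N ->
  `|f 0 i - seg X (yv h SS) a c i| <= h.
Proof.
move=> ac ai ic; have /(consecP x_incr)[_ _ ltac _] := ac.
have Zadd b e : Z h SS b a = U b a + e -> Z h SS b c = U b c + e ->
    seg X (Z h SS b) a c i = seg X (U b) a c i + e.
  by move=> Za Zc; rewrite /seg Za Zc; ring.
case: (edge_cases ac) => [[b [bq sa cs]]|[b [bq aE cE]]|[b [bq ta ct]]|[b [Pa Pc ac']]].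
- have [edge _ _] := ji_left (inv bq).
  have := edge a c ac; rewrite !Xle' => /(_ sa cs i); rewrite !Xlt' => /(_ ai ic).
  rewrite (dist_Z h SS b) (Zadd b h) ?Z_left //; try nlia.
  by move=> [? ?]; rewrite ler_norml; move: H0 hH h0; lra.
- subst a c; have [_ tl tr] := closed bq.
  have ls : X (s b) < X (t b) by rewrite Xlt'.
  have := tl i; rewrite !Xlt' => /(_ ai ic).
  have := tr i; rewrite /negf !ltrN2 !Xlt' -!/(negf _) => /(_ ic ai).
  rewrite low_opp // /negf (dist_Z h SS b) => lo hi.
  have -> : seg X (Z h SS b) (s b) (t b) i = low X (U b) (s b) (t b) h i + h.
    rewrite /seg /low Z_left ?le_s's // Z_right ?le_tt' //.
    by rewrite opprD; ring.
  by rewrite ler_norml; move: H0 hH h0; lra.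
- have [edge _ _] := ji_right (inv bq).
  have /consec_opp ca := ac.
  have := edge c a ca; rewrite /negf !lerN2 !Xle' => /(_ ct ta i); rewrite !ltrN2 !Xlt' => /(_ ic ai).
  rewrite -!/(negf _) seg_opp (segC _ _ (_ : X a < X c)) ?Xlt' //.
  rewrite (dist_Z h SS b) (Zadd b (- h)) ?Z_right //; try nlia.
  by rewrite /negf => -[? ?]; rewrite ler_norml; move: H0 hH h0; lra.
- have la := in_piece_lab Pa; have lc := in_piece_lab Pc.
  have := g_edge G' H0 ac'; rewrite la lc => /(_ erefl i ai ic) lo.
  have := edges ac'; rewrite la lc => /(_ erefl i ai ic) hi.
  rewrite (dist_Z h SS b) (Zadd b h) ?Z_piece //.
  by rewrite ler_norml; move: H0 hH h0; lra.
Qed.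

Let old_lab b : (b < q)%N -> lab SS' (s' b) = b /\ lab SS' (t' b) = b.+1.
Proof.
move=> bq; split; apply: in_piece_lab; split=> //; try nlia.
- by move=> k kb; apply: t's' => //; nlia.
- move=> k bk kq; rewrite -/(s' b); move: bk; rewrite leq_eqVlt => /orP[/eqP -> //|bk].
  exact: ltnW (s'_lt bk kq).
- move=> k; rewrite ltnS leq_eqVlt => /orP[/eqP -> //|kb].
  by apply: leq_trans (t's' kb (ltnW bq)) (ltnW (s't'lt bq)).
- by move=> k bk kq; apply: t's'.
Qed.

(* The slope of the old join number [b]; the data between its ends lie within *)
(* [H] of its line, which is what confines the new edges in [old_tube].       *)
Let m b := slope X (Z H SS' b) (s' b) (t' b).

Let mE b : (b < q)%N -> U b (t' b) - 2 * H = U b (s' b) + m b * (X (t' b) - X (s' b)).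
Proof.
move=> bq; have [ls lt] := old_lab bq.
have := slopeE (Z H SS' b) (_ : X (s' b) < X (t' b)).
rewrite Xlt' => /(_ (s't'lt bq)); rewrite -/(m b) (Z_lab H ls) (Z_labS H lt); move: H0 hH h0; lra.
Qed.

Let old_tube b i : (b < q)%N -> (s' b <= i)%N -> (i < t' b)%N ->
  U b (s' b) + m b * (X i - X (s' b)) <= U b i.
Proof.
move=> bq si it; move: si; rewrite leq_eqVlt => /orP[/eqP/val_inj <-|si].
  by rewrite subrr mulr0 addr0.
have := g_dist G' (s't' bq) si it; rewrite (dist_Z H SS' b) seg_slope -/(m b).
have [ls _] := old_lab bq; rewrite (Z_lab H ls) ler_norml => /andP[]; move: H0 hH h0; lra.
Qed.

Let old_tube' b i : (b < q)%N -> (s' b < i)%N -> (i <= t' b)%N ->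
  U b i <= U b (t' b) + m b * (X i - X (t' b)).
Proof.
move=> bq si; rewrite leq_eqVlt => /orP[/eqP/val_inj <-|it].
  by rewrite subrr mulr0 addr0.
have := g_dist G' (s't' bq) si it; rewrite (dist_Z H SS' b) seg_slope -/(m b).
have [ls _] := old_lab bq; rewrite (Z_lab H ls) ler_norml => /andP[].
move: H0 hH h0 (mE bq); lra.
Qed.

(** Chain edges at an end of the gap are held by the strip of the old join. If the edge is the new
    join, the slope conditions carry its strip out to both ends of the gap, and h <= H bounds its
    slope from below by the old one. *)
Let gap_slope b u v : (b < q)%N -> consec X I u v -> (s' b <= u)%N -> (v <= t' b)%N ->
  u = s' b \/ v = t' b -> m b <= slope X (Z h SS b) u v.
Proof.
move=> bq uv s'u vt' end_.
have [uI vI ltuv _] := uv; have luv : (u < v)%N by rewrite -Xlt'.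
have J := inv bq; have E := mE bq; have lst' := s't'lt bq.
have slope_bound W : W v - W u >= m b * (X v - X u) -> m b <= slope X W u v.
  by move=> le; rewrite /slope ler_pdivlMr // subr_gt0.
case: (edge_cases uv) => [[c [cq sa cs]]|[c [cq aE cE]]|[c [cq ta ct]]|[c [Pu Pv _]]].
- have cb : c = b.
    have := t's' (_ : (b < c)%N) (ltnW cq); have := t's' (_ : (c < b)%N) (ltnW bq).
    by have := le_st cq; have := le_tt' cq; nlia.
  subst c; apply: slope_bound; rewrite !Z_left //; try nlia.
  case: end_ => ?; subst.
    have [vt|] := ltnP v (t' b); first by have := old_tube bq (ltnW luv) vt; move: H0 hH h0; lra.
    move=> t'v; have -> : v = t' b by apply/val_inj/eqP; rewrite eqn_leq vt'.
    by move: H0 hH h0 (mE bq); lra.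
  (* The left end has crossed the whole gap, so the two ends coincide and h = 0. *)
  have sE : s b = t' b by apply/val_inj => /=; have := le_st bq; have := le_tt' bq; nlia.
  have h_eq0 : h = 0.
    by apply: (ji_eq J); congr X; apply/val_inj => /=; have := le_st bq; have := le_tt' bq; rewrite sE; nlia.
  move: s'u; rewrite leq_eqVlt => /orP[/eqP/val_inj <-|su].
    by move: H0 (mE bq); rewrite h_eq0; lra.
  by have := old_tube' bq su (ltnW luv); lra.
- have cb : c = b.
    have := t's' (_ : (b < c)%N) (ltnW cq); have := t's' (_ : (c < b)%N) (ltnW bq).
    by have := le_s's cq; have := le_tt' cq; subst; nlia.
  subst c u v.
  have le1 : (0 <= H) by apply: ltW.
  have tl : U b (t' b) - 2 * h <= low X (U b) (s b) (t b) h (t' b).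
    apply: (right_chain_slope (Xinj x_incr) J) => //.
    + exact: ji_mem4 J.
    + exact: ji_le3 J.
  have lst : negf X (t b) < negf X (s b) by rewrite /negf ltrN2.
  have tl' : low X (U b) (s b) (t b) h (s' b) <= U b (s' b).
    have := right_chain_slope (oXinj x_incr) (join_inv_opp J) (ji_mem1 J).
    rewrite /negf !lerN2 -!/(negf _) => /(_ (ji_le1 J) (lexx _) lst).
    by rewrite low_opp // /negf; move: H0 hH h0; lra.
  have slE : slope X (Z h SS b) (s b) (t b) = (U b (t b) - 2 * h - U b (s b)) / (X (t b) - X (s b)).
    by rewrite /slope (Z_left bq (le_s's bq) (leqnn _)) (Z_right bq (leqnn _) (le_tt' bq)); congr (_ / _); ring.
  move: tl tl'; rewrite /low -slE; move: (slope _ _ _ _) => g tl tl'.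
  have pos : 0 < X (t' b) - X (s' b) by rewrite subr_gt0 Xlt'.
  rewrite -(ler_pM2r pos); move: H0 hH h0; lra.
- have cb : c = b.
    have := t's' (_ : (b < c)%N) (ltnW cq); have := t's' (_ : (c < b)%N) (ltnW bq).
    by have := le_s's cq; have := le_st cq; nlia.
  subst c; apply: slope_bound; rewrite !Z_right //; try nlia.
  case: end_ => ?; subst; last first.
    move: s'u; rewrite leq_eqVlt => /orP[/eqP/val_inj <-|su].
      by move: H0 hH h0 (mE bq); lra.
    by have := old_tube' bq su (ltnW luv); move: H0 hH h0; lra.
  have h_eq0 : h = 0.
    by apply: (ji_eq J); congr X; apply/val_inj => /=; have := le_st bq; have := le_s's bq; nlia.
  have [vt|t'v] := ltnP v (t' b); first by have := old_tube bq (ltnW luv) vt; lra.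
  have -> : v = t' b by apply/val_inj/eqP; rewrite eqn_leq vt'.
  by move: H0 (mE bq); rewrite h_eq0; lra.
- have [uE bc] := in_piece_left Pu bq s'u ltac:(nlia).
  have [_ bc'] := in_piece_right Pv bq ltac:(nlia) vt'.
  by nlia.
Qed.

(** At a vertex of an old piece each new edge either is an old one or replaces an old join; by
    [gap_slope] the replacement only sharpens the old convex kink. *)
Let convex_piece b a p c : in_piece b p -> (p \in SS -> 0 < h) -> consec X I a p ->
  consec X I p c -> slope X (Z h SS b) a p <= slope X (Z h SS b) p c.
Proof.
move=> Pp pS ap pc.
have /(consecP x_incr)[aI pI ltap _] := ap; have /(consecP x_incr)[_ cI ltpc _] := pc.
have lp := in_piece_lab Pp.
have piece_eq u v : in_piece b u -> in_piece b v ->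
    slope X (Z h SS b) u v = slope X (Z H SS' b) u v.
  move=> Pu Pv; rewrite /slope !Z_piece // (Z_lab H (in_piece_lab Pu)) (Z_lab H (in_piece_lab Pv)).
  by congr (_ / _); ring.
have [c' [pc' le2]] : exists c', consec X I' p c' /\
    slope X (Z H SS' b) p c' <= slope X (Z h SS b) p c.
  have gapR k : (k < q)%N -> (s' k <= p)%N -> (c <= t' k)%N -> exists c', consec X I' p c' /\
    slope X (Z H SS' b) p c' <= slope X (Z h SS b) p c.
    move=> kq sp ct; have [pE bk] := in_piece_left Pp kq sp (leq_trans ltpc ct).
    subst k; exists (t' b); split; first by rewrite pE; exact: s't'.
    by have := gap_slope kq pc sp ct (or_introl pE); rewrite /m -pE.
  case: (edge_cases pc) => [[k [kq sa cs]]|[k [kq aE cE]]|[k [kq ta ct]]|[k [Pu Pv pc']]].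
  - by apply: (gapR k) => //; have := le_st kq; have := le_tt' kq; nlia.
  - by apply: (gapR k) => //; subst; [exact: le_s's|exact: le_tt'].
  - by apply: (gapR k) => //; have := le_st kq; have := le_s's kq; nlia.
  - have kb : k = b by rewrite -(in_piece_lab Pu).
    by subst k; exists c; rewrite piece_eq.
have [a' [ap' le1]] : exists a', consec X I' a' p /\
    slope X (Z h SS b) a p <= slope X (Z H SS' b) a' p.
  have gapL k : (k < q)%N -> (s' k <= a)%N -> (p <= t' k)%N -> exists a', consec X I' a' p /\
    slope X (Z h SS b) a p <= slope X (Z H SS' b) a' p.
    move=> kq sp ct; have [pE bk] := in_piece_right Pp kq (leq_ltn_trans sp ltap) ct.
    exists (s' k); split; first by rewrite pE; exact: s't'.
    rewrite bk !ZS !slopeN lerN2.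
    by have := gap_slope kq ap sp ct (or_intror pE); rewrite /m -pE.
  case: (edge_cases ap) => [[k [kq sa cs]]|[k [kq aE cE]]|[k [kq ta ct]]|[k [Pu Pv pc0]]].
  - by apply: (gapL k) => //; have := le_st kq; have := le_tt' kq; nlia.
  - by apply: (gapL k) => //; subst; [exact: le_s's|exact: le_tt'].
  - by apply: (gapL k) => //; have := le_st kq; have := le_s's kq; nlia.
  - have kb : k = b by rewrite -(in_piece_lab Pv).
    by subst k; exists a; rewrite piece_eq.
apply: le_trans le1 (le_trans _ le2).
by have := g_convex G' ap' pc' (fun=> H0); rewrite lp.
Qed.

(** Inside a gap, convexity at chain vertices is part of [join_inv], and convexity at [s b] and
    [t b] amounts to the slope conditions. *)
Let good_convex a p c : consec X I a p -> consec X I p c -> (p \in SS -> 0 < h) ->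
  slope X (Z h SS (lab SS p)) a p <= slope X (Z h SS (lab SS p)) p c.
Proof.
move=> ap pc pS.
have [aI pI ap_ gapap] := ap; have [_ cI pc_ gappc] := pc.
have ltap : (a < p)%N by rewrite -Xlt'. have ltpc : (p < c)%N by rewrite -Xlt'.
case: (position p) => [[b [bq sp pt]]|Pp]; last first.
  by rewrite (lab_piece pS Pp); exact: (convex_piece Pp pS ap pc).
have J := inv bq; have [edge vert sl] := ji_left J; have [edge' vert' sl'] := ji_right J.
have Xsp : X (s' b) < X p by rewrite Xlt'. have Xpt : X p < X (t' b) by rewrite Xlt'.
have s'a : (s' b <= a)%N.
  rewrite leqNgt; apply/negP => lt; apply: (gapap (s' b)); rewrite ?Xlt' //.
  exact: ji_mem1 J.
have ct' : (c <= t' b)%N.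
  rewrite leqNgt; apply/negP => lt; apply: (gappc (t' b)); rewrite ?Xlt' //.
  exact: ji_mem4 J.
case: (ltngtP p (s b)) => [ps|sp'|/val_inj pE].
- have cs : (c <= s b)%N.
    rewrite leqNgt; apply/negP => lt; apply: (gappc (s b)); rewrite ?Xlt' //.
    exact: ji_mem2 J.
  rewrite (lab_left bq) ?sp //; [|nlia..].
  rewrite /slope !Z_left //; try nlia.
  have /cvx_slope : cvx X (U b) a p c.
    by apply: vert => //; rewrite ?Xle' //; have := le_st bq; nlia.
  move=> /(_ ap_ pc_); rewrite /slope => /ltW; congr (_ <= _).
    by congr (_ / _); ring.
  by congr (_ / _); ring.
- rewrite (lab_right bq) //; last exact: ltnW.
  rewrite ZS !slopeN lerN2.
  have tp : (t b <= p)%N.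
    by rewrite leqNgt; apply/negP => pt'; apply: (ji_gap J pI); rewrite Xlt'.
  move: tp; rewrite leq_eqVlt => /orP[/eqP/val_inj tE|tp]; last first.
    have ta : (t b <= a)%N.
      rewrite leqNgt; apply/negP => lt; apply: (gapap (t b)); rewrite ?Xlt' //.
      exact: ji_mem3 J.
    have : cvx (negf X) (negf (U b)) c p a.
      apply: vert'; rewrite /negf ?ltrN2 ?lerN2 ?Xlt' ?Xle' //; first exact: ltnW.
      exact: leq_trans (le_st bq) ta.
    move=> /cvx_slope; rewrite /negf !ltrN2 -!/(negf _) => /(_ pc_ ap_).
    have slopeC u v : slope (negf X) (negf (U b)) u v = slope X (U b) v u.
      by rewrite /slope /negf -opprD -[- X v - _]opprD invrN mulrNN -(opprB (U b v)) -(opprB (X v)) invrN mulrNN.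
    rewrite !slopeC /slope => /ltW; rewrite !Z_right //; try nlia.
    by congr (_ <= _); congr (_ / _); ring.
  have aE : a = s b.
    apply/val_inj/eqP; rewrite eqn_leq; apply/andP; split.
      by rewrite leqNgt; apply/negP => sa; apply: (ji_gap J aI); rewrite ?Xlt' // tE.
    rewrite leqNgt; apply/negP => lt; apply: (gapap (s b)); rewrite ?Xlt' //.
    exact: ji_mem2 J.
  subst a p.
  have /consec_opp cp := pc; have := sl' c cp.
  rewrite /negf lerN2 Xle' -!/(negf _) => /(_ ct').
  rewrite seg_opp (segC _ _ pc_) /negf => sl2.
  rewrite -ge_slope //.
  rewrite leNgt; apply/negP => /(cvx_right _ ap_ pc_)/(cvx_left _ ap_ pc_).
  rewrite /seg (Z_left bq (le_s's bq) (leqnn _)) (Z_right bq (leqnn _) (le_tt' bq)).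
  rewrite (@Z_right b c) //; last by rewrite -Xle' ltW.
  by move: sl2; rewrite /seg !opprD !opprK; move: H0 hH h0; lra.
- have hp : 0 < h by apply: pS; rewrite pE mem_nth // sz; nlia.
  have cE : c = t b.
    have pt2 : (p < t b)%N by rewrite pE; exact: lt_st.
    apply/val_inj/eqP; rewrite eqn_leq; apply/andP; split.
      rewrite leqNgt; apply/negP => lt; apply: (gappc (t b)); rewrite ?Xlt' //.
      exact: ji_mem3 J.
    by rewrite leqNgt; apply/negP => lt; apply: (ji_gap J cI); rewrite ?Xlt' // -pE.
  rewrite (lab_left bq) ?sp //; [|exact: ltnW|by rewrite pE].
  subst c p; have := sl a ap; rewrite Xle' => /(_ s'a) sl2.
  rewrite -le_slope // /seg (Z_left bq (le_s's bq) (leqnn _)) (@Z_left b a) //; last exact: ltnW.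
  rewrite (Z_right bq (leqnn _) (le_tt' bq)).
  by move: sl2; rewrite /seg; move: H0 hH h0; lra.
Qed.

(** The label condition keeps i and k from reaching past a join, so one chain and the old piece next
    to it control the triple. A triple that crosses an end of the gap is split there by
    transitivity. *)
Let good_vertex i p (k : 'I_n.+1) : 0 < h -> p \in I -> (i < p)%N -> (p < k)%N ->
  (forall c, c \in I -> (i < c)%N -> (c < k)%N -> lab SS c = lab SS p) ->
  cvx X (U (lab SS p)) i p k.
Proof.
move=> hp pI ip pk same.
have old_lab_eq c : c \in I' -> c \in I /\ lab SS c = lab SS' c.
  move=> cI'; case: (position c) => [[b [bq sc ct]]|Pc].
    by case/(consecP x_incr): (s't' bq) => _ _ _ gap; case: (gap c).
  by rewrite (in_piece_mem Pc); split=> //; apply: lab_piece.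
have Xip : X i < X p by rewrite Xlt'. have Xpk : X p < X k by rewrite Xlt'.
case: (position p) => [[b [bq sp pt]]|Pp]; last first.
  have pI' : p \in I' by rewrite -(in_piece_mem Pp).
  rewrite (old_lab_eq p pI').2; apply: (g_vertex G') => // c cI' ic ck.
  have [cI <-] := old_lab_eq c cI'.
  by rewrite same // (old_lab_eq p pI').2.
have J := inv bq; have [edge vert sl] := ji_left J; have [edge' vert' sl'] := ji_right J.
have [ls' lt'] := old_lab bq.
have s'I2 := s'I (ltnW bq).
have t'I2 : t' b \in I' by case/(consecP x_incr): (s't' bq).
have tst := lt_st hp bq.
have no_gap c : c \in I' -> (s' b < c)%N -> (c < t' b)%N -> False.
  by case/(consecP x_incr): (s't' bq) => _ _ _; apply.
have [ps|sp'] := leqP p (s b).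
  have lp : lab SS p = b by rewrite (lab_left bq) ?sp //; nlia.
  rewrite lp; have kt : (k <= t b)%N.
    rewrite leqNgt; apply/negP => tk.
    have := same (t b) (ji_mem3 J) ltac:(nlia) tk.
    by rewrite lp (lab_right bq) //; [nlia|exact: le_tt'].
  have [si|is'] := leqP (s' b) i; first by apply: vert; rewrite ?Xle' ?Xlt'.
  have c1 : cvx X (U b) i (s' b) p.
    rewrite -[in U b]ls'; apply: (g_vertex G') => // c cI' ic cp.
    have [cI <-] := old_lab_eq c cI'; rewrite ls' same //; nlia.
  have c2 : cvx X (U b) (s' b) p k by apply: vert; rewrite ?Xle' ?Xlt'.
  by apply: cvx_transl c1 c2; rewrite ?Xlt'.
have tp : (t b <= p)%N.
  by rewrite leqNgt; apply/negP => pt'; apply: (ji_gap J pI); rewrite Xlt'.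
have lp : lab SS p = b.+1 by rewrite (lab_right bq) // ltnW.
rewrite lp; have si : (s b <= i)%N.
  rewrite leqNgt; apply/negP => tk.
  have := same (s b) (ji_mem2 J) tk ltac:(nlia).
  by rewrite lp (lab_left bq) ?hp ?orbT ?le_s's //; nlia.
have mirror (c : 'I_n.+1) : (p < c)%N -> (c <= t' b)%N -> cvx X (U b.+1) i p c.
  move=> pc ct.
  have : cvx (negf X) (negf (U b)) c p i.
    by apply: vert'; rewrite /negf ?ltrN2 ?lerN2 ?Xlt' ?Xle'.
  by rewrite US /cvx /negf; nra.
have [kt|tk] := leqP k (t' b); first exact: mirror.
have c1 : cvx X (U b.+1) p (t' b) k.
  rewrite -[in U _]lt'; apply: (g_vertex G') => // c cI' ic cp.
  have [cI <-] := old_lab_eq c cI'; rewrite lt' same //; nlia.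
by apply: cvx_transr (mirror (t' b) pt (leqnn _)) c1; rewrite ?Xlt'.
Qed.

Let good_edge a c i : 0 < h -> consec X I a c -> lab SS a = lab SS c ->
  (a < i)%N -> (i < c)%N -> seg X (U (lab SS a)) a c i <= U (lab SS a) i.
Proof.
move=> hp ac lac ai ic.
case: (edge_cases ac) => [[b [bq sa cs]]|[b [bq aE cE]]|[b [bq ta ct]]|[b [Pa Pc ac']]].
- have [edge _ _] := ji_left (inv bq).
  have := edge a c ac; rewrite !Xle' => /(_ sa cs i); rewrite !Xlt' => /(_ ai ic) [].
  by rewrite (lab_left bq) ?hp ?orbT //; nlia.
- move: lac; subst; rewrite (lab_left bq) ?hp ?orbT ?le_s's // (lab_right bq) ?le_tt' ?lt_st //.
  by nlia.
- have [edge _ _] := ji_right (inv bq).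
  have /consec_opp ca := ac.
  have := edge c a ca; rewrite /negf !lerN2 !Xle' => /(_ ct ta i); rewrite !ltrN2 !Xlt' => /(_ ic ai).
  rewrite -!/(negf _) (lab_right bq) -?/(s b) ?(leq_trans (lt_st hp bq)) //; [|nlia].
  by rewrite US seg_opp (segC _ _ (_ : X a < X c)) ?Xlt' ?(seg_oppW x) //; [case|nlia].
- have la := in_piece_lab Pa; have lc := in_piece_lab Pc.
  have := g_edge G' H0 ac'; rewrite la lc => /(_ erefl i ai ic).
  by rewrite (lab_piece (fun=> hp) Pa).
Qed.

Lemma assemble : good h I SS.
Proof.
have sub : {subset SS <= I}.
  move=> z /(nthP ord0)[b]; rewrite sz ltnS leq_eqVlt => bq <-.
  case/orP: bq => [/eqP ->|bq]; last exact: ji_mem2 (inv bq).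
  rewrite -/(s q) sq -s'q (@in_piece_mem q) ?s'I //.
  split=> // k kq; [exact: t's'|move=> kq'].
  by have -> : k = q by nlia.
split=> //.
- split=> //; first by case: (SS) sz.
  by rewrite (last_nth ord0) sz /= -/(s q).
- have [[b [bq]]|P0] := position ord0; first by [].
  by rewrite (in_piece_mem P0) (g_ord0 G').
- by move=> a c ac i ai ic; apply: good_dist.
- move=> hp; apply/(sortedP ord0) => i; rewrite sz => iq; rewrite -!/(s _).
  have bq : (i < q)%N by nlia.
  apply: leq_trans (lt_st hp bq) _; apply: leq_trans (le_tt' bq) _.
  by apply: leq_trans (t's' (ltnSn i) bq) _; apply: le_s's'.
- by move=> hp i p k; apply: good_vertex.
- by move=> hp a c ac lac i ai ic; apply: good_edge.
Qed.

(** A raise during the closing of join b happened on one of its two chains, whose edges now lie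
    inside the pieces b and b+1. *)
Lemma assemble_attained b : 0 < h -> (b < q)%N ->
  attains X (U b) (s' b) (s b) I h \/ attains (negf X) (negf (U b)) (t' b) (t b) I h ->
  attained h I SS.
Proof.
move=> hp bq [[a [c [j [ac sa cs /andP[aj jc] Uj]]]]|[c [a [j [/consec_opp ac tc ca /andP[cj ja] Uj]]]]].
- have [_ _ ltac _] := ac; rewrite !Xlt' !Xle' in sa cs aj jc ltac.
  have la : lab SS a = b by rewrite (lab_left bq) ?hp ?orbT //; nlia.
  have lc : lab SS c = b by rewrite (lab_left bq) ?hp ?orbT //; nlia.
  by exists a, c, j; split; rewrite ?la ?lc.
- have [_ _ ltac _] := ac.
  move: tc ca cj ja; rewrite /negf !lerN2 !ltrN2 => tc ca cj ja.
  have E : U b.+1 j = seg X (U b.+1) a c j + 2 * h.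
    by move: Uj; rewrite seg_opp (segC _ _ ltac) US (seg_oppW x).
  rewrite !Xlt' !Xle' in tc ca cj ja ltac.
  have sa : (s b < a)%N := leq_trans (lt_st hp bq) ca.
  have la : lab SS a = b.+1 by apply: (lab_right bq) => //; nlia.
  have lc : lab SS c = b.+1 by apply: (lab_right bq) => //; nlia.
  by exists a, c, j; split; rewrite ?la ?lc.
Qed.

(** Without a raise the witness is on an edge inside an old piece, and closing the joins leaves such
    edges alone. *)
Lemma assemble_attained0 : 0 < h -> attained h I' SS' -> attained h I SS.
Proof.
move=> hp [a [c [j [ac lac aj jc Uj]]]].
have inP z : z \in I' -> in_piece (lab SS' z) z.
  move=> zI; case: (position z) => // -[b [bq sz_ zt]].
  by case/(consecP x_incr): (s't' bq) => _ _ _ gap; case: (gap z).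
have /(consecP x_incr)[aI cI ltac gap] := ac.
have Pa := inP a aI; have Pc := inP c cI.
have la := lab_piece (fun=> hp) Pa; have lc := lab_piece (fun=> hp) Pc.
exists a, c, j; rewrite la lc; split=> //; apply/(consecP x_incr).
rewrite (in_piece_mem Pa) (in_piece_mem Pc); split=> // i iI ai ic.
have Pi : in_piece (lab SS' a) i.
  have [bq lo _] := Pa; have [_ _ hi] := Pc; rewrite -lac in hi.
  split=> // k kb; first exact: leq_trans (lo k kb) (ltnW ai).
  by move=> kq; apply: leq_trans (ltnW ic) (hi k kb kq).
by apply: (gap i) => //; rewrite -(in_piece_mem Pi).
Qed.

End Assemble.
End Good.

(** * Counting sign changes *)

Section SignChanges.
Variable R : realType.
Implicit Types (c : nat -> R) (a : R) (l g : nat -> nat).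

Lemma sign_pos (e : nat) (a : R) : a != 0 -> 0 < (-1) ^+ e * a \/ 0 < (-1) ^+ e.+1 * a.
Proof.
move=> a0; rewrite exprS mulN1r mulNr oppr_gt0.
have : (-1) ^+ e * a != 0 by rewrite mulf_neq0 // signr_eq0.
by rewrite neq_lt => /orP[]; [right|left].
Qed.

Lemma sign_mul (e e' : nat) (a b : R) : 0 < (-1) ^+ e * a -> 0 < (-1) ^+ e' * b ->
  (a * b < 0) = (odd e != odd e').
Proof.
rewrite -signr_odd -[in X in _ -> X -> _]signr_odd.
by case: (odd e); case: (odd e'); rewrite ?expr1 ?expr0 ?mulN1r ?mul1r ?oppr_gt0 => a0 b0 /=;
  [apply/negbTE; rewrite -leNgt|idtac|idtac|apply/negbTE; rewrite -leNgt]; nra.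
Qed.

Lemma changes_le c l (m k p q : nat) a : 0 < (-1) ^+ p * a -> (p <= q)%N ->
  (forall i, (k <= i < k + m)%N -> [/\ (p <= l i)%N, (l i <= q)%N & 0 <= (-1) ^+ l i * c i]) ->
  (forall i j, (k <= i)%N -> (i <= j)%N -> (j < k + m)%N -> (l i <= l j)%N) ->
  (qe_rcf_th.changes (a :: [seq z : R <- [seq c i | i <- iota k m] | z != 0%R]) <= q - p)%N.
Proof.
elim: m k p a => [|m IH] k p a pa pq cl mono /=; first by rewrite mulr0 ltxx.
have cl' i : (k.+1 <= i < k.+1 + m)%N -> [/\ (p <= l i)%N, (l i <= q)%N & 0 <= (-1) ^+ l i * c i].
  by move=> ki; apply: cl; lia.
have mono' i j : (k.+1 <= i)%N -> (i <= j)%N -> (j < k.+1 + m)%N -> (l i <= l j)%N.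
  by move=> *; apply: mono; lia.
case: eqP => [ck0|/eqP ck0] /=; first exact: IH.
have [pl lq sk] := cl k ltac:(lia).
have {}sk : 0 < (-1) ^+ l k * c k by rewrite lt_neqAle sk andbT eq_sym mulf_neq0 // signr_eq0.
have := IH k.+1 (l k) (c k) sk lq; move=> /(_ _ mono') H.
rewrite (sign_mul pa sk).
have {}H := H _; case: eqP => [E|E] /=.
  rewrite add0n; apply: leq_trans (H _) _; last lia.
  by move=> i ki; have [_ ? ?] := cl' i ki; split=> //; apply: mono; lia.
rewrite add1n.
have lt : (p < l k)%N by rewrite ltn_neqAle pl andbT; apply/eqP => E'; apply: E; rewrite E'.
apply: leq_ltn_trans (H _) _; last lia.
by move=> i ki; have [_ ? ?] := cl' i ki; split=> //; apply: mono; lia.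
Qed.

(** Greedy scan: an entry with the sign of its predecessor is passed over, and the first one of
    opposite sign pays for the first remaining requirement, even if it stands before position
    [g 0]. *)
Lemma changes_ge c g (m k e M : nat) a : 0 < (-1) ^+ e * a ->
  (forall j, (j < M)%N -> [/\ (k <= g j)%N, (g j < k + m)%N & 0 < (-1) ^+ (e + j).+1 * c (g j)]) ->
  (forall i j, (i < j)%N -> (j < M)%N -> (g i < g j)%N) ->
  (M <= qe_rcf_th.changes (a :: [seq z : R <- [seq c i | i <- iota k m] | z != 0%R]))%N.
Proof.
elim: m k e M a g => [|m IH] k e M a g ea cg mono.
  by case: M cg mono => // M /(_ 0%N isT) []; lia.
case: M cg mono => // M cg mono.
have later : g 0%N != k -> forall j, (j < M.+1)%N -> (k.+1 <= g j)%N.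
  move=> g0k j jM; have [g0 _ _] := cg 0%N isT.
  case: j jM => [|j] jM; first by rewrite ltn_neqAle eq_sym g0k.
  by have := mono 0%N j.+1 isT jM; lia.
rewrite /= -/(qe_rcf_th.changes _).
case: eqP => [ck0|/eqP ck0] /=.
  have g0k : g 0%N != k.
    by apply/eqP => g0; have [_ _] := cg 0%N isT; rewrite g0 ck0 mulr0 ltxx.
  apply: (IH k.+1 e M.+1 a g) => // j jM; have [_ ? ?] := cg j jM.
  by split=> //; [apply: later|lia].
have [ck|ck] := sign_pos e ck0.
  have g0k : g 0%N != k.
    apply/eqP => g0; have [_ _] := cg 0%N isT.
    by rewrite g0 addn0 exprS mulN1r mulNr oppr_gt0 ltNge (ltW ck).
  rewrite (sign_mul ea ck) eqxx add0n.
  apply: (IH k.+1 e M.+1 _ g) => // j jM; have [_ ? ?] := cg j jM.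
  by split=> //; [apply: later|lia].
rewrite (sign_mul ea ck) /=; have -> : odd e != ~~ odd e by case: odd.
rewrite add1n ltnS; apply: (IH k.+1 e.+1 M _ (fun j => g j.+1)) => //.
- move=> j jM; have [_ ? ?] := cg j.+1 jM; split; [|lia|by rewrite addSnnS].
  by have [? _ _] := cg 0%N isT; have := mono 0%N j.+1 isT jM; lia.
- by move=> i j ij jM; apply: mono.
Qed.

(** The slope from u to w is a weighted mean of the slopes of the unit steps. *)
Lemma slope_average (X V : nat -> R) (u w : nat) (g : R) : (u < w)%N ->
  (forall i, (u <= i < w)%N -> X i < X i.+1) ->
  g * (X w - X u) <= V w - V u ->
  exists2 i, (u <= i < w)%N & g <= (V i.+1 - V i) / (X i.+1 - X i).
Proof.
move=> uw incr; elim: w uw incr => // w IH uw incr le.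
have lw : X w < X w.+1 by apply: incr; lia.
have [ok|bad] := lerP g ((V w.+1 - V w) / (X w.+1 - X w)).
  by exists w => //; lia.
rewrite ltr_pdivrMr ?subr_gt0 // in bad.
have [uw'|wu] := ltnP u w; last first.
  by have uE : u = w by [lia]; subst u; lra.
have [||i ui gi] := IH uw'; [by move=> i ui; apply: incr; lia|lra|].
by exists i => //; lia.
Qed.

Lemma step_up (D : nat -> R) (i j : nat) : (i <= j)%N -> D i < D j ->
  exists2 l, (i <= l < j)%N & D l < D l.+1.
Proof.
elim: j => [|j IH] ij lt.
  by move: lt; have -> : i = 0%N by [lia]; rewrite ltxx.
have [ij'|ji] := leqP i j; last by move: lt; have -> : i = j.+1 by [lia]; rewrite ltxx.
have [lt'|ge] := ltP (D j) (D j.+1); first by exists j => //; lia.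
have [|l il Dl] := IH ij'; first exact: lt_le_trans ge.
by exists l => //; lia.
Qed.

End SignChanges.

(** * The vector y(S) of a good state *)

Section GoodFacts.
Variables (R : realType) (n : nat) (x f : 'rV[R]_n.+1).
Hypothesis x_incr : forall i j : 'I_n.+1, (i < j)%N -> x 0 i < x 0 j.
Implicit Types (I J : {set 'I_n.+1}) (i j p u v : 'I_n.+1) (b k : nat).
Implicit Types (h H : R) (SS : seq 'I_n.+1).

Notation X := (X x).
Notation U := (U f).
Let Xlt' := Xlt x_incr.
Let Xle' := Xle x_incr.

Lemma F_le (w : 'rV[R]_n.+1) h : 0 <= h -> (forall i, `|w 0 i - f 0 i| <= h) -> F f w <= h.
Proof.
move=> h0 le; rewrite /F [`|_|]mx_normrE; apply: bigmax_le => // -[i j] _ /=.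
by rewrite !mxE ord1.
Qed.

Lemma F_ge (w : 'rV[R]_n.+1) i : `|w 0 i - f 0 i| <= F f w.
Proof.
rewrite /F [leRHS]mx_normrE.
have := le_bigmax 0 (fun ij : 'I_1 * 'I_n.+1 => `|(w - f) ij.1 ij.2|) (0, i).
by rewrite /= !mxE.
Qed.

Lemma pieces_nth I SS b : (b < size SS)%N -> nth (ord0, ord0) (pieces I SS) b =
  (if b is b'.+1 then odflt (nth ord0 SS b') (succ_in I (nth ord0 SS b')) else ord0, nth ord0 SS b).
Proof.
move=> bS; rewrite /pieces nth_zip_cond size_zip /= size_map.
rewrite (_ : minn _ _ = size SS); last lia.
rewrite bS; congr (_, _); case: b bS => //= b bS.
by rewrite (nth_map ord0) //; lia.
Qed.

Section Vector.
Variables (h : R) (I : {set 'I_n.+1}) (SS : seq 'I_n.+1) (Q : nat).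
Hypothesis G : good x f h I SS.
Hypothesis sz : size SS = Q.+1.

Notation s b := (nth ord0 SS b).

Lemma good_sorted : sorted (fun i j : 'I_n.+1 => (i <= j)%N) SS.
Proof. by case: (g_pieces G). Qed.

Lemma good_last : s Q = ord_max.
Proof. by case: (g_pieces G) => _ _ _; rewrite (last_nth ord0) sz. Qed.

Lemma good_lab_le i : (lab SS i <= Q)%N.
Proof.
by case: (g_pieces G) => so _ S0 lS; have := lab_lt_size i S0 lS so; rewrite sz.
Qed.

Lemma good_mem b : (b <= Q)%N -> s b \in I.
Proof. by move=> bQ; case: (g_pieces G) => _ sub _ _; apply: sub; rewrite mem_nth // sz. Qed.

Lemma good_lt b c : 0 < h -> (b < c)%N -> (c <= Q)%N -> (s b < s c)%N.
Proof.
move=> h0 bc cQ; have so := g_strict G h0.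
have tr : transitive (fun i j : 'I_n.+1 => (i < j)%N) by move=> ? ? ?; apply: ltn_trans.
by apply: (sorted_ltn_nth tr ord0 so) => //; rewrite inE sz; lia.
Qed.

Lemma good_join b : 0 < h -> (b < Q)%N ->
  exists t, [/\ consec X I (s b) t, lab SS (s b) = b, lab SS t = b.+1 & (t <= s b.+1)%N].
Proof.
move=> h0 bQ.
have lt := good_lt h0 (ltnSn b) bQ.
have ltX : X (s b) < X (s b.+1) by rewrite Xlt'.
have [t [st ts]] := next_exists (good_mem (ltnW bQ)) (good_mem bQ) ltX.
exists t; have /(consecP x_incr)[_ tI ltst gap] := st.
rewrite Xle' in ts; split=> //; apply: lab_eq; rewrite ?sz //; try exact: good_sorted.
- lia.
- by move=> k kb; apply: good_lt => //; lia.
- move=> k; rewrite ltnS leq_eqVlt => /orP[/eqP -> //|kb].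
  by apply: leq_trans (good_lt h0 kb _) (ltnW ltst); lia.
Qed.

Lemma good_bracket i : i \notin I ->
  exists u v, [/\ consec X I u v, (u < i)%N & (i < v)%N].
Proof.
move=> iI.
have l : X ord0 < X i.
  by rewrite Xlt' lt0n; apply: contraNneq iI => i0; rewrite (_ : i = ord0) ?(g_ord0 G) //; apply/val_inj.
have r : X i < X ord_max.
  rewrite Xlt' ltn_neqAle -ltnS ltn_ord andbT; apply: contraNneq iI => i0.
  by rewrite (_ : i = ord_max) ?(good_max G) //; apply/val_inj.
have [u [v [uv _ _ /andP[ui iv]]]] := bracket (Xinj x_incr) (g_ord0 G) (good_max G) l r iI.
by exists u, v; rewrite -!Xlt'.
Qed.

Lemma interp_in (w : 'rV[R]_n.+1) i : i \in I -> interp x w I i = w 0 i.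
Proof. by rewrite /interp => ->. Qed.

Lemma interp_seg (w : 'rV[R]_n.+1) u v i : consec X I u v -> (u < i)%N -> (i < v)%N ->
  interp x w I i = seg X (vec w) u v i.
Proof.
move=> /(consecP x_incr)[uI vI uv gap] ui iv.
have iI : i \notin I by apply/negP => /gap /(_ ui iv).
rewrite /interp (negbTE iI).
have -> : pred_in I i = Some u.
  apply: omax_some; first by rewrite inE uI.
  move=> k; rewrite inE => /andP[kI ki]; rewrite leqNgt; apply/negP => uk.
  by apply: (gap k) => //; lia.
have -> // : succ_in I i = Some v.
rewrite /succ_in (@omax_some _ I ord_max) /=; last 2 first.
- exact: good_max G.
- by move=> k _; rewrite -ltnS ltn_ord.
have -> : (n <= i)%N = false by have := ltn_ord v; lia.
apply: omin_some; first by rewrite inE vI.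
move=> k; rewrite inE => /andP[kI ki]; rewrite leqNgt; apply/negP => uk.
by apply: (gap k) => //; lia.
Qed.

Definition yfull : 'rV[R]_n.+1 := \row_i interp x (\row_j yv f h SS j) I i.

Lemma yfull_in i : i \in I -> yfull 0 i = yv f h SS i.
Proof. by move=> iI; rewrite mxE interp_in // mxE. Qed.

Lemma yfull_seg u v i : consec X I u v -> (u <= i)%N -> (i <= v)%N ->
  yfull 0 i = seg X (yv f h SS) u v i.
Proof.
move=> uv; have [uI vI ltuv _] := uv.
rewrite leq_eqVlt => /orP[/eqP/val_inj <- _|ui]; first by rewrite yfull_in // segl.
rewrite leq_eqVlt => /orP[/eqP/val_inj ->|iv]; first by rewrite yfull_in // segr.
by rewrite mxE (interp_seg _ uv) // /seg /vec !mxE.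
Qed.

Lemma yfull_dist : F f yfull = h.
Proof.
apply/le_anti/andP; split.
- apply: F_le => [|i]; first exact: g_ge0 G.
  have [iI|iI] := boolP (i \in I).
    rewrite yfull_in // /yv addrC addKr normrM normrX normrN1 expr1n mul1r.
    by rewrite ger0_norm // (g_ge0 G).
  have [u [v [uv ui iv]]] := good_bracket iI.
  rewrite (yfull_seg uv (ltnW ui) (ltnW iv)) distrC.
  exact: g_dist G _ _ uv _ ui iv.
- apply: le_trans (F_ge yfull ord0).
  rewrite yfull_in ?(g_ord0 G) // /yv addrC addKr normrM normrX normrN1 expr1n mul1r.
  exact: ler_norm.
Qed.

(** For h > 0 the elements of S are distinct, and the ranges of [pieces] cut I exactly into its
    label classes. *)
Lemma piece_bounds b i : 0 < h -> i \in I -> (b <= Q)%N ->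
  ((nth (ord0, ord0) (pieces I SS) b).1 <= i <= (nth (ord0, ord0) (pieces I SS) b).2)%N
   = (lab SS i == b).
Proof.
move=> h0 iI bQ; rewrite pieces_nth ?sz //=.
have so := good_sorted.
have hiE : (i <= s b)%N = (lab SS i <= b)%N by rewrite leqNgt lab_nth // ?sz // -leqNgt.
rewrite hiE eqn_leq andbC; congr (_ && _); case: b bQ {hiE} => [|b] bQ //.
have [t [st ls lt _]] := good_join h0 bQ.
rewrite (consec_succ x_incr st) /= -lab_nth ?sz //; last exact: ltnW.
have /(consecP x_incr)[_ _ lst gap] := st.
apply/idP/idP; first exact: leq_trans.
by move=> si; rewrite leqNgt; apply/negP => it; apply: (gap i).
Qed.

Lemma ypieces_lab b i : i \in I -> (b < size SS)%N ->
  (let P := nth (ord0, ord0) (ypieces h I SS) b in (P.1 <= i <= P.2)%N) ->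
  yv f h SS i = f 0 i + (-1) ^+ b * h.
Proof.
move=> iI bS; rewrite /ypieces; case: ifP => [h0|].
  by move=> /=; rewrite piece_bounds // => [/eqP lb|]; [rewrite /yv lb|rewrite -ltnS -sz].
have := g_ge0 G; rewrite le_eqVlt => /orP[/eqP <- _ _|-> //].
by rewrite /yv !mulr0.
Qed.

Lemma ypieces_cover i : i \in I ->
  let P := nth (ord0, ord0) (ypieces h I SS) (lab SS i) in (P.1 <= i <= P.2)%N.
Proof.
move=> iI; have lQ := good_lab_le i; have so := good_sorted.
rewrite /ypieces; case: ifP => [h0|_] /=; first by rewrite piece_bounds.
rewrite nth_zip_cond size_zip /= (_ : minn _ _ = size SS); last lia.
rewrite sz ltnS lQ /=; apply/andP; split; last first.
  by rewrite leqNgt lab_nth // ?sz // ltnn.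
case E : (lab SS i) => [|b] //=.
by apply: ltnW; rewrite lab_nth // ?sz ?E //; lia.
Qed.

Lemma yfull_unique : unique (is_y x f h I SS) yfull.
Proof.
have rec w : is_y x f h I SS w -> forall i, i \in I -> w 0 i = yv f h SS i.
  move=> [val _] i iI; have lQ : (lab SS i < size SS)%N by rewrite sz ltnS good_lab_le.
  have /= cov := ypieces_cover iI.
  have := val (Ordinal lQ) i iI cov; rewrite /= => ->.
  by rewrite (ypieces_lab iI lQ cov).
split.
- split=> [b i P iI iP|j].
    by rewrite yfull_in // (ypieces_lab iI (ltn_ord b)).
  have [jI|jI] := boolP (j \in I); first by rewrite interp_in.
  have [u [v [uv uj jv]]] := good_bracket jI.
  have [uI vI _ _] := uv.
  rewrite (interp_seg _ uv uj jv) (yfull_seg uv (ltnW uj) (ltnW jv)).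
  by rewrite /seg /vec !yfull_in.
- move=> w wy; apply/rowP => j; have wI := rec w wy; have [_ wint] := wy.
  have [jI|jI] := boolP (j \in I); first by rewrite yfull_in // wI.
  have [u [v [uv uj jv]]] := good_bracket jI.
  have [uI vI _ _] := uv.
  rewrite (yfull_seg uv (ltnW uj) (ltnW jv)) wint (interp_seg _ uv uj jv).
  by rewrite /seg /vec !wI.
Qed.

Lemma cdiff_slope (w : 'rV[R]_n.+1) (a p c : 'I_n.+1) :
  cdiff x w a p c = (X c - X a)^-1 * (slope X (vec w) p c - slope X (vec w) a p).
Proof. by []. Qed.

Lemma slope_seg (W : 'I_n.+1 -> R) (V : 'I_n.+1 -> R) u v i j : X i < X j ->
  V i = seg X W u v i -> V j = seg X W u v j -> slope X V i j = slope X W u v.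
Proof.
move=> ij Vi Vj; rewrite {1}/slope Vi Vj !seg_slope.
have : X j - X i != 0 by rewrite subr_eq0 gt_eqF.
by move=> ?; field.
Qed.

(** Off I the vector is affine around p and the difference vanishes; on I the unit slopes are those
    of the two edges at p, and [g_convex] applies. *)
Lemma yfull_sign (a p c : 'I_n.+1) : p = a.+1 :> nat -> c = p.+1 :> nat ->
  (p \in SS -> 0 < h) -> 0 <= (-1) ^+ lab SS p * cdiff x yfull a p c.
Proof.
move=> pa cp pS; rewrite cdiff_slope mulrCA.
have ltap : X a < X p by rewrite Xlt'; lia.
have ltpc : X p < X c by rewrite Xlt'; lia.
rewrite pmulr_rge0 ?invr_gt0 ?subr_gt0 ?(lt_trans ltap) //.
have [pI|pI] := boolP (p \in I); last first.
  have [u [v [uv up pv]]] := good_bracket pI.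
  have E i : (u <= i)%N -> (i <= v)%N -> vec yfull i = seg X (yv f h SS) u v i.
    exact: yfull_seg uv.
  by rewrite !(@slope_seg (yv f h SS) (vec yfull) u v) ?subrr ?mulr0 // E //; lia.
have [c' [pc' _]] : exists c', consec X I p c' /\ X c' <= X ord_max.
  apply: next_exists; rewrite ?(good_max G) // Xlt'.
  by have := ltn_ord c; rewrite /=; lia.
have [a' ap'] : exists a', consec X I a' p.
  have lt0 : X ord0 < X p by rewrite Xlt' pa.
  have := @next_exists _ _ (negf X) I p ord0 pI (g_ord0 G).
  by rewrite /negf ltrN2 => /(_ lt0)[a' [/consec_opp ap' _]]; exists a'.
have /(consecP x_incr)[_ _ lta' _] := ap'; have /(consecP x_incr)[_ _ ltc' _] := pc'.
have -> : slope X (vec yfull) p c = slope X (yv f h SS) p c'.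
  by apply: slope_seg; rewrite // /vec (yfull_seg pc') //; lia.
have -> : slope X (vec yfull) a p = slope X (yv f h SS) a' p.
  by apply: slope_seg; rewrite // /vec (yfull_seg ap') //; lia.
by have := g_convex G ap' pc' pS; rewrite /Z !(slope_scale X) mulrBr subr_ge0.
Qed.

Lemma yfull_changes : (sign_changes x yfull <= Q)%N.
Proof.
rewrite /sign_changes /= oner_neq0 /cseq.
pose m (i : nat) : 'I_n.+1 := inord i.+1.
pose c (i : nat) := cdiff x yfull (inord i) (inord i.+1) (inord i.+2).
(* At h = 0 the sign at an element of S is not controlled. If it is wrong, the element takes the
   next label; this stays monotone because the index after it has a larger label anyway ([labS]). *)
pose l (i : nat) := if 0 <= (-1) ^+ lab SS (m i) * c i then lab SS (m i) else (lab SS (m i)).+1.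
rewrite -[Q]subn0.
have labS (i : nat) : (i.+1 < n)%N -> m i \in SS -> (lab SS (m i) < lab SS (m i.+1))%N.
  move=> ilt miS; have so := good_sorted.
  rewrite -lab_nth //; last by rewrite sz ltnS good_lab_le.
  have /(nthP ord0)[k kS kE] := miS.
  apply: (@leq_ltn_trans (m i)).
    rewrite -kE; have tr : transitive (fun i j : 'I_n.+1 => (i <= j)%N) by move=> ? ? ?; apply: leq_trans.
    have refl : reflexive (fun i j : 'I_n.+1 => (i <= j)%N) by move=> ?.
    apply: (sorted_leq_nth tr refl ord0 so); rewrite ?inE //.
      by rewrite sz ltnS good_lab_le.
    by rewrite leqNgt -lab_nth // kE ltnn.
  by rewrite /m !inordK //; lia.
have bad (i : nat) : (i < n.-1)%N -> ~~ (0 <= (-1) ^+ lab SS (m i) * c i) -> m i \in SS.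
  move=> ilt; apply: contraR => mS.
  by apply: yfull_sign; rewrite ?inordK //; first [lia|rewrite -/(m i) (negbTE mS)].
apply: (changes_le (l := l)); rewrite ?expr0 ?mulr1 //.
- move=> i /andP[_]; rewrite add0n => ilt; split=> //.
    rewrite /l; case: ifPn => [_|/(bad i ilt) mS]; first exact: good_lab_le.
    by apply: leq_trans (labS i _ mS) (good_lab_le _); lia.
  rewrite /l; case: ifPn => // /negP; rewrite exprS mulN1r mulNr oppr_ge0.
  by case: lerP => // /ltW.
- move=> i j _ ij; rewrite add0n => jlt.
  have [->//|ij'] := eqVneq i j.
  have lij : (lab SS (m i.+1) <= lab SS (m j))%N.
    by apply: lab_le; rewrite /m !inordK //; lia.
  have lii : (lab SS (m i) <= lab SS (m i.+1))%N.
    by apply: lab_le; rewrite /m !inordK //; lia.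
  apply: (@leq_trans (lab SS (m j))); last by rewrite /l; case: ifP.
  rewrite /l; case: ifPn => [_|/bad mS]; first lia.
  by apply: leq_trans lij; apply: labS; [lia|apply: mS; lia].
Qed.

End Vector.
End GoodFacts.

(** * Lower bound from a good state *)

Section Prices.
Variables (R : realType) (n : nat) (x f : 'rV[R]_n.+1).
Hypothesis x_incr : forall i j : 'I_n.+1, (i < j)%N -> x 0 i < x 0 j.
Implicit Types (I J : {set 'I_n.+1}) (i j p u v : 'I_n.+1) (b k : nat).
Implicit Types (h H : R) (SS : seq 'I_n.+1).

Notation X := (X x).
Notation U := (U f).
Let Xlt' := Xlt x_incr.
Let Xle' := Xle x_incr.

Notation attained := (attained x f).

Section LowerBound.
Variables (h : R) (I : {set 'I_n.+1}) (SS : seq 'I_n.+1) (Q : nat).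
Hypothesis G : good x f h I SS.
Hypothesis sz : size SS = Q.+1.
Hypothesis h0 : 0 < h.

Notation s b := (nth ord0 SS b).

(** Walking back from u to t through piece b+1, convexity makes the slopes decrease. Only u needs
    the label b+1, so the next join is included. *)
Lemma join_slope_le b t u v : (b < Q)%N -> consec X I (s b) t -> lab SS t = b.+1 ->
  consec X I u v -> lab SS u = b.+1 ->
  slope X (Z f h SS b.+1) (s b) t <= slope X (Z f h SS b.+1) u v.
Proof.
move=> bQ st lt; have [k] := ubnP u; elim: k u v => // k IH u v uk uv lu.
have /(consecP x_incr)[sI tI lst gap] := st.
have /(consecP x_incr)[uI vI luv _] := uv.
have su : (s b < u)%N by rewrite lab_nth ?lu ?sz //; [exact: good_sorted G|lia].
have tu : (t <= u)%N by rewrite leqNgt; apply/negP => /(gap u uI su).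
move: tu; rewrite leq_eqVlt => /orP[/eqP/val_inj tE|tu].
  by subst u; have := g_convex G st uv (fun=> h0); rewrite lt.
have Xtu : negf X u < negf X t by rewrite /negf ltrN2 Xlt'.
have [a [/consec_opp au]] := next_exists uI tI Xtu; rewrite /negf lerN2 Xle' => ta.
have /(consecP x_incr)[_ _ lau _] := au.
have la : lab SS a = b.+1.
  have := @lab_le _ SS a u (ltnW lau); have := @lab_le _ SS t a ta.
  by rewrite lu lt; lia.
by apply: le_trans (IH a u _ au la) _; [lia|have := g_convex G au uv (fun=> h0); rewrite lu].
Qed.

(** In orientation b, w is below the polygon on piece b and above it on piece b+1, so its slope over
    join b exceeds that of the join. By [join_slope_le] the slopes of w must then rise, in
    orientation b+1, from join b to join b+1, which needs a second difference of sign (-1)^(b+1). *)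
Lemma good_lower (w : 'rV[R]_n.+1) : F f w < h -> (Q.-1 <= sign_changes x w)%N.
Proof.
move=> Fw.
have wf i : `|w 0 i - f 0 i| < h by apply: le_lt_trans Fw; exact: F_ge.
pose V b : 'I_n.+1 -> R := fun i => (-1) ^+ b * w 0 i.
have VU b i : `|V b i - U b i| < h.
  by rewrite -mulrBr normrM normrX normrN1 expr1n mul1r.
have Vlt b i : lab SS i = b -> V b i < Z f h SS b i.
  by move=> lb; rewrite (Z_lab f h lb); have := VU b i; rewrite ltr_norml => /andP[_]; lra.
have Vgt b i : lab SS i = b.+1 -> Z f h SS b i < V b i.
  by move=> lb; rewrite (Z_labS f h lb); have := VU b i; rewrite ltr_norml => /andP[]; lra.
have /choice[t tP] : forall b, exists t, (b < Q)%N ->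
    [/\ consec X I (s b) t, lab SS (s b) = b, lab SS t = b.+1 & (t <= s b.+1)%N].
  move=> b; case: (ltnP b Q) => [bQ|]; last by exists ord0.
  by have [t tP] := good_join x_incr G sz h0 bQ; exists t.
pose D (i : nat) := (w 0 (inord i.+1) - w 0 (inord i)) / (X (inord i.+1) - X (inord i)).
(* [d b] is a unit step inside join b that is at least as steep as w is on average over the join. *)
have /choice[d dP] : forall b, exists d : nat, (b < Q)%N ->
    (s b <= d < t b)%N /\ slope X (V b) (s b) (t b) <= (-1) ^+ b * D d.
  move=> b; case: (ltnP b Q) => [bQ|]; last by exists 0%N.
  have [/(consecP x_incr)[_ _ st _] _ _ _] := tP b bQ.
  have tn := ltn_ord (t b).
  have := @slope_average R (fun i : nat => X (inord i)) (fun i : nat => V b (inord i)) (s b) (t b)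
    (slope X (V b) (s b) (t b)) st.
  case.
  - by move=> i ib; rewrite Xlt' !inordK //; lia.
  - by rewrite !inord_val /slope divfK // subr_eq0 gt_eqF // Xlt'.
  - move=> i ib le; exists i; split=> //; apply: le_trans le _.
    by rewrite /V /D -mulrBr mulrA.
have jumps b : (b.+1 < Q)%N -> exists2 l, (d b <= l < d b.+1)%N &
    0 < (-1) ^+ b.+1 * cdiff x w (inord l) (inord l.+1) (inord l.+2).
  move=> bQ; have bQ' := ltnW bQ.
  have [st ls lt ts] := tP b bQ'; have [st1 ls1 lt1 _] := tP b.+1 bQ.
  have /(consecP x_incr)[_ _ lst _] := st; have /(consecP x_incr)[_ _ lst1 _] := st1.
  have [/andP[d1 d2] dle] := dP b bQ'; have [/andP[d1' d2'] dle1] := dP b.+1 bQ.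
  have dd : (d b <= d b.+1)%N by lia.
  have le1 : (-1) ^+ b.+1 * D (d b) <= slope X (V b.+1) (s b) (t b).
    move: dle; rewrite /V !slope_scale !exprS !mulN1r !mulNr lerN2 //.
  have lt2 : slope X (V b.+1) (s b) (t b) < slope X (Z f h SS b.+1) (s b) (t b).
    rewrite /slope ltr_pM2r ?invr_gt0 ?subr_gt0 ?Xlt' //.
    have := Vlt b.+1 (t b) lt.
    have := Vgt b (s b); have := Vlt b (s b) ls.
    have -> : Z f h SS b.+1 (s b) = - Z f h SS b (s b) by rewrite ZS.
    have -> : V b.+1 (s b) = - V b (s b) by rewrite /V exprS mulN1r mulNr.
    lra.
  have le3 := join_slope_le bQ' st lt st1 ls1.
  have lt4 : slope X (Z f h SS b.+1) (s b.+1) (t b.+1) < slope X (V b.+1) (s b.+1) (t b.+1).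
    rewrite /slope ltr_pM2r ?invr_gt0 ?subr_gt0 ?Xlt' //.
    by have := Vlt b.+1 _ ls1; have := Vgt b.+1 _ lt1; lra.
  have Dlt : (-1) ^+ b.+1 * D (d b) < (-1) ^+ b.+1 * D (d b.+1).
    exact: le_lt_trans le1 (lt_trans lt2 (le_lt_trans le3 (lt_le_trans lt4 dle1))).
  have [l ll Dl] := @step_up R (fun i : nat => (-1) ^+ b.+1 * D i) _ _ dd Dlt.
  exists l => //; have tn := ltn_ord (t b.+1).
  rewrite cdiff_slope mulrCA pmulr_rgt0; last first.
    by case/andP: ll => ? ?; rewrite invr_gt0 subr_gt0 Xlt' !inordK //; nlia.
  by rewrite mulrBr subr_gt0.
have /choice[g gP] : forall b, exists l : nat, (b.+1 < Q)%N -> (d b <= l < d b.+1)%N /\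
    0 < (-1) ^+ b.+1 * cdiff x w (inord l) (inord l.+1) (inord l.+2).
  move=> b; case: (ltnP b.+1 Q) => [/jumps[l ? ?]|]; [by exists l|by exists 0%N].
rewrite /sign_changes /= oner_neq0 /cseq.
(* The leading 1 has sign (-1)^0 and the first forced difference is negative, so each of the Q - 1
   differences gives a change. *)
apply: (changes_ge (e := 0) (g := g)); rewrite ?expr0 ?mulr1 //.
- move=> b bQ; have bQ' : (b.+1 < Q)%N by lia.
  have [/andP[_ gd] pos] := gP b bQ'; have [/andP[_ dt] _] := dP b.+1 bQ'.
  by have := ltn_ord (t b.+1); split=> //; lia.
- move=> i j; elim: j => // j IH; rewrite ltnS leq_eqVlt => /orP[/eqP ->|ij] jQ.
    by have [/andP[_ ?] _] := gP j ltac:(lia); have [/andP[? _] _] := gP j.+1 ltac:(lia); lia.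
  apply: ltn_trans (IH ij _) _; first lia.
  by have [/andP[_ ?] _] := gP j ltac:(lia); have [/andP[? _] _] := gP j.+1 ltac:(lia); lia.
Qed.

End LowerBound.

(** * Prices of the pieces and the index to be inserted *)

Section PiecePrice.
Variables (h : R) (I : {set 'I_n.+1}) (SS : seq 'I_n.+1) (Q : nat).
Hypothesis G : good x f h I SS.
Hypothesis sz : size SS = Q.+1.
Hypothesis h0 : 0 < h.

Notation s b := (nth ord0 SS b).
Notation P b := (nth (ord0, ord0) (pieces I SS) b).

Lemma lab_s b : (b <= Q)%N -> lab SS (s b) = b.
Proof.
move=> bQ; apply: lab_eq; rewrite ?sz //; first exact: good_sorted G.
by move=> k kb; apply: (good_lt G sz h0 kb bQ).
Qed.

Lemma piece_left_mem b : (b <= Q)%N -> (P b).1 \in I.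
Proof.
move=> bQ; rewrite pieces_nth ?sz //=; case: b bQ => [|b] bQ; first exact: g_ord0 G.
have [t [st _ _ _]] := good_join x_incr G sz h0 bQ.
by rewrite (consec_succ x_incr st) /=; case: st.
Qed.

Lemma piece_rightE b : (b <= Q)%N -> (P b).2 = s b.
Proof. by move=> bQ; rewrite pieces_nth ?sz. Qed.

Lemma piece_right_mem b : (b <= Q)%N -> (P b).2 \in I.
Proof. by move=> bQ; rewrite piece_rightE //; exact: (good_mem G sz bQ). Qed.

Lemma piece_le b : (b <= Q)%N -> ((P b).1 <= (P b).2)%N.
Proof.
move=> bQ; have := piece_bounds x_incr G sz h0 (piece_right_mem bQ) bQ.
by rewrite leqnn andbT => ->; rewrite piece_rightE // lab_s.
Qed.

(** [g_vertex] puts the elements of I on the hull of their range, and [g_edge] leaves no datum under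
    an edge that could be another vertex. *)
Lemma good_hull b j : (b <= Q)%N -> ((P b).1 <= j)%N -> (j <= (P b).2)%N ->
  (j \in hull x ((-1) ^+ b) f (P b).1 (P b).2) = (j \in I).
Proof.
move=> bQ lj jr; have lI := piece_left_mem bQ; have rI := piece_right_mem bQ.
have vE : vec ((-1) ^+ b *: f) = U b by apply: funext => i; rewrite /vec mxE.
have labE i : i \in I -> ((P b).1 <= i)%N -> (i <= (P b).2)%N -> lab SS i = b.
  by move=> iI li ir; apply/eqP; rewrite -(piece_bounds x_incr G sz h0 iI bQ) li ir.
apply/(hullP x_incr)/idP => [[_ _ H]|jI].
  case: H => [->|->|vj] //; apply: contraT => jI.
  have lj' : X (P b).1 < X j.
    by rewrite Xlt' ltn_neqAle lj andbT; apply: contraNneq jI => /val_inj <-.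
  have jr' : X j < X (P b).2.
    by rewrite Xlt' ltn_neqAle jr andbT; apply: contraNneq jI => /val_inj ->.
  have [u [v [uv lu vr /andP[uj jv]]]] := bracket (Xinj x_incr) lI rI lj' jr' jI.
  have [uI vI luv _] := uv.
  have := vj u v lu uj jv vr; rewrite vE => /(cvx_mid _ uj jv).
  have lu' : lab SS u = b.
    by apply: labE; rewrite // -Xle' // (le_trans (ltW luv)).
  have lv' : lab SS v = b.
    by apply: labE; rewrite // -Xle' // (le_trans lu) // ltW.
  have := g_edge G h0 uv _ (i := j); rewrite lu' lv' -!Xlt' => /(_ erefl uj jv).
  by rewrite leNgt => /negP.
split=> //; case: (eqVneq j (P b).1) => [->|jl]; first exact: Or31.
case: (eqVneq j (P b).2) => [->|jr']; first exact: Or32.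
apply: Or33 => i k; rewrite vE !Xle' !Xlt' => li ij jk kr.
have lj' := labE j jI lj jr; rewrite -[in U _]lj'.
apply: (g_vertex G) => // c cI ic ck; rewrite lj'; apply: labE => //; lia.
Qed.

Lemma piece_price_spec : let pp := piece_price x f I SS in
  [/\ 0 <= pp,
      forall a c, consec X I a c -> lab SS a = lab SS c -> forall i, (a < i)%N -> (i < c)%N ->
        U (lab SS a) i <= seg X (U (lab SS a)) a c i + 2 * pp &
      pp = 0 \/ attained pp I SS].
Proof.
move=> pp; have vE b : vec ((-1) ^+ b *: f) = U b by apply: funext => i; rewrite /vec mxE.
have spec b (bQ : (b <= Q)%N) := price_spec x_incr (piece_le bQ) (piece_left_mem bQ)
  (piece_right_mem bQ) (fun j => @good_hull b j bQ).
pose Fp (b : 'I_(size SS)) := price x ((-1) ^+ b) f (P b).1 (P b).2.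
have ppE : pp = \big[Num.max/0]_(b < size SS) Fp b by [].
have ltQ (b : 'I_(size SS)) : (b <= Q)%N by rewrite -ltnS -sz.
split.
- by rewrite ppE; apply: bigmax_ge_id.
- move=> a c ac lac i ai ic; have [aI cI _ _] := ac.
  have bQ := good_lab_le G sz a; move: lac bQ; set b := lab SS a => lac bQ.
  have /andP[la _] : ((P b).1 <= a <= (P b).2)%N by rewrite (piece_bounds x_incr G sz).
  have /andP[_ rc] : ((P b).1 <= c <= (P b).2)%N by rewrite (piece_bounds x_incr G sz) // -lac.
  have [_ bnd _] := spec b bQ; have := bnd a c ac la rc i ai ic; rewrite vE => /le_trans; apply.
  rewrite lerD2l ler_pM2l // ppE.
  have bS : (b < size SS)%N by rewrite sz.
  exact: (@le_bigmax _ _ _ 0 Fp (Ordinal bS)).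
- have := bigmax_cases xpredT Fp; rewrite -ppE => -[->|[b _ ppb]]; first by left.
  have [_ _ att] := spec b (ltQ b); case: att => [E|[a [c [j [ac la cr /andP[aj jc] Uj]]]]].
    by left; rewrite ppb.
  right; exists a, c, j; have [aI cI lac _] := ac; rewrite Xlt' in lac.
  have lE : lab SS a = b.
    by apply/eqP; rewrite -(piece_bounds x_incr G sz h0 aI (ltQ b)) la /=; lia.
  have lE' : lab SS c = b.
    by apply/eqP; rewrite -(piece_bounds x_incr G sz h0 cI (ltQ b)) cr andbT; lia.
  split=> //; first by rewrite lE lE'.
  by rewrite lE; rewrite vE in Uj; rewrite Uj ppb.
Qed.

Lemma good_edge_le a c i : consec X I a c -> lab SS a = lab SS c -> (a < i)%N -> (i < c)%N ->
  U (lab SS a) i <= seg X (U (lab SS a)) a c i + 2 * h.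
Proof.
move=> ac lac ai ic; have := g_dist G ac ai ic; rewrite (dist_Z x f h SS (lab SS a)).
have -> : seg X (Z f h SS (lab SS a)) a c i = seg X (U (lab SS a)) a c i + h.
  by rewrite /seg !(@Z_lab _ _ f h SS (lab SS a)) //; ring.
by rewrite ler_norml => /andP[_]; lra.
Qed.

Lemma attained_le h1 : attained h1 I SS -> h1 <= h.
Proof.
by move=> [a [c [j [ac lac aj jc Uj]]]]; have := good_edge_le ac lac aj jc; rewrite Uj; lra.
Qed.

Lemma piece_price_le : piece_price x f I SS <= h.
Proof.
have [_ _ [->|]] := piece_price_spec; first exact: ltW.
exact: attained_le.
Qed.

Lemma piece_price_eq : attained h I SS -> piece_price x f I SS = h.
Proof.
move=> [a [c [j [ac lac aj jc Uj]]]]; apply/le_anti; rewrite piece_price_le /=.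
by have [_ le _] := piece_price_spec; have := le a c ac lac j aj jc; rewrite Uj; lra.
Qed.

(** The assumption u < v excludes the conventional successor of an index at or after max I. *)
Lemma succ_consec u v : u \in I -> succ_in I u = Some v -> (u < v)%N -> consec X I u v.
Proof.
move=> uI; rewrite /succ_in; case E: (omax I) => [m|//] /=.
case: ifP => mu.
  rewrite /pred_in /omax; case: pickP => // z /andP[]; rewrite inE => /andP[_ zm] _ [<-]; lia.
move=> /ominP[]; rewrite inE => /andP[vI _] vmin uv; apply/(consecP x_incr); split=> //.
by move=> i iI ui iv; have := vmin i; rewrite inE iI ui => /(_ isT); lia.
Qed.

(** The last clause is what the choice of the lowest index provides: strictness to the left of j,
    which makes j a strict vertex of its new piece. *)
Lemma jstar_spec : attained h I SS -> exists j u v,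
  [/\ jstar x f I SS = Some j, pred_in I j = Some u /\ consec X I u v,
      lab SS u = lab SS v, (u < j < v)%N /\
      U (lab SS u) j = seg X (U (lab SS u)) u v j + 2 * h &
      forall i, (u < i)%N -> (i < j)%N ->
        U (lab SS u) i < seg X (U (lab SS u)) u v i + 2 * h].
Proof.
move=> att; have ppE := piece_price_eq att.
rewrite /jstar ppE h0.
set A := [set j : 'I_n.+1 | _].
have AP j : j \in A <-> exists u v, [/\ consec X I u v, lab SS u = lab SS v,
    (u < j)%N, (j < v)%N & U (lab SS u) j = seg X (U (lab SS u)) u v j + 2 * h].
  rewrite inE; split.
  - move=> /existsP[b /existsP[u /existsP[v /and5P[uI /eqP su Pu uj /and3P[jv vP /eqP E]]]]].
    have bQ : (b <= Q)%N by rewrite -ltnS -sz.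
    have uv := succ_consec uI su (ltn_trans uj jv); have [_ vI _ _] := uv.
    have lu : lab SS u = b.
      by apply/eqP; rewrite -(piece_bounds x_incr G sz h0 uI bQ) Pu /=; lia.
    have lv : lab SS v = b.
      by apply/eqP; rewrite -(piece_bounds x_incr G sz h0 vI bQ) vP andbT; lia.
    exists u, v; split; rewrite ?lu ?lv //.
    by rewrite E mulVKf // (seg_scale x) lineE /U /vec; ring.
  - move=> [u [v [uv luv uj jv E]]].
    have [uI vI _ _] := uv; have bQ := good_lab_le G sz u.
    have bS : (lab SS u < size SS)%N by rewrite sz.
    apply/existsP; exists (Ordinal bS); apply/existsP; exists u; apply/existsP; exists v.
    have /andP[la _] : ((P (lab SS u)).1 <= u <= (P (lab SS u)).2)%N by rewrite (piece_bounds x_incr G sz).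
    have /andP[_ rc] : ((P (lab SS u)).1 <= v <= (P (lab SS u)).2)%N by rewrite (piece_bounds x_incr G sz) // -luv.
    rewrite /= uI (consec_succ x_incr uv) eqxx la uj jv rc /=.
    apply/eqP; move: E; rewrite /U (seg_scale x) lineE /vec => E.
    by have -> : h = 2^-1 * (2 * h) by [rewrite mulKf]; congr (_ * _); lra.
have [a [c [j0 [ac lac aj jc Uj]]]] := att.
have j0A : j0 \in A by apply/AP; exists a, c.
case: (@arg_minnP _ j0 (fun j => j \in A) val j0A) => j jA jmin.
have [u [v [uv luv uj jv E]]] := (AP j).1 jA.
have /(consecP x_incr)[uI vI _ gap] := uv.
exists j, u, v; split=> //.
- exact: omin_some.
- split=> //; apply: omax_some; first by rewrite inE uI.
  by move=> k; rewrite inE => /andP[kI kj]; rewrite leqNgt; apply/negP => uk; apply: (gap k) => //; lia.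
- by rewrite uj.
- move=> i ui ij; have iv : (i < v)%N by lia.
  rewrite lt_neqAle (good_edge_le uv luv ui iv) andbT; apply/eqP => Ei.
  have /jmin : i \in A by apply/AP; exists u, v.
  by rewrite /=; lia.
Qed.

End PiecePrice.
End Prices.

(** * Splitting a piece where h is attained *)

Section Insertion.
Variables (R : realType) (n : nat) (x f : 'rV[R]_n.+1).
Hypothesis x_incr : forall i j : 'I_n.+1, (i < j)%N -> x 0 i < x 0 j.
Notation X := (X x).
Notation U := (U f).
Let Xlt' := Xlt x_incr.
Let Xle' := Xle x_incr.
Variables (h : R) (I : {set 'I_n.+1}) (SS : seq 'I_n.+1) (Q : nat).
Hypothesis G : good x f h I SS.
Hypothesis sz : size SS = Q.+1.
Hypothesis h0 : 0 < h.
Variables (j u v : 'I_n.+1).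
Hypothesis uv : consec X I u v.
Hypothesis luv : lab SS u = lab SS v.
Hypothesis uj : (u < j)%N.
Hypothesis jv : (j < v)%N.
Hypothesis Uj : U (lab SS u) j = seg X (U (lab SS u)) u v j + 2 * h.
Hypothesis Umin : forall i : 'I_n.+1, (u < i)%N -> (i < j)%N ->
  U (lab SS u) i < seg X (U (lab SS u)) u v i + 2 * h.

Let I1 := j |: I.
Let SS1 := sort (fun i j : 'I_n.+1 => (i <= j)%N) [:: j, u & SS].
Let b := lab SS u.

Let uI : u \in I. Proof. by case: uv. Qed.
Let vI : v \in I. Proof. by case: uv. Qed.
Let gap (i : 'I_n.+1) : i \in I -> (u < i)%N -> (i < v)%N -> False.
Proof. by case/(consecP x_incr): uv => _ _ _; apply. Qed.
Let jI : j \notin I. Proof. by apply/negP => /gap; apply. Qed.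

Let perm1 : perm_eq SS1 [:: j, u & SS].
Proof. by rewrite perm_sort. Qed.

Lemma size_insert : size SS1 = Q.+3.
Proof. by rewrite size_sort /= sz. Qed.

Let lab1 (i : 'I_n.+1) : lab SS1 i = ((j < i) + ((u < i) + lab SS i))%N.
Proof. by rewrite /lab (permP perm1). Qed.

Let side (i : 'I_n.+1) : i \in I -> (i <= u)%N || (v <= i)%N.
Proof.
by move=> iI; case: (leqP i u) => //= ui; rewrite leqNgt; apply/negP => /(gap iI ui).
Qed.

(** Elements up to u keep their number, j forms a piece of its own, and elements from v on move up
    by two, which preserves their orientation. *)
Let lab1_lo (i : 'I_n.+1) : (i <= u)%N -> lab SS1 i = lab SS i.
Proof.
by move=> iu; rewrite lab1; case: (ltnP j i) => ?; case: (ltnP u i) => ?; move: uj; lia.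
Qed.

Let lab1_hi (i : 'I_n.+1) : (v <= i)%N -> lab SS1 i = (lab SS i).+2.
Proof.
by move=> iu; rewrite lab1; case: (ltnP j i) => ?; case: (ltnP u i) => ?; move: uj jv; lia.
Qed.

Let lab1_j : lab SS1 j = b.+1.
Proof.
rewrite lab1 ltnn uj /= add0n add1n; congr S; apply/eqP.
by rewrite eqn_leq /b {1}luv !lab_le // ltnW.
Qed.

Let lab_lo (i : 'I_n.+1) : (i <= u)%N -> (lab SS i <= b)%N.
Proof. exact: lab_le. Qed.
Let lab_hi (i : 'I_n.+1) : (v <= i)%N -> (b <= lab SS i)%N.
Proof. by rewrite /b luv; exact: lab_le. Qed.

Let U2 c : U c.+2 = U c.
Proof. by rewrite !US opp_opp. Qed.

Let Ulab1 (i : 'I_n.+1) : i \in I -> U (lab SS1 i) = U (lab SS i).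
Proof. by move=> /side/orP[/lab1_lo|/lab1_hi] ->; rewrite ?U2. Qed.

Let yv1 (i : 'I_n.+1) : i \in I -> yv f h SS1 i = yv f h SS i.
Proof.
by move=> /side/orP[/lab1_lo|/lab1_hi]; rewrite /yv => -> //; rewrite !exprS !mulN1r opprK.
Qed.

(** The new vertex lies on the old edge, so the polygon and its slopes do not change. *)
Let yv1_j : yv f h SS1 j = seg X (yv f h SS) u v j.
Proof.
have Zj : Z f h SS1 b j = U b j - h by apply: Z_labS lab1_j.
have sgn := sign_sq R b.
have E : Z f h SS b u = U b u + h by apply: Z_lab.
have E' : Z f h SS b v = U b v + h by apply: Z_lab; rewrite /b luv.
have : Z f h SS1 b j = seg X (Z f h SS b) u v j.
  rewrite Zj Uj /seg E E' -/b; ring.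
rewrite /Z (seg_scale x) => /(congr1 (fun z => (-1) ^+ b * z)).
by rewrite !mulrA sgn !mul1r.
Qed.

Let collinear_l (W W' : 'I_n.+1 -> R) (i : 'I_n.+1) : W' u = W u -> W' j = seg X W u v j ->
  seg X W' u j i = seg X W u v i.
Proof.
move=> Wu Wj; rewrite /seg Wu Wj /seg.
have : X j - X u != 0 by rewrite subr_eq0 gt_eqF // Xlt'.
have : X v - X u != 0 by rewrite subr_eq0 gt_eqF // Xlt' (ltn_trans uj).
by move=> ? ?; field; apply/andP.
Qed.

Let collinear_r (W W' : 'I_n.+1 -> R) (i : 'I_n.+1) : W' v = W v -> W' j = seg X W u v j ->
  seg X W' j v i = seg X W u v i.
Proof.
move=> Wv Wj; rewrite /seg Wv Wj /seg.
have : X v - X j != 0 by rewrite subr_eq0 gt_eqF // Xlt'.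
have : X v - X u != 0 by rewrite subr_eq0 gt_eqF // Xlt' (ltn_trans uj).
by move=> ? ?; field; apply/andP.
Qed.

Let consec1 (a c : 'I_n.+1) : consec X I1 a c ->
  [\/ a = u /\ c = j, a = j /\ c = v | consec X I a c].
Proof.
move=> /(consecP x_incr)[]; rewrite !in_setU1 => aI cI ac gap1.
have gap1' i : i \in I -> (a < i)%N -> (i < c)%N -> False.
  by move=> iI; apply: gap1; rewrite in_setU1 iI orbT.
case/predU1P: aI => [aE|aI]; case/predU1P: cI => [cE|cI].
- by move: ac; rewrite cE aE ltnn.
- apply: Or32; split=> //; apply/val_inj/eqP => /=.
  subst a; have /orP[cu|vc] := side cI; first by move: uj ac; lia.
  by rewrite eqn_leq vc andbT leqNgt; apply/negP; apply: (gap1' v).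
- subst c; apply: Or31; split=> //; apply/val_inj/eqP => /=.
  have /orP[au|va] := side aI; last by move: jv ac; lia.
  by rewrite eqn_leq au /= leqNgt; apply/negP => aU; apply: (gap1' u).
- by apply: Or33; apply/(consecP x_incr).
Qed.

Let slope_edge (a c : 'I_n.+1) : consec X I1 a c -> exists a' c',
  [/\ consec X I a' c', a \in I -> a' = a, c \in I -> c' = c,
      a = j \/ c = j -> a' = u /\ c' = v &
      forall e, slope X (Z f h SS1 e) a c = slope X (Z f h SS e) a' c'].
Proof.
have jNE z : z \in I -> z <> j by move=> zI E; move: jI; rewrite -E zI.
have Zj e : Z f h SS1 e j = seg X (Z f h SS e) u v j by rewrite /Z (seg_scale x) yv1_j.
have ZI e z : z \in I -> Z f h SS1 e z = Z f h SS e z by move=> zI; rewrite /Z yv1.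
move=> ac; case: (consec1 ac) => [[-> ->]|[-> ->]|ac'].
- exists u, v; split=> //; first by move=> jI'; case: (jNE _ jI').
  move=> e; apply: (@slope_seg _ _ _ (Z f h SS e) (Z f h SS1 e) u v); rewrite ?Xlt' //.
  by rewrite segl ZI.
- exists u, v; split=> //; first by move=> jI'; case: (jNE _ jI').
  move=> e; apply: (@slope_seg _ _ _ (Z f h SS e) (Z f h SS1 e) u v); rewrite ?Xlt' //.
  by rewrite segr ?ZI // Xlt' (ltn_trans uj).
- have [aI cI _ _] := ac'; exists a, c; split=> //; first by case=> E; [case: (jNE a)|case: (jNE c)].
  move=> e.
  by rewrite /slope !ZI.
Qed.

Let sorted1 : sorted (fun i j : 'I_n.+1 => (i <= j)%N) SS1.
Proof. by apply: sort_sorted => z t; apply: leq_total. Qed.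

Let sorted1_lt : sorted (fun i j : 'I_n.+1 => (i < j)%N) SS1.
Proof.
have sortedE (r : rel nat) s : sorted (fun i j : 'I_n.+1 => r i j) s = sorted r (map val s).
  by rewrite sorted_map.
have un : uniq SS.
  have := g_strict G h0; rewrite (sortedE ltn) ltn_sorted_uniq_leq => /andP[].
  by rewrite map_inj_uniq //; exact: val_inj.
rewrite (sortedE ltn) ltn_sorted_uniq_leq -(sortedE leq) sorted1 andbT.
rewrite map_inj_uniq; last exact: val_inj.
rewrite (perm_uniq perm1) /= un andbT.
have sub : {subset SS <= I} by case: (g_pieces G).
(* An element of S has a smaller label than every index after it, whereas u and v share theirs. *)
have uS : u \notin SS.
  apply/negP => /(nthP ord0)[a aS aE].
  have l1 := lab_nth u (good_sorted G) aS; have l2 := lab_nth v (good_sorted G) aS.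
  by move: l1 l2; rewrite aE ltnn luv (ltn_trans uj jv) => <-.
rewrite uS andbT in_cons negb_or; apply/andP; split.
  by apply: contraTneq uj => ->; rewrite ltnn.
by apply: contra jI => /sub.
Qed.

Lemma good_insert : good x f h I1 SS1.
Proof.
have [so sub S0 lS] := g_pieces G.
have sub1 : {subset SS1 <= I1}.
  move=> z; rewrite (perm_mem perm1) !inE => /or3P[->//|/eqP ->|/sub ->].
  - by rewrite uI orbT.
  - by rewrite orbT.
have I1P z : z \in I1 -> z = j \/ z \in I by rewrite in_setU1 => /predU1P.
split.
- split=> //; first by rewrite -size_eq0 size_insert.
  have mx : ord_max \in SS1.
    rewrite (perm_mem perm1) !inE -lS; case: (SS) S0 => // a s _.
    by rewrite /= mem_last !orbT.
  have /(nthP ord0)[k kS kE] := mx.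
  have tr : transitive (fun i j : 'I_n.+1 => (i <= j)%N) by move=> ? ? ?; apply: leq_trans.
  have rf : reflexive (fun i j : 'I_n.+1 => (i <= j)%N) by move=> ?.
  rewrite -nth_last; apply/val_inj/eqP; rewrite eqn_leq -ltnS ltn_ord /= -[leqLHS]/(nat_of_ord ord_max) -kE.
  apply: (sorted_leq_nth tr rf ord0 sorted1); rewrite ?inE // size_insert //.
  by move: kS; rewrite size_insert.
- by rewrite in_setU1 (g_ord0 G) orbT.
- exact: ltW.
- move=> a c ac i ai ic; case: (consec1 ac) => [[aE cE]|[aE cE]|ac'].
  + move: ai ic; rewrite aE cE => ai ic; rewrite (collinear_l i (yv1 uI) yv1_j).
    exact: (g_dist G uv ai (ltn_trans ic jv)).
  + move: ai ic; rewrite aE cE => ai ic; rewrite (collinear_r i (yv1 vI) yv1_j).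
    exact: (g_dist G uv (ltn_trans uj ai) ic).
  + have [aI cI _ _] := ac'; rewrite /seg !yv1 //.
    exact: (g_dist G ac' ai ic).
- move=> a p c ap pc _.
  have [a1 [p1 [ap1 _ p1E E1 ->]]] := slope_edge ap.
  have [p2 [c2 [pc2 p2E _ E2 ->]]] := slope_edge pc.
  have [_ pI1 _ _] := ap; case: (I1P _ pI1) => [pj|pI].
    by have [-> ->] := E1 (or_intror pj); have [-> ->] := E2 (or_introl pj).
  rewrite (p1E pI) {E1} in ap1 *; rewrite (p2E pI) {E2} in pc2 *.
  have := g_convex G ap1 pc2 (fun=> h0).
  by case/orP: (side pI) => [/lab1_lo|/lab1_hi] -> //; rewrite !ZS !opp_opp.
- by [].
- move=> _ i p k pI1 ip pk same; case: (I1P _ pI1) => [pj|pI].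
    subst p; rewrite lab1_j US.
    have ui : (u <= i)%N.
      rewrite leqNgt; apply/negP => iu.
      have := same u; rewrite in_setU1 uI orbT lab1_j lab1_lo // => /(_ isT iu (ltn_trans uj pk)).
      by rewrite -/b; clear; lia.
    have kv : (k <= v)%N.
      rewrite leqNgt; apply/negP => vk.
      have := same v; rewrite in_setU1 vI orbT lab1_j lab1_hi // => /(_ isT (ltn_trans ip jv) vk).
      by rewrite -luv -/b; clear; lia.
    (* Strict on the left by the choice of j, weak on the right: together they make j a strict
       corner. *)
    have Di : U b i < seg X (U b) u v i + 2 * h.
      move: ui; rewrite leq_eqVlt => /orP[/eqP/val_inj <-|ui]; last exact: Umin.
      by rewrite segl; move: h0; lra.
    have Dk : U b k <= seg X (U b) u v k + 2 * h.
      move: kv; rewrite leq_eqVlt => /orP[/eqP/val_inj ->|kv].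
        by rewrite segr ?Xlt' ?(ltn_trans uj) //; move: h0; lra.
      exact: (good_edge_le G uv luv (ltn_trans uj pk) kv).
    have Dj : U b j = seg X (U b) u v j + 2 * h by exact: Uj.
    have [al [be L]] := aff_seg X (U b) u v.
    rewrite !L in Di Dk Dj.
    have Xij : 0 < X j - X i by rewrite subr_gt0 Xlt'.
    have Xjk : 0 < X k - X j by rewrite subr_gt0 Xlt'.
    rewrite /cvx /negf Dj.
    have H1 : 0 < (al + be * X i + 2 * h - U b i) * (X k - X j) by rewrite mulr_gt0 // subr_gt0.
    have H2 : 0 <= (al + be * X k + 2 * h - U b k) * (X j - X i).
      by rewrite mulr_ge0 ?(ltW Xij) // subr_ge0.
    by lra.
  rewrite Ulab1 //; apply: (g_vertex G) => // c cI ic ck.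
  have cI1 : c \in I1 by rewrite in_setU1 cI orbT.
  have := same c cI1 ic ck.
  case/orP: (side cI) => [cu|vc]; case/orP: (side pI) => [pu|vp].
  + by rewrite !lab1_lo.
  + rewrite lab1_lo // lab1_hi // => E; move: E (lab_lo cu) (lab_hi vp); clear; lia.
  + rewrite lab1_hi // lab1_lo // => E; move: E (lab_hi vc) (lab_lo pu); clear; lia.
  + by rewrite !lab1_hi // => -[].
- move=> _ a c ac; case: (consec1 ac) => [[-> ->]|[-> ->]|ac'].
  + by rewrite lab1_j lab1_lo // -/b; clear; lia.
  + by rewrite lab1_j lab1_hi // -luv -/b; clear; lia.
  have [aI cI lac _] := ac'; rewrite Ulab1 // => E; apply: (g_edge G) => //.
  rewrite Xlt' in lac; move: E.
  case/orP: (side aI) => [au|va]; case/orP: (side cI) => [cu|vc].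
  + by rewrite !lab1_lo.
  + rewrite lab1_lo // lab1_hi // => E; move: E (lab_lo au) (lab_hi vc); clear; lia.
  + by move: va lac cu (ltn_trans uj jv); clear; lia.
  + by rewrite !lab1_hi // => -[].
Qed.

End Insertion.

(** * Bounds valid while the joins are being closed *)

Section Phase.
Variables (R : realType) (n : nat) (x f : 'rV[R]_n.+1).
Hypothesis x_incr : forall i j : 'I_n.+1, (i < j)%N -> x 0 i < x 0 j.
Notation X := (X x).
Notation U := (U f).
Notation attained := (attained x f).
Notation closed_join := (closed_join x f).
Let Xlt' := Xlt x_incr.
Let Xle' := Xle x_incr.
Implicit Types (I J : {set 'I_n.+1}) (b k : nat) (h H : R) (SS : seq 'I_n.+1).

(** The ends of an edge are data, so the edge lies above L, while the data do not exceed L + 2H. *)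
Lemma attains_tube (Y V : 'I_n.+1 -> R) (L : 'I_n.+1 -> R) (lo hi : 'I_n.+1) I h H :
  aff Y L -> (forall i, Y lo <= Y i -> Y i <= Y hi -> L i <= V i /\ V i <= L i + 2 * H) ->
  attains Y V lo hi I h -> h <= H.
Proof.
move=> affL tb [a [c [j [[_ _ ac _] la ch /andP[aj jc] Vj]]]].
have [La _] := tb a la (le_trans (ltW ac) ch).
have [Lc _] := tb c (le_trans la (ltW ac)) ch.
have [_ Lj] := tb j (le_trans la (ltW aj)) (le_trans (ltW jc) ch).
have := @aff_ge0 _ _ Y (fun z => seg Y V a c z - L z) a j c (affB (aff_seg _ _ _ _) affL) (ltW aj) (ltW jc).
by rewrite segl segr // !subr_ge0 => /(_ La Lc); lra.
Qed.

(** The old edge over the gap confines the data to a strip of height 2H, and a raised h is attained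
    inside the gap. *)
Lemma closed_join_le H I0 SS0 b s' t' e s t h I : good x f H I0 SS0 -> 0 < H ->
  consec X I0 s' t' -> lab SS0 s' = b -> lab SS0 t' = b.+1 -> e <= H ->
  closed_join b s' t' e s t h I -> h <= H.
Proof.
move=> G H0 st ls lt eH [J _ _].
have /(consecP x_incr)[_ _ lst _] := st; have Xst : X s' < X t' by rewrite Xlt'.
pose L i := seg X (Z f H SS0 b) s' t' i - H.
have affL : aff X L by apply: affB; [exact: aff_seg|exact: aff_cst].
have tb i : X s' <= X i -> X i <= X t' -> L i <= U b i /\ U b i <= L i + 2 * H.
  rewrite /L le_eqVlt => /orP[/eqP/(Xinj x_incr) <- _|si].
    by rewrite segl (Z_lab f H ls); lra.
  rewrite le_eqVlt => /orP[/eqP/(Xinj x_incr) ->|it].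
    by rewrite segr // (Z_labS f H lt); lra.
  rewrite !Xlt' in si it; have := g_dist G st si it.
  by rewrite (dist_Z x f H SS0 b) ler_norml => /andP[? ?]; split; lra.
have [ss st' tt] := And3 (ji_le1 J) (ji_le2 J) (ji_le3 J).
case: (ji_att J) => [-> //|att|att].
- apply: (attains_tube affL _ att) => i si is_; apply: tb => //.
  exact: le_trans is_ (le_trans st' tt).
- have affL' : aff (negf X) (fun z => - (L z + 2 * H)).
    have [a [c Lac]] := affL; exists (- (a + 2 * H)), c => z.
    by rewrite Lac /negf; ring.
  apply: (attains_tube affL' _ att) => i; rewrite /negf !lerN2 => it si.
  have [lo hi] := tb i (le_trans ss (le_trans st' si)) it.
  by split; lra.
Qed.

(** Resetting the starting value discards the attainment clause, so that joins closed from different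
    starting values can be assembled. *)
Lemma closed_join_self b s' t' e s t h I :
  closed_join b s' t' e s t h I -> closed_join b s' t' h s t h I.
Proof.
by move=> [J tl tr]; split=> //; split; try (by case: J); exact: Or31.
Qed.

Lemma closed_join_ext b (s' t' : 'I_n.+1) e s t h I I' :
  (forall i : 'I_n.+1, (s' <= i)%N -> (i <= t')%N -> (i \in I) = (i \in I')) ->
  closed_join b s' t' e s t h I -> closed_join b s' t' e s t h I'.
Proof.
move=> ext [J tl tr]; split=> //; apply: join_inv_ext J => i.
by rewrite !Xle'; exact: ext.
Qed.

Lemma prev_exists I (a q : 'I_n.+1) : a \in I -> q \in I -> (q < a)%N ->
  exists c, consec X I c a /\ (q <= c)%N.
Proof.
move=> aI qI qa; have := @next_exists _ _ (negf X) I a q aI qI.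
rewrite /negf ltrN2 Xlt' => /(_ qa) [c [/consec_opp ca]].
by rewrite lerN2 Xle' => qc; exists c.
Qed.

(** Step 4 evaluates the successor of t before testing whether it is wanted, possibly at max I,
    where the convention supplies a value. *)
Lemma succ_in_some I (i j : 'I_n.+1) : i \in I -> j \in I -> i != j -> exists t, succ_in I j = Some t.
Proof.
move=> iI jI ij; rewrite /succ_in.
case: (@arg_maxnP _ i (fun i => i \in I) val iI) => m mI mmax.
rewrite (omax_some mI) //=; case: leqP => [mj|jm].
  have im : (i < m)%N.
    rewrite ltn_neqAle; have /= -> := mmax i iI; rewrite andbT.
    apply: contraNneq ij => E; have /= jm := mmax j jI; apply/eqP/val_inj => /=; lia.
  have [c [cm _]] := prev_exists mI iI im.
  by exists c; exact: (consec_pred x_incr cm).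
have [|c [jc _]] := @next_exists _ _ X I j m jI mI; first by rewrite Xlt'.
exists c; have := consec_succ x_incr jc.
by rewrite /succ_in (omax_some mI) //= leqNgt jm.
Qed.

Lemma good_hull0 : let h := price x 1 f ord0 ord_max in
  let I := hull x 1 f ord0 ord_max in
  good x f h I [:: ord_max] /\ (0 < h -> attained h I [:: ord_max]).
Proof.
move=> h I.
have lab0 (i : 'I_n.+1) : lab [:: ord_max] i = 0%N.
  by rewrite /lab /= addn0 ltnNge -ltnS ltn_ord.
have vE : vec ((1 : R) *: f) = U 0 by apply: funext => i; rewrite /vec mxE /U expr0.
have IP i : i \in I <-> [\/ i = ord0, i = ord_max | vertex X (U 0) ord0 ord_max i].
  split=> [/(hullP x_incr)[_ _]|H]; first by rewrite vE.
  by apply/(hullP x_incr); rewrite vE; split=> //; rewrite -ltnS.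
have in0 : ord0 \in I by apply/IP; exact: Or31.
have inM : ord_max \in I by apply/IP; exact: Or32.
have [p0 bnd att] := @price_spec _ _ x x_incr 1 f ord0 ord_max I (leq0n _) in0 inM (fun _ _ _ => erefl).
rewrite vE -/h in p0 bnd att.
have leM (i : 'I_n.+1) : (i <= (ord_max : 'I_n.+1))%N by rewrite -ltnS.
have vert (i p k : 'I_n.+1) : p \in I -> (i < p)%N -> (p < k)%N -> cvx X (U 0) i p k.
  move=> /IP[->|->|v] ip pk; first by rewrite ltn0 in ip.
    by have := leM k; rewrite leqNgt pk.
  by apply: v; rewrite ?Xlt' ?Xle'.
(* The tangent point from a within the range up to c is a vertex of the whole hull, so it can only
   be c. *)
have below (a c i : 'I_n.+1) : consec X I a c -> (a < i)%N -> (i < c)%N -> seg X (U 0) a c i <= U 0 i.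
  move=> ac ai ic; have /(consecP x_incr)[aI cI lac gap] := ac.
  have Xac : X a < X c by rewrite Xlt'.
  have [p tan] := tangent_exists (U 0) Xac; have [ap pc P] := tan.
  suff pE : p = c.
    by subst p; apply: (tangent_chord tan); rewrite Xlt'.
  apply: (Xinj x_incr); apply/eqP; rewrite eq_le pc leNgt; apply/negP => ltpc.
  apply: (gap p); rewrite -?Xlt' //; apply/IP/Or33 => i' k _ i'p pk _.
  have step1 (k' : 'I_n.+1) : X p < X k' -> X k' <= X c -> cvx X (U 0) i' p k'.
    move=> pk' k'c; have [ai'|i'a] := lerP (X a) (X i').
      exact: (tangent_cvx (Xinj x_incr) tan).
    have c1 : cvx X (U 0) i' a p by apply: vert; rewrite // -Xlt'.
    have c2 : cvx X (U 0) a p k' := tangent_cvx (Xinj x_incr) tan (lexx _) ap pk' k'c.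
    exact: (cvx_transl i'a ap pk' c1 c2).
  have [kc|ck] := lerP (X k) (X c); first exact: step1.
  have c2 : cvx X (U 0) p c k by apply: vert; rewrite // -Xlt'.
  exact: (cvx_transr i'p ltpc ck (step1 c ltpc (lexx _)) c2).
have Zu i : Z f h [:: ord_max] 0 i = U 0 i + h by apply: Z_lab.
have slU i j : slope X (Z f h [:: ord_max] 0) i j = slope X (U 0) i j.
  by rewrite /slope !Zu; congr (_ / _); ring.
split.
  split=> //.
  - by split=> // z; rewrite inE => /eqP ->.
  - move=> a c ac i ai ic; rewrite (dist_Z x f h _ 0).
    have -> : seg X (Z f h [:: ord_max] 0) a c i = seg X (U 0) a c i + h.
      by rewrite /seg !Zu; ring.
    have lo := below a c i ac ai ic.
    have := bnd a c ac (leq0n _) (leM _) i ai ic; rewrite ler_norml; lra.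
  - move=> a p c ap pc _; rewrite lab0 !slU.
    have [_ pI lap _] := ap; have [_ _ lpc _] := pc.
    by have /cvx_slope := vert a p c pI ltac:(by rewrite -Xlt') ltac:(by rewrite -Xlt'); move=> /(_ lap lpc)/ltW.
  - by move=> _ i p k pI ip pk _; rewrite lab0; exact: vert.
  - by move=> _ a c ac _ i; rewrite lab0; exact: below.
move=> h0; case: att => [E|[a [c [j [ac _ _ /andP[aj jc] Uj]]]]]; first by rewrite E ltxx in h0.
by exists a, c, j; rewrite !lab0.
Qed.

End Phase.

(** * An auxiliary state for odd q *)

Section TwoPieces.
Variables (R : realType) (n : nat) (x f : 'rV[R]_n.+2).
Hypothesis x_incr : forall i j : 'I_n.+2, (i < j)%N -> x 0 i < x 0 j.
Notation X := (X x).

Lemma ends_consec : consec X [set ord0; ord_max] ord0 ord_max.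
Proof.
apply/(consecP x_incr); rewrite !in_set2 !eqxx orbT; split=> // i.
by rewrite in_set2 => /orP[]/eqP ->; rewrite ?ltnn.
Qed.

(** For odd q the algorithm starts at h = 0 without a good state. For large H, however, the line
    from f + H at the first point to f - H at the last one stays within H of all data; this state
    plays the part of the old one in the first closing. *)
Lemma good_two_pieces : exists2 H, 0 < H & good x f H [set ord0; ord_max] [:: ord0; ord_max].
Proof.
pose S : seq 'I_n.+2 := [:: ord0; ord_max].
pose d i := `|f 0 i - seg X (vec f) ord0 ord_max i|.
(* With r the relative position of i, the deviation d i is absorbed once it is at most rH and (1 -
   r)H. Inside the range [T i] equals d i (1/r + 1/(1 - r)), and H dominates all of these. *)
pose T i := d i * (X ord_max - X ord0) * ((X i - X ord0)^-1 + (X ord_max - X i)^-1).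
pose H := 1 + \sum_i T i.
have X0 i : 0 <= X i - X ord0 by rewrite subr_ge0 (Xle x_incr).
have XM i : 0 <= X ord_max - X i by rewrite subr_ge0 (Xle x_incr) -ltnS.
have T0 i : 0 <= T i.
  by rewrite !mulr_ge0 // ?normr_ge0 // addr_ge0 // invr_ge0.
have TH i : T i <= H.
  rewrite /H (bigD1 i) //=; have : 0 <= \sum_(j | j != i) T j by apply: sumr_ge0.
  by lra.
have H0 : 0 < H by rewrite /H; have : 0 <= \sum_i T i by [apply: sumr_ge0]; lra.
have only a c : consec X [set ord0; ord_max] a c -> a = ord0 /\ c = ord_max.
  move=> [+ + ac _]; rewrite !in_set2 => /orP[]/eqP ? /orP[]/eqP ?; subst => //.
  - by rewrite ltxx in ac.
  - by move: ac; rewrite (Xlt x_incr).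
  - by rewrite ltxx in ac.
have lab0 : lab S ord0 = 0%N by [].
have labM : lab S ord_max = 1%N by rewrite /lab /= ltnn.
have yv0 : yv f H S ord0 = f 0 ord0 + H by rewrite /yv lab0 expr0 mul1r.
have yvM : yv f H S ord_max = f 0 ord_max - H by rewrite /yv labM expr1 mulN1r.
exists H => //; split.
- by split=> // z; rewrite !inE.
- by rewrite in_set2 eqxx.
- exact: ltW.
- move=> a c /only[-> ->] i i0 iM.
  have l0 : 0 < X i - X ord0 by rewrite subr_gt0 (Xlt x_incr).
  have lM : 0 < X ord_max - X i by rewrite subr_gt0 (Xlt x_incr).
  set D := f 0 i - seg X (vec f) ord0 ord_max i.
  have lt : 0 < X ord_max - X ord0 by lra.
  set r := (X i - X ord0) / (X ord_max - X ord0).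
  have rE : r * (X ord_max - X ord0) = X i - X ord0 by rewrite /r divfK // gt_eqF.
  have -> : f 0 i - seg X (yv f H S) ord0 ord_max i = D - H * (1 - 2 * r).
    rewrite /D /seg yv0 yvM /vec /r; field; exact: lt0r_neq0.
  have r0 : 0 < r by rewrite divr_gt0.
  have r1 : r < 1 by rewrite /r ltr_pdivrMr //; lra.
  have TE : T i = d i * (r^-1 + (1 - r)^-1).
    have rN : 1 - r = (X ord_max - X i) / (X ord_max - X ord0).
      by rewrite /r; field; exact: lt0r_neq0.
    rewrite rN /T /r; field; by rewrite !lt0r_neq0.
  have d0 : 0 <= d i := normr_ge0 _.
  have inv1 : r * r^-1 = 1 by rewrite mulfV ?lt0r_neq0.
  have inv2 : (1 - r) * (1 - r)^-1 = 1 by rewrite mulfV ?lt0r_neq0 // subr_gt0.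
  have p1 : 0 <= r^-1 by rewrite invr_ge0 ltW.
  have p2 : 0 <= (1 - r)^-1 by rewrite invr_ge0 subr_ge0 ltW.
  have dH1 : d i <= r * H.
    apply: le_trans (_ : r * T i <= _); last by rewrite ler_pM2l.
    by rewrite TE mulrCA mulrDr inv1 ler_peMr // lerDl mulr_ge0 // ltW.
  have dH2 : d i <= (1 - r) * H.
    apply: le_trans (_ : (1 - r) * T i <= _); last by rewrite ler_pM2l // subr_gt0.
    by rewrite TE mulrCA mulrDr inv2 ler_peMr // lerDr mulr_ge0 // subr_ge0 ltW.
  have := ler_norm D.
  have := lerNnormlW (lexx `|D|); rewrite -/(d i) => D1 D2.
  by rewrite ler_norml; apply/andP; split; nra.
- by move=> a p c /only[_ ->] /only[].
- by move=> _ /=.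
- move=> _ i p k; rewrite in_set2 => /orP[]/eqP -> //.
  by move=> _; rewrite ltnNge -ltnS ltn_ord.
- by move=> _ a c /only[-> ->]; rewrite lab0 labM.
Qed.

End TwoPieces.

(** * Invariants of the main machine *)

Section Main.
Variables (R : realType) (n : nat) (x f : 'rV[R]_n.+1).
Hypothesis x_incr : forall i j : 'I_n.+1, (i < j)%N -> x 0 i < x 0 j.
Notation X := (X x).
Notation U := (U f).
Notation attained := (attained x f).
Notation closed_join := (closed_join x f).
Notation good := (good x f).
Let Xlt' := Xlt x_incr.
Let Xle' := Xle x_incr.
Implicit Types (I J : {set 'I_n.+1}) (b k : nat) (h H : R) (SS : seq 'I_n.+1).

(** [H] is a value at which the saved state is good, [e0] the value of h from which its joins are
    closed, and [t0] gives the right ends of its gaps. *)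
Record join_phase Q H (e0 : R) I0 SS0 t0 : Prop := Phase {
  ph_good : good H I0 SS0;
  ph_H : 0 < H;
  ph_sz : size SS0 = Q.+1;
  ph_e0 : 0 <= e0;
  ph_eH : e0 <= H;
  ph_t : forall b, (b < Q)%N -> consec X I0 (nth ord0 SS0 b) (t0 b);
  ph_edge : forall a c, consec X I0 a c -> lab SS0 a = lab SS0 c ->
    forall i : 'I_n.+1, (a < i)%N -> (i < c)%N ->
    U (lab SS0 a) i <= seg X (U (lab SS0 a)) a c i + 2 * e0;
  ph_att : 0 < e0 -> attained e0 I0 SS0 }.

Definition phase_frame Q SS0 t0 I0 I := forall i : 'I_n.+1,
  (forall b, (b < Q)%N -> ((nth ord0 SS0 b) < i)%N -> (i < t0 b)%N -> False) -> (i \in I) = (i \in I0).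

Record phase_shape Q SS0 t0 I0 I SS : Prop := Shape {
  sh_sz : size SS = Q.+1;
  sh_last : (nth ord0 SS Q) = ord_max;
  sh_frame : phase_frame Q SS0 t0 I0 I }.

Section OnePhase.
Variables (Q : nat) (H e0 : R) (I0 : {set 'I_n.+1}) (SS0 : seq 'I_n.+1) (t0 : nat -> 'I_n.+1).
Hypothesis ph : join_phase Q H e0 I0 SS0 t0.

Notation closed SS t b e h I := (closed_join b (nth ord0 SS0 b) (t0 b) e (nth ord0 SS b) (t b) h I).

Lemma phase_finish h I SS t : phase_shape Q SS0 t0 I0 I SS -> e0 <= h -> h <= H ->
  (forall b, (b < Q)%N -> closed SS t b h h I) -> good h I SS.
Proof.
move=> [sz la fr] eh hH cl; have h0 := le_trans (ph_e0 ph) eh.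
apply: (assemble x_incr (ph_good ph) (ph_H ph) hH h0 (ph_sz ph) sz la (ph_t ph) cl fr).
move=> a c ac lac i ai ic; apply: le_trans (ph_edge ph ac lac ai ic) _.
by rewrite lerD2l ler_pM2l.
Qed.

Lemma phase_att h I SS t b : phase_shape Q SS0 t0 I0 I SS -> e0 <= h -> h <= H ->
  (forall b, (b < Q)%N -> closed SS t b h h I) -> (b < Q)%N ->
  forall e : R, 0 <= e -> e < h -> closed SS t b e h I -> attained h I SS.
Proof.
move=> [sz la fr] eh hH cl bQ e e_ge0 elt [J _ _]; have h0 := le_trans (ph_e0 ph) eh.
have hp : 0 < h by apply: le_lt_trans elt.
apply: (assemble_attained x_incr (ph_good ph) (ph_H ph) hH h0 (ph_sz ph) sz la (ph_t ph) cl hp bQ).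
by case: (ji_att J) => [E|att|att]; [rewrite E ltxx in elt|left|right].
Qed.

Lemma phase_att0 I SS t : phase_shape Q SS0 t0 I0 I SS -> 0 < e0 ->
  (forall b, (b < Q)%N -> closed SS t b e0 e0 I) -> attained e0 I SS.
Proof.
move=> [sz la fr] ep cl.
apply: (assemble_attained0 x_incr (ph_good ph) (ph_H ph) (ph_eH ph) (ph_e0 ph) (ph_sz ph) sz la (ph_t ph) cl fr ep).
exact: ph_att ph ep.
Qed.

Lemma phase_disjoint b c (i : 'I_n.+1) : (b < Q)%N -> (c < Q)%N -> c != b ->
  ((nth ord0 SS0 c) <= i)%N -> (i <= t0 c)%N -> (i <= (nth ord0 SS0 b))%N || (t0 b <= i)%N.
Proof.
move=> bQ cQ cb ci ic.
have G := ph_good ph; have sz := ph_sz ph.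
have key b1 c1 : (b1 < Q)%N -> (c1 < Q)%N -> (b1 < c1)%N -> (t0 b1 <= (nth ord0 SS0 c1))%N.
  move=> b1Q c1Q lt; have /(consecP x_incr)[_ _ _ gap] := ph_t ph b1Q.
  rewrite leqNgt; apply/negP; apply: gap; first exact: (good_mem G sz (ltnW c1Q)).
  exact: (good_lt G sz (ph_H ph) lt (ltnW c1Q)).
case: (ltngtP c b) => [lt|lt|E]; last by rewrite E eqxx in cb.
- by rewrite (leq_trans ic (key c b cQ bQ lt)).
- by rewrite (leq_trans (key b c bQ cQ lt) ci) orbT.
Qed.

Lemma phase_labels b : (b < Q)%N -> lab SS0 (nth ord0 SS0 b) = b /\ lab SS0 (t0 b) = b.+1.
Proof.
move=> bQ; have [t' [st ls lt _]] := good_join x_incr (ph_good ph) (ph_sz ph) (ph_H ph) bQ.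
split=> //; have := consec_succ x_incr st; rewrite (consec_succ x_incr (ph_t ph bQ)) => -[->] //.
Qed.

Lemma phase_consec b h I SS : phase_shape Q SS0 t0 I0 I SS -> (b < Q)%N ->
  (forall i : 'I_n.+1, i \in I -> ((nth ord0 SS0 b) < i)%N -> (i < t0 b)%N -> False) ->
  consec X I (nth ord0 SS0 b) (t0 b).
Proof.
move=> sh bQ gap; have /(consecP x_incr)[sI tI lt _] := ph_t ph bQ.
have lt' : ((nth ord0 SS0 b) < t0 b)%N := lt.
have mem (i : 'I_n.+1) : (i == (nth ord0 SS0 b)) || (i == t0 b) -> i \in I0 -> i \in I.
  move=> iE iI0; rewrite (sh_frame sh) // => c cQ ci ic.
  have /(consecP x_incr)[_ _ _ gapc] := ph_t ph cQ.
  exact: (gapc i).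
by apply/(consecP x_incr); split; rewrite ?mem ?eqxx ?orbT.
Qed.

Lemma phase_step b h I SS : phase_shape Q SS0 t0 I0 I SS -> (b < Q)%N -> 0 <= h ->
  (nth ord0 SS b) = (nth ord0 SS0 b) ->
  (forall i : 'I_n.+1, i \in I -> ((nth ord0 SS0 b) < i)%N -> (i < t0 b)%N -> False) ->
  exists N s t1 h1 I1,
  [/\ closejoin x f N b.+1 h I SS = Some (h1, I1, set_nth ord0 SS b s),
      closed_join b (nth ord0 SS0 b) (t0 b) h s t1 h1 I1,
      phase_shape Q SS0 t0 I0 I1 (set_nth ord0 SS b s),
      forall c, (c < Q)%N -> c != b -> forall i : 'I_n.+1, ((nth ord0 SS0 c) <= i)%N ->
        (i <= t0 c)%N -> (i \in I) = (i \in I1) &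
      forall s2 t2 h2 hb I2, 0 <= h2 -> closed_join b (nth ord0 SS0 b) (t0 b) h2 s2 t2 hb I2 ->
        hb < h -> h1 = h].
Proof.
move=> sh bQ h0 sE gap; have con := phase_consec h sh bQ gap.
have bS : (b < size SS)%N by rewrite (sh_sz sh) ltnW.
have := closejoin_spec f x_incr bS (t' := t0 b) (h0 := h); rewrite sE => /(_ _ con h0).
move=> [N [s [t1 [h1 [I1 [E cl fr rerun]]]]]].
exists N, s, t1, h1, I1; split=> //.
- split.
  + by rewrite size_set_nth (sh_sz sh); apply/maxn_idPr; rewrite ltnS ltnW.
  + by rewrite nth_set_nth /= gtn_eqF // (sh_last sh).
  + move=> i out; rewrite fr ?(sh_frame sh) //.
    rewrite leqNgt; case: (ltnP (nth ord0 SS0 b) i) => //= si.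
    by rewrite leqNgt; apply/negP; apply: out.
- move=> c cQ cb i ci ic; rewrite fr //.
  exact: phase_disjoint ci ic.
Qed.

End OnePhase.

(** The joins already treated in step 3. As h never decreases, those closed at 0 come first, and c
    marks where they end. *)
Definition proc Q SS0 t0 (e hh : nat -> R) t a h e0 I SS (c : nat) :=
  forall b, (b < Q)%N -> (b.+1 < a)%N ->
  [/\ closed_join b (nth ord0 SS0 b) (t0 b) (e b) (nth ord0 SS b) (t b) (hh b) I, e0 <= e b, hh b <= h &
      (b.+1 < c)%N = (hh b == 0)].

Definition unproc Q SS0 t0 (a : nat) I SS := forall b, (b < Q)%N -> (a <= b.+1)%N ->
  (nth ord0 SS b) = (nth ord0 SS0 b) /\
  forall i : 'I_n.+1, i \in I -> ((nth ord0 SS0 b) < i)%N -> (i < t0 b)%N -> False.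

(** The meaning of the last raising join: earlier joins ended below the final h, this one and the
    later ones at it. *)
Definition last_raise (e hh : nat -> R) (a : nat) (ab : option nat) h e0 :=
  match ab with
  | None => h = e0 /\ forall b, (b.+1 < a)%N -> hh b = h
  | Some al => [/\ (0 < al < a)%N, e al.-1 < h,
      forall b, (b.+1 < al)%N -> hh b < h &
      forall b, (al <= b.+1)%N -> (b.+1 < a)%N -> hh b = h]
  end.

(* [e b] and [hh b] are the values of [h] before and after the last closing of *)
(* the join number [b].                                                        *)
Record inv3 Q a ab c h I SS (e0 : R) I0 SS0 H t0 (e hh : nat -> R) t : Prop := Inv3 {
  i3_ph : join_phase Q H e0 I0 SS0 t0;
  i3_sh : phase_shape Q SS0 t0 I0 I SS;
  i3_a : (0 < a <= Q.+1)%N;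
  i3_c : (c <= a)%N;
  i3_eh : e0 <= h;
  i3_hH : h <= H;
  i3_proc : proc Q SS0 t0 e hh t a h e0 I SS c;
  i3_unproc : unproc Q SS0 t0 a I SS;
  i3_last : last_raise e hh a ab h e0 }.

(** Joins numbered below a are closed at the final h; the others are as step 3 left them. *)
Record inv4 Q a al c h I SS I0 SS0 (e0 : R) H t0 (e hh : nat -> R) t : Prop := Inv4 {
  i4_ph : join_phase Q H e0 I0 SS0 t0;
  i4_sh : phase_shape Q SS0 t0 I0 I SS;
  i4_a : (0 < a)%N;
  i4_al : (a <= al <= Q)%N;
  i4_eh : e0 < h;
  i4_hH : h <= H;
  i4_done : forall b, (b < Q)%N -> (b.+1 < a)%N ->
    closed_join b (nth ord0 SS0 b) (t0 b) h (nth ord0 SS b) (t b) h I;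
  i4_todo : forall b, (b < Q)%N -> (a <= b.+1)%N ->
    [/\ closed_join b (nth ord0 SS0 b) (t0 b) (e b) (nth ord0 SS b) (t b) (hh b) I, e0 <= e b,
        (b.+1 < al)%N -> hh b < h, (al <= b.+1)%N -> hh b = h &
        (b.+1 < c)%N = (hh b == 0)];
  i4_last : e al.-1 < h }.

Definition main_ok Q h I SS := [/\ good h I SS, size SS = Q.+1 & 0 < h -> attained h I SS].

Definition machine_inv q (st : state5 R n) : Prop := match st with
  | Main2 qb h II SS => [/\ main_ok qb h II SS, (qb <= q)%N & odd qb = odd q]
  | Main3 qb a ab c h II SS h0 II0 SS0 => [/\ (1 < qb <= q)%N, odd qb = odd q &
      exists H t0 e hh t, inv3 qb a ab c h II SS h0 II0 SS0 H t0 e hh t]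
  | Main4 qb a ab c h II SS II0 SS0 => [/\ (1 < qb <= q)%N, odd qb = odd q &
      exists2 al, ab = Some al &
      exists e0 H t0 e hh t, inv4 qb a al c h II SS II0 SS0 e0 H t0 e hh t]
  | Main5 qb a ab c h II SS II0 SS0 => [/\ (1 < qb <= q)%N, odd qb = odd q &
      exists2 al, ab = Some al & (a < al)%N /\
      exists e0 H t0 e hh t, inv4 qb a al c h II SS II0 SS0 e0 H t0 e hh t]
  end.

(** A round takes a number of transitions linear in q, paid for by the increase of [qb] by two; the
    remaining terms count the joins still to be visited. *)
Definition rank q (st : state5 R n) : nat := match st with
  | Main2 qb _ _ _ => (q - qb) * (4 * q + 20)
  | Main3 qb a _ _ _ _ _ _ _ _ => (q - qb) * (4 * q + 20) + 2 * qb + 6 + (qb.+2 - a)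
  | Main4 qb a _ _ _ _ _ _ _ => (q - qb) * (4 * q + 20) + 2 * (qb.+1 - a) + 2
  | Main5 qb a _ _ _ _ _ _ _ => (q - qb) * (4 * q + 20) + 2 * (qb.+1 - a) + 1
  end.

Definition next_ok q st := exists N,
  (exists2 out, next5 x f q N st = stop out &
     let: (h, II, SS) := out in exists2 Q, (Q <= q)%N & main_ok Q h II SS /\ (h = 0 \/ Q = q)) \/
  (exists st', [/\ next5 x f q N st = goto st', machine_inv q st' & (rank q st' < rank q st)%N]).

Lemma phase_joins Q h I SS : good h I SS -> size SS = Q.+1 -> 0 < h ->
  exists t0, forall b, (b < Q)%N -> consec X I (nth ord0 SS b) (t0 b).
Proof.
move=> G sz h0.
have /choice[t0 t0P] : forall b, exists t, (b < Q)%N -> consec X I (nth ord0 SS b) t.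
  move=> b; case: (ltnP b Q) => [bQ|]; last by exists ord0.
  by have [t [st _ _ _]] := good_join x_incr G sz h0 bQ; exists t.
by exists t0.
Qed.

Lemma next_main2 q qb h I SS : machine_inv q (Main2 qb h I SS) -> next_ok q (Main2 qb h I SS).
Proof.
move=> [[G sz att] qbq par]; exists 0%N; rewrite /=.
case: ifPn => [/orP stopc|].
  left; eexists; first reflexivity.
  exists qb => //; split=> //.
  by case: stopc => /eqP; [right|left].
rewrite negb_or => /andP[qne hne].
have h0 : 0 < h by rewrite lt_neqAle eq_sym hne (g_ge0 G).
have [j [u [v [-> [pj uv] luv [/andP[uj jv] Uj] Umin]]]] := jstar_spec x_incr G sz h0 (att h0).
rewrite /= pj /=; right; eexists; split; first reflexivity; last first.
  have : (qb.+1 < q)%N.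
    by rewrite ltn_neqAle (ltn_neqAle qb q) qne qbq !andbT; apply/eqP => E; move: par; rewrite -E /=; case: odd.
  by move: (q) (qb) => q' qb' lt /=; rewrite -(subnK lt) -addnBA //; nia.
have G1 := good_insert x_incr G sz h0 uv luv uj jv Uj Umin.
have sz1 := size_insert sz j u.
have [pp0 ppe ppa] := piece_price_spec x_incr G1 sz1 h0.
have [t0 t0P] := phase_joins G1 sz1 h0.
have qlt : (qb.+2 <= q)%N.
  rewrite ltn_neqAle (ltn_neqAle qb q) qne qbq !andbT; apply/eqP => E.
  by move: par; rewrite -E /=; case: odd.
split=> //; first by rewrite /= negbK.
(* The previous h serves as H. No join has been closed yet, so [e] and [hh] are dummies. *)
exists h, t0, (fun=> 0), (fun=> 0), t0; split=> //.
- split=> //; first exact: (piece_price_le x_incr G1 sz1 h0).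
  by case: ppa => [->|//]; rewrite ltxx.
- split=> //.
  by have := good_last G1 sz1.
- exact: (piece_price_le x_incr G1 sz1 h0).
- move=> b bQ _; split=> // i iI bi ib.
  by have /(consecP x_incr)[_ _ _ gap] := t0P b bQ; apply: (gap i).
Qed.

Lemma next_main3 q qb a ab c h I SS e0 I0 SS0 :
  machine_inv q (Main3 qb a ab c h I SS e0 I0 SS0) -> next_ok q (Main3 qb a ab c h I SS e0 I0 SS0).
Proof.
move=> [/andP[qb1 qbq] par [H [t0 [e [hh [t [ph sh /andP[a0 aQ] ca eh hH pr un la]]]]]]].
have h0 := le_trans (ph_e0 ph) eh.
case: (leqP a qb) => [aqb|qba].
  pose b := a.-1; have aE : a = b.+1 by rewrite /b prednK.
  have bQ : (b < qb)%N by rewrite -aE.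
  have [sE gap] := un b bQ ltac:(by rewrite aE).
  have [N [s [t1 [h1 [I1 [E cl sh1 agree _]]]]]] := phase_step ph sh bQ h0 sE gap.
  exists N; right; rewrite /= aqb {1}aE E /=.
  eexists; split; first reflexivity; last by rewrite /=; lia.
  have hh1 : h <= h1 by case: cl => J _ _; exact: ji_h J.
  have [ls lt] := phase_labels ph bQ.
  have h1H : h1 <= H := closed_join_le x_incr (ph_good ph) (ph_H ph) (ph_t ph bQ) ls lt hH cl.
  split; rewrite ?qb1 ?qbq //.
  exists H, t0, (fun k => if k == b then h else e k), (fun k => if k == b then h1 else hh k),
    (fun k => if k == b then t1 else t k).
  have sz' := sh_sz sh.
  split=> //.
  - by case: ifP => // _; apply: leqW.
  - exact: le_trans eh hh1.
  - move=> k kQ ka; have [->|kb] := eqVneq k b.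
      rewrite nth_set_nth /= eqxx; split=> //.
      case: eqP => [_|ne]; first by rewrite -aE ltnSn.
      by apply/negbTE; rewrite -leqNgt -aE.
    have ka' : (k.+1 < a)%N by move: kb ka; rewrite aE; lia.
    have [clk ek hk ck] := pr k kQ ka'.
    rewrite nth_set_nth /= (negbTE kb); split=> //.
    + exact: (closed_join_ext x_incr (agree k kQ kb) clk).
    + exact: le_trans hk hh1.
    + case: eqP => // h10; have hk0 : 0 <= hh k.
        case: clk => J _ _; apply: le_trans (ji_h J); exact: le_trans (ph_e0 ph) ek.
      have -> : hh k == 0 by rewrite eq_le hk0 andbT (le_trans hk) // -h10.
      by lia.
  - move=> k kQ ak; have kb : k != b by lia.
    have [sk gk] := un k kQ ltac:(lia).
    rewrite nth_set_nth /= (negbTE kb); split=> // i iI ki ik.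
    apply: (gk i) => //; rewrite (agree k kQ kb) //; exact: ltnW.
  - case: ltP => [hlt|hge].
      split=> //.
      + by rewrite a0 /=.
      + by rewrite /b eqxx.
      + move=> k ka; have kb : k != b by lia.
        rewrite (negbTE kb); have [_ _ hk _] := pr k ltac:(lia) ka.
        exact: le_lt_trans hk hlt.
      + by move=> k ak ka; have -> : k = b by [lia]; rewrite eqxx.
    have h1E : h1 = h by apply/le_anti; rewrite hge hh1.
    subst h1; move: la; rewrite /last_raise; case: (ab) => [al|].
      move=> [ala el lo hi]; split.
      + by lia.
      + have -> : (al.-1 == b) = false by lia.
        exact: el.
      + by move=> k kal; have -> : (k == b) = false by [lia]; apply: lo.
      + move=> k kal ka; case: eqP => // kb; apply: hi => //; lia.
    move=> [hE all]; split=> // k ka; case: eqP => // kb; apply: all; lia.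
exists 0%N; right; rewrite /= leqNgt qba /=.
have aE : a = qb.+1 by lia.
(* Without a raise, every join has been closed at the common value [e0]. *)
case: eqP => [hE|/eqP hne].
  eexists; split; first reflexivity; last by rewrite /=; lia.
  split=> //; have cl b : (b < qb)%N -> closed_join b (nth ord0 SS0 b) (t0 b) h (nth ord0 SS b) (t b) h I.
    move=> bQ; have [clb eb hb _] := pr b bQ ltac:(lia).
    have hbE : hh b = h.
      apply/le_anti; rewrite hb hE /=.
      by case: clb => J _ _; apply: le_trans eb (ji_h J).
    by rewrite hbE in clb; exact: closed_join_self clb.
  split.
  + exact: (phase_finish ph sh eh hH cl).
  + exact: sh_sz sh.
  + by move=> hp; move: cl hp; rewrite hE => cl hp; exact: (phase_att0 ph sh hp cl).
case: ab la => [al|] la; last by case: la => hE _; rewrite hE eqxx in hne.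
have [/andP[al0 ala] el lo hi] := la.
eexists; split; first reflexivity; last by rewrite /=; lia.
split; rewrite ?qb1 ?qbq //; exists al => //; exists e0, H, t0, e, hh, t; split=> //.
- by lia.
- by rewrite lt_neqAle eq_sym hne.
- move=> b bQ _; have [clb eb hb cb] := pr b bQ ltac:(lia).
  by split=> //; [apply: lo|move=> ?; apply: hi => //; lia].
Qed.

End Main.

(** * Steps 4 and 5, and the run as a whole *)

Section MainLoop.
Variables (R : realType) (n : nat) (x f : 'rV[R]_n.+1).
Hypothesis x_incr : forall i j : 'I_n.+1, (i < j)%N -> x 0 i < x 0 j.
Notation X := (X x).
Notation U := (U f).
Notation attained := (attained x f).
Notation closed_join := (closed_join x f).
Notation good := (good x f).
Let Xlt' := Xlt x_incr.
Let Xle' := Xle x_incr.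
Implicit Types (I J : {set 'I_n.+1}) (b k : nat) (h H : R) (SS : seq 'I_n.+1).

Lemma signed_join_grad b h (s t : 'I_n.+1) :
  (-1) ^+ b * join_grad x f b.+1 h s t = (U b t - 2 * h - U b s) / (X t - X s).
Proof.
rewrite /join_grad /U mulrA; congr (_ / _).
have := sign_sq R b; rewrite [b.+1.-1]/=; set g := (-1) ^+ b => sq.
transitivity (g * f 0 t - g * g * (2 * h) - g * f 0 s); first by ring.
by rewrite sq mul1r.
Qed.

Lemma signed_grad b (s t : 'I_n.+1) : (-1) ^+ b * grad x f s t = slope X (U b) s t.
Proof. by rewrite /U slope_scale. Qed.

(** The tests of step 4 are the two slope conditions of the join at the final h, each asked only if
    the chain concerned has an edge. If both pass, [closed_join_raise] applies. *)
Lemma next_main4 q qb a ab c h I SS I0 SS0 :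
  machine_inv x f q (Main4 qb a ab c h I SS I0 SS0) ->
  next_ok x f q (Main4 qb a ab c h I SS I0 SS0).
Proof.
move=> [/andP[qb1 qbq] par [al abE [e0 [H [t0 [e [hh [t I4]]]]]]]]; exists 0%N; right.
have [ph sh a0 /andP[aal alQ] eh hH dn td la] := I4.
pose b := a.-1; have aE : a = b.+1 by rewrite /b prednK.
have bQ : (b < qb)%N by rewrite -aE; apply: leq_trans aal alQ.
have h0 : 0 < h := le_lt_trans (ph_e0 ph) eh.
have [clb eb hblt hbeq cb] := td b bQ ltac:(by rewrite aE).
rewrite -aE in hblt hbeq cb.
have to5 : (a < al)%N -> exists st' : state5 R n,
    [/\ goto (Main5 qb a ab c h I SS I0 SS0) = goto st' :> option (state5 R n + R * {set 'I_n.+1} * seq 'I_n.+1),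
        machine_inv x f q st' & (rank q st' < rank q (Main4 qb a ab c h I SS I0 SS0))%N].
  move=> lt; eexists; split; first reflexivity; last by rewrite /= addn1 addn2.
  split; rewrite ?qb1 ?qbq //; exists al => //; split=> //.
  by exists e0, H, t0, e, hh, t.
rewrite /=; case: ifP => [ac|nac].
  (* A join before gamma was closed at 0 < h, so it is not the one that raised h to its final
     value. *)
  apply: to5; rewrite ltn_neqAle aal andbT; apply/eqP => aal'.
  have : hh b = h by apply: hbeq; rewrite aal'.
  by move: cb; rewrite ac => /esym/eqP -> E; rewrite -E ltxx in h0.
case: eqP => [abE'|abNE].
  move: abE; rewrite abE' => -[alE]; subst al.
  eexists; split; first reflexivity; last by rewrite /=; lia.
  have cl k : (k < qb)%N -> closed_join k (nth ord0 SS0 k) (t0 k) h (nth ord0 SS k) (t k) h I.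
    move=> kQ; case: (ltnP k.+1 a) => [ka|ak]; first exact: dn.
    have [clk _ _ hk _] := td k kQ ak.
    by rewrite (hk ak) in clk; exact: closed_join_self clk.
  split=> //; split.
  - exact: (phase_finish x_incr ph sh (ltW eh) hH cl).
  - exact: sh_sz sh.
  - move=> _; have hbE := hbeq (leqnn _); rewrite hbE in clb.
    exact: (phase_att x_incr ph sh (ltW eh) hH cl bQ (le_trans (ph_e0 ph) eb) la clb).
have alt : (a < al)%N by rewrite ltn_neqAle aal andbT; apply/eqP => E; apply: abNE; rewrite abE E.
have [J tl tr] := clb.
(* From gamma on, joins were closed at positive values, so their ends are distinct and they can be
   raised. *)
have hb0 : 0 < hh b.
  have ge0 : 0 <= hh b by apply: le_trans (ji_h J); exact: le_trans (ph_e0 ph) eb.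
  by rewrite lt_neqAle ge0 andbT eq_sym -cb nac.
set s := nth ord0 SS b in clb J tl tr *; set s0 := nth ord0 SS0 b in clb J tl tr *.
have bS : (b < size SS)%N by rewrite (sh_sz sh) ltnW.
have bS0 : (b < size SS0)%N by rewrite (ph_sz ph) ltnW.
rewrite -/b (onth_some ord0 bS) (onth_some ord0 bS0) /= -/s -/s0.
have lst : X s < X (t b).
  by rewrite lt_neqAle (ji_le2 J) andbT; apply/eqP => /(ji_eq J) E; rewrite E ltxx in hb0.
have st : consec X I s (t b).
  by split=> //; [exact: ji_mem2 J|exact: ji_mem3 J|exact: ji_gap J].
rewrite (consec_succ x_incr st) /= (consec_succ x_incr (ph_t ph bQ)) /=.
have next4 : (forall a', consec X I a' s -> X s0 <= X a' -> seg X (U b) a' s (t b) <= U b (t b) - 2 * h) ->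
    (forall c', consec X I (t b) c' -> X c' <= X (t0 b) -> U b s + 2 * h <= seg X (U b) (t b) c' s) ->
    exists st' : state5 R n,
    [/\ goto (Main4 qb a.+1 ab c h I SS I0 SS0) = goto st' :> option (state5 R n + R * {set 'I_n.+1} * seq 'I_n.+1),
        machine_inv x f q st' & (rank q st' < rank q (Main4 qb a ab c h I SS I0 SS0))%N].
  move=> L1 L2; eexists; split; first reflexivity; last by rewrite /=; move: bQ; rewrite -aE; clear; lia.
  split; rewrite ?qb1 ?qbq //; exists al => //; exists e0, H, t0, e, hh, t; split=> //.
  - by rewrite alt.
  - move=> k kQ; rewrite ltnS leq_eqVlt => /orP[/eqP ka|ka]; last exact: dn.
    have -> : k = b by rewrite /b -ka.
    apply: (closed_join_raise clb _ _ hb0 L1 L2); first exact: ltW (hblt alt).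
    exact: le_trans (ph_e0 ph) eb.
  - by move=> k kQ ak; apply: td => //; exact: ltnW.
have gE := signed_join_grad b h s (t b); rewrite -aE in gE.
have lt_st : 0 < X (t b) - X s by rewrite subr_gt0.
set g := (U b (t b) - 2 * h - U b s) / (X (t b) - X s) in gE.
have gM : g * (X (t b) - X s) = U b (t b) - 2 * h - U b s by rewrite divfK ?gt_eqF.
have right_part : (forall a', consec X I a' s -> X s0 <= X a' -> seg X (U b) a' s (t b) <= U b (t b) - 2 * h) ->
  exists st' : state5 R n,
    [/\ (let? t1 := succ_in I (t b)
      in if (t b < t0 b)%N && ((-1) ^+ b * join_grad x f a h s (t b) < (-1) ^+ b * grad x f (t b) t1)
         then goto (Main5 qb a ab c h I SS I0 SS0) else goto (Main4 qb a.+1 ab c h I SS I0 SS0))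
        = goto st' :> option (state5 R n + R * {set 'I_n.+1} * seq 'I_n.+1),
        machine_inv x f q st' & (rank q st' < rank q (Main4 qb a ab c h I SS I0 SS0))%N].
  move=> L1.
  have sNt : s != t b by apply: contraTneq lst => ->; rewrite ltxx.
  have [t1 t1E] := succ_in_some x_incr (ji_mem2 J) (ji_mem3 J) sNt.
  rewrite t1E /= gE signed_grad; case: ifPn => [_|ok]; first exact: to5.
  apply: next4 => // c' tc' c't0.
  have ltc : X (t b) < X c' by case: tc'.
  have t1c : t1 = c' by have := consec_succ x_incr tc'; rewrite t1E => -[].
  move: ok; rewrite -Xlt' (lt_le_trans ltc c't0) /= -leNgt t1c => ok.
  rewrite seg_slope; move: ok; set sl := slope _ _ _ _ => ok.
  have : sl * (X (t b) - X s) <= g * (X (t b) - X s) by rewrite ler_pM2r.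
  by rewrite gM; lra.
case: ltnP => [s0s|ss0] /=; last first.
  apply: right_part => a' a's s0a'; exfalso.
  have /(consecP x_incr)[_ _ lt _] := a's.
  by move: s0a'; rewrite Xle'; move: lt ss0; clear; lia.
have [sm [sms s0sm]] := prev_exists x_incr (ji_mem2 J) (ji_mem1 J) s0s.
rewrite (consec_pred x_incr sms) /= gE signed_grad; case: ltP => [_|ok]; first exact: to5.
rewrite -gE; apply: right_part => a' a's _.
have -> : a' = sm by have := consec_pred x_incr a's; rewrite (consec_pred x_incr sms) => -[].
have [_ _ ltsm _] := sms; rewrite seg_slope.
have : slope X (U b) sm s * (X (t b) - X s) <= g * (X (t b) - X s) by rewrite ler_pM2r.
have := slopeE (U b) ltsm; rewrite gM; lra.
Qed.

(** Deleting the inner elements restores the saved gap. As a precedes the last raising join, the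
    earlier closing ended below h, so the comparison clause of [phase_step] applies and h stays
    put. *)
Lemma next_main5 q qb a ab c h I SS I0 SS0 :
  machine_inv x f q (Main5 qb a ab c h I SS I0 SS0) ->
  next_ok x f q (Main5 qb a ab c h I SS I0 SS0).
Proof.
move=> [/andP[qb1 qbq] par [al abE [alt [e0 [H [t0 [e [hh [t I4]]]]]]]]].
have [ph sh a0 /andP[aal alQ] eh hH dn td la] := I4.
pose b := a.-1; have aE : a = b.+1 by rewrite /b prednK.
have bQ : (b < qb)%N by rewrite -aE; apply: leq_trans aal alQ.
have h0 : 0 < h := le_lt_trans (ph_e0 ph) eh.
have [clb eb hblt hbeq cb] := td b bQ ltac:(by rewrite aE).
rewrite -aE in hblt; have {}hblt := hblt alt.
pose I2 := I :\: [set i : 'I_n.+1 | (nth ord0 SS0 b < i < t0 b)%N].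
pose SS2 := set_nth ord0 SS b (nth ord0 SS0 b).
have sh2 : phase_shape qb SS0 t0 I0 I2 SS2.
  split.
  - by rewrite size_set_nth (sh_sz sh); apply/maxn_idPr; rewrite ltnS ltnW.
  - by rewrite nth_set_nth /= gtn_eqF // (sh_last sh).
  - move=> i out; rewrite finset.in_setD inE (sh_frame sh) //.
    rewrite (_ : (nth ord0 SS0 b < i < t0 b)%N = false) //.
    by apply/negP => /andP[]; exact: (out b bQ).
have sE2 : nth ord0 SS2 b = nth ord0 SS0 b by rewrite nth_set_nth /= eqxx.
have gap2 (i : 'I_n.+1) : i \in I2 -> (nth ord0 SS0 b < i)%N -> (i < t0 b)%N -> False.
  by rewrite finset.in_setD inE => /andP[/negP out _] si it; apply: out; rewrite si it.
have [N [s [t1 [h1 [I3 [E cl sh3 agree rerun]]]]]] := phase_step x_incr ph sh2 bQ (ltW h0) sE2 gap2.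
have h1E : h1 = h := rerun _ _ _ _ _ (le_trans (ph_e0 ph) eb) clb hblt.
subst h1.
have agree3 k : (k < qb)%N -> k != b -> forall i : 'I_n.+1, (nth ord0 SS0 k <= i)%N ->
    (i <= t0 k)%N -> (i \in I) = (i \in I3).
  move=> kQ kb i ki ik; rewrite -(agree k kQ kb i ki ik) finset.in_setD inE.
  suff -> : (nth ord0 SS0 b < i < t0 b)%N = false by [].
  apply/negbTE; rewrite negb_and -!leqNgt.
  exact: (phase_disjoint x_incr ph bQ kQ kb ki ik).
have bS0 : (b < size SS0)%N by rewrite (ph_sz ph) ltnW.
exists N; right; rewrite /= -/b (onth_some ord0 bS0) /=.
rewrite (consec_succ x_incr (ph_t ph bQ)) /= -/SS2 -/I2 {1}aE E /=.
eexists; split; first reflexivity; last by rewrite /=; move: bQ; rewrite -aE; clear; lia.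
have nthE k : k != b -> nth ord0 (set_nth ord0 SS2 b s) k = nth ord0 SS k.
  by move=> kb; rewrite !nth_set_nth /= (negbTE kb) nth_set_nth /= (negbTE kb).
split; rewrite ?qb1 ?qbq //; exists al => //.
exists e0, H, t0, e, hh, (fun k => if k == b then t1 else t k); split=> //.
- by rewrite alt.
- move=> k kQ ka; have [->|kb] := eqVneq k b; first by rewrite nth_set_nth /= eqxx.
  rewrite nthE //; have ka' : (k.+1 < a)%N by move: kb ka; rewrite aE; clear; lia.
  exact: (closed_join_ext x_incr (agree3 k kQ kb) (dn k kQ ka')).
- move=> k kQ ak; have kb : k != b by move: ak; rewrite aE; clear; lia.
  rewrite (negbTE kb) nthE //; have [clk ek h1k h2k ck] := td k kQ (ltnW ak).
  by split=> //; exact: (closed_join_ext x_incr (agree3 k kQ kb) clk).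
Qed.

Lemma run_main q Q h I SS : main_ok x f Q h I SS -> (Q <= q)%N -> odd Q = odd q ->
  exists N h1 I1 SS1 Q1, [/\ run (next5 x f q N) N (Main2 Q h I SS) = Some (h1, I1, SS1),
    (Q1 <= q)%N, main_ok x f Q1 h1 I1 SS1 & h1 = 0 \/ Q1 = q].
Proof.
move=> ok Qq par.
pose Post (out : R * {set 'I_n.+1} * seq 'I_n.+1) := let: (h, II, SS) := out in
  exists2 Q, (Q <= q)%N & main_ok x f Q h II SS /\ (h = 0 \/ Q = q).
have [|||N [[[h1 I1] SS1] E [Q1 Q1q [ok1 fin]]]] :=
  @run_total _ _ (next5 x f q) (machine_inv x f q) (rank q) Post _ _ (Main2 Q h I SS).
- by move=> N M st r le; exact: next5_mono le st r.
- case=> *.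
  + exact: next_main2.
  + exact: next_main3.
  + exact: next_main4.
  + exact: next_main5.
- by [].
- by exists N, h1, I1, SS1, Q1.
Qed.

(** One more insertion gives Q + 2 joins at the same h, and [good_lower] then yields at least Q + 1
    sign changes. *)
Lemma main_lower Q h I SS (w : 'rV[R]_n.+1) : main_ok x f Q h I SS -> 0 < h ->
  (sign_changes x w <= Q)%N -> h <= F f w.
Proof.
move=> [G sz att] h0 wQ; rewrite leNgt; apply/negP => Fw.
have [j [u [v [_ [_ uv] luv [/andP[uj jv] Uj] Umin]]]] := jstar_spec x_incr G sz h0 (att h0).
have G1 := good_insert x_incr G sz h0 uv luv uj jv Uj Umin.
have sz1 := size_insert sz j u.
have := good_lower x_incr G1 sz1 h0 Fw.
by rewrite /= leqNgt ltnS wQ.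
Qed.

End MainLoop.

(** * Initial states and conclusion *)

Section Start.
Variables (R : realType) (n : nat) (x f : 'rV[R]_n.+2).
Hypothesis x_incr : forall i j : 'I_n.+2, (i < j)%N -> x 0 i < x 0 j.

(** The first closing is a phase with a single gap, started at 0 from the state of
    [good_two_pieces]. *)
Lemma start_odd : exists N h I SS,
  closejoin x f N 1 0 [set ord0; ord_max] [:: ord0; ord_max] = Some (h, I, SS) /\
  main_ok x f 1 h I SS.
Proof.
have [H H0 G] := good_two_pieces f x_incr.
pose t0 : nat -> 'I_n.+2 := fun=> ord_max.
pose S0 : seq 'I_n.+2 := [:: ord0; ord_max].
have con := ends_consec x_incr.
have only a c : consec (X x) [set ord0; ord_max] a c -> a = ord0 /\ c = ord_max.
  move=> [+ + ac _]; rewrite !in_set2 => /orP[]/eqP ? /orP[]/eqP ?; subst => //.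
  - by rewrite ltxx in ac.
  - by move: ac; rewrite (Xlt x_incr).
  - by rewrite ltxx in ac.
have ph : join_phase x f 1 H 0 [set ord0; ord_max] S0 t0.
  split=> //; first exact: ltW.
  - by move=> b; rewrite ltnS leqn0 => /eqP ->.
  - by move=> a c /only[-> ->]; rewrite /lab /= ltnn.
  - by rewrite ltxx.
have sh : phase_shape 1 S0 t0 [set ord0; ord_max] [set ord0; ord_max] S0 by split.
have gap (i : 'I_n.+2) : i \in [set ord0; ord_max] -> (nth ord0 S0 0 < i)%N -> (i < t0 0%N)%N -> False.
  by rewrite in_set2 => /orP[]/eqP ->; rewrite ?ltnn.
have [N [s [t1 [h1 [I1 [E cl sh1 _ _]]]]]] := phase_step x_incr ph sh (ltn0Sn 0) (lexx 0) erefl gap.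
exists N, h1, I1, (set_nth ord0 S0 0 s); split=> //.
have [ls lt] := phase_labels x_incr ph (ltn0Sn 0).
have h1H : h1 <= H := closed_join_le x_incr (ph_good ph) H0 (ph_t ph (ltn0Sn 0)) ls lt (ltW H0) cl.
have h10 : 0 <= h1 by case: cl => J _ _; exact: ji_h J.
have cls b : (b < 1)%N -> closed_join x f b (nth ord0 S0 b) (t0 b) h1
    (nth ord0 (set_nth ord0 S0 0 s) b) t1 h1 I1.
  by rewrite ltnS leqn0 => /eqP ->; exact: closed_join_self cl.
split.
- exact: (phase_finish (t := fun=> t1) x_incr ph sh1 h10 h1H cls).
- exact: sh_sz sh1.
- move=> h1p.
  exact: (phase_att (t := fun=> t1) x_incr ph sh1 h10 h1H cls (ltn0Sn 0) (lexx 0) h1p cl).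
Qed.

Lemma start_even : main_ok x f 0 (price x 1 f ord0 ord_max) (hull x 1 f ord0 ord_max) [:: ord_max].
Proof. by have [G att] := good_hull0 f x_incr; split. Qed.

Lemma algorithm5_ok q : exists N h I SS Q, [/\ algorithm5 x f q N = Some (h, I, SS),
  (Q <= q)%N, main_ok x f Q h I SS & h = 0 \/ Q = q].
Proof.
rewrite /algorithm5; case qodd : (odd q).
  have [N1 [h0 [I0 [SS0 [E0 ok0]]]]] := start_odd.
  have q1 : (1 <= q)%N by case: (q) qodd.
  have [N2 [h [I [SS [Q [E Qq ok fin]]]]]] := run_main x_incr ok0 q1 (esym qodd).
  exists (maxn N1 N2), h, I, SS, Q; split=> //.
  rewrite (closejoin_mono (leq_maxl N1 N2) E0) /=.
  by apply: (run_mono _ (leq_maxr N1 N2) E) => st r; apply: next5_mono; exact: leq_maxr.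
have [N [h [I [SS [Q [E Qq ok fin]]]]]] := run_main x_incr start_even (leq0n q) (esym qodd).
by exists N, h, I, SS, Q.
Qed.

End Start.

Local Open Scope classical_set_scope.

(* There are n+2 data points, indexed by 'I_n.+2. *)
Theorem theorem5 (R : realType) (n : nat) (x f : 'rV[R]_n.+2) (q : nat)
    (x_incr : forall i j : 'I_n.+2, (i < j)%N -> x 0 i < x 0 j) :
  exists (N : nat) (h : R) (I : {set 'I_n.+2}) (S : seq 'I_n.+2),
    [/\ algorithm5 x f q N = Some (h, I, S),
        0 <= h,
        (ord0 \in I) /\ (ord_max \in I),
        piece_set I S &
        exists y : 'rV[R]_n.+2,
          [/\ unique (is_y x f h I S) y,
              h = F f y,
              F f y = inf [set F f v | v in Y x q] &
              Y x q y]].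
Proof.
have [N [h [I [SS [Q [E Qq ok fin]]]]]] := algorithm5_ok f x_incr q.
have [G sz att] := ok.
exists N, h, I, SS; split=> //.
- exact: g_ge0 G.
- by split; [exact: g_ord0 G|exact: good_max G].
- exact: g_pieces G.
pose y := yfull x f h I SS.
have yF : F f y = h := yfull_dist x_incr G sz.
have yY : Y x q y by apply: leq_trans (yfull_changes x_incr G sz) Qq.
exists y; split=> //; first exact: (yfull_unique x_incr G sz).
(* An early stop has h = 0, where the bound is trivial; otherwise the state has exactly q + 1
   pieces. *)
have lb : lbound [set F f v | v in Y x q] h.
  move=> _ [v vY <-]; case: fin => [->|QE]; first exact: normr_ge0.
  have [->|hn] := eqVneq h 0; first exact: normr_ge0.
  have h0 : 0 < h by rewrite lt_neqAle eq_sym hn (g_ge0 G).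
  by apply: (main_lower x_incr ok h0); rewrite QE.
have mem : [set F f v | v in Y x q] h by exists y.
rewrite yF; apply/le_anti/andP; split.
- by apply: lb_le_inf => //; exists h.
- by apply: ge_inf => //; exists h.
Qed.
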